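(* Let $d\geqslant 2$, $N\geqslant 1$, $1<p<\infty$, $A,B\in\mathbb{C}^{N,N}$ and $S\in\mathbb{R}^{d,d}$ be such that $S$ is skew-symmetric and there exists $\gamma_A>0$ with $$|z|^2\,\mathrm{Re}\langle w,Aw\rangle+(p-2)\,\mathrm{Re}\langle w,z\rangle\,\mathrm{Re}\langle z,Aw\rangle\geqslant\gamma_A|z|^2|w|^2\quad\text{for all }z,w\in\mathbb{C}^N.$$ Let $\beta_B\in\mathbb{R}$ be such that $\mathrm{Re}\langle w,Bw\rangle\geqslant-\beta_B$ for all $w\in\mathbb{C}^N$ with $|w|=1$. Let $\lambda\in\mathbb{C}$ with $\mathrm{Re}\,\lambda>\beta_B$, let $g\in L^p(\mathbb{R}^d,\mathbb{C}^N)$, and let $v_\star\in\mathcal{D}^p_{\mathrm{loc}}(\mathcal{L}_0)$ be a solution of $$(\lambda I-\mathcal{L}_\infty)v=g\quad\text{in }L^p(\mathbb{R}^d,\mathbb{C}^N).$$ Then $v_\star$ is the unique solution in $\mathcal{D}^p_{\mathrm{loc}}(\mathcal{L}_0)$ and satisfies the resolvent estimate $$\|v_\star\|_{L^p(\mathbb{R}^d,\mathbb{C}^N)}\leqslant\frac{1}{\mathrm{Re}\,\lambda-\beta_B}\|g\|_{L^p(\mathbb{R}^d,\mathbb{C}^N)}.$$ In addition, for $1<p\leqslant 2$ the following gradient estimate holds: $$|v_\star|_{W^{1,p}(\mathbb{R}^d,\mathbb{C}^N)}\leqslant\frac{d^{\frac1p}\gamma_A^{-\frac12}}{(\mathrm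{Re}\,\lambda-\beta_B)^{\frac12}}\|g\|_{L^p(\mathbb{R}^d,\mathbb{C}^N)}.$$
   Context: $\langle u,v\rangle:=\overline{u}^Tv$ is the standard inner product on $\mathbb{C}^N$ and $|\cdot|$ the Euclidean norm. For $v:\mathbb{R}^d\to\mathbb{C}^N$, $A\triangle v(x)=A\sum_{i=1}^d\frac{\partial^2}{\partial x_i^2}v(x)$ and $\langle Sx,\nabla v(x)\rangle:=\sum_{i=1}^d(Sx)_i\frac{\partial}{\partial x_i}v(x)$ (weak derivatives). The operator $\mathcal{L}_\infty$ is $$[\mathcal{L}_\infty v](x)=A\triangle v(x)+\langle Sx,\nabla v(x)\rangle-Bv(x),$$ considered in $L^p(\mathbb{R}^d,\mathbb{C}^N)$ with domain $$\mathcal{D}^p_{\mathrm{loc}}(\mathcal{L}_0):=\left\{v\in W^{2,p}_{\mathrm{loc}}(\mathbb{R}^d,\mathbb{C}^N)\cap L^p(\mathbb{R}^d,\mathbb{C}^N)\mid A\triangle v+\langle S\cdot,\nabla v\rangle\in L^p(\mathbb{R}^d,\mathbb{C}^N)\right\}.$$ Norms: $\|v\|_{L^p}=\left(\int_{\mathbb{R}^d}|v(x)|^p\,dx\right)^{1/p}$ and $|v|_{W^{1,p}(\mathbb{R}^d,\mathbb{C}^N)}:=\left(\sum_{j=1}^d\|D_jv\|_{L^p(\mathbb{R}^d,\mathbb{C}^N)}^p\right)^{1/p}$, where $D_j=\partial/\partial x_j$. *)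

(* Defs.v *)
From HB Require Import structures.
From mathcomp Require Import all_boot all_order all_algebra.
From mathcomp Require Import complex.
From mathcomp Require Import all_classical all_reals all_analysis.

Set Implicit Arguments.
Unset Strict Implicit.
Unset Printing Implicit Defensive.

Import Order.TTheory GRing.Theory Num.Theory.
Import numFieldNormedType.Exports.

Local Open Scope classical_set_scope.
Local Open Scope ring_scope.
Local Open Scope complex_scope.

(* The sigma-algebra generated by the coordinates of R^d, i.e. the Borel
   sigma-algebra, as the library does for n.-tuple T. *)
Section measurable_cV.
Context {R : realType} (d : nat).

Let coord (i : 'I_d) (x : 'cV[R]_d) : measurableTypeR R := x i 0.

Let cV_set0 : g_sigma_preimage coord set0.
Proof. exact: sigma_algebra0. Qed.

Let cV_setC A : g_sigma_preimage coord A -> g_sigma_preimage coord (~` A).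
Proof. exact: sigma_algebraC. Qed.

Let cV_bigcup (F : (set 'cV[R]_d)^nat) :
  (forall i, g_sigma_preimage coord (F i)) ->
  g_sigma_preimage coord (\bigcup_i (F i)).
Proof. exact: sigma_algebra_bigcup. Qed.

HB.instance Definition _ := @isMeasurable.Build default_measure_display
  'cV[R]_d (g_sigma_preimage coord) cV_set0 cV_setC cV_bigcup.

Lemma measurable_coord (i : 'I_d) :
  measurable_fun [set: 'cV[R]_d] (fun x => coord i x).
Proof.
move=> _ Y mY; rewrite setTI; apply: sub_sigma_algebra => /=.
rewrite -bigcup_seq/=; exists i => /=; first by rewrite mem_index_enum.
by exists Y => //; rewrite setTI.
Qed.

Lemma measurable_fun_coord d1 (T1 : measurableType d1) (f : T1 -> 'cV[R]_d) :
  (forall i, measurable_fun [set: T1] (fun t => coord i (f t))) ->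
  measurable_fun [set: T1] f.
Proof.
move=> mf; apply: (@measurability _ _ _ _ _ _
    (\big[setU/set0]_(i < d) preimage_set_system setT (coord i) measurable)) => //.
move=> _ [B + <-].
rewrite -bigcup_seq => -[i /= _ [C mC <-]].
by rewrite setTI; exact: mf.
Qed.
End measurable_cV.

Section lebesgue_cV.
Context {R : realType}.

Definition cons_cV d (vt : 'cV[R]_d * measurableTypeR R) : 'cV[R]_d.+1 :=
  col_mx (vt.2 : R)%:M vt.1.

Lemma measurable_cons_cV d : measurable_fun setT (@cons_cV d).
Proof.
apply: measurable_fun_coord => i.
case: (@split_ordP 1 d i) => j ->.
  rewrite (_ : (fun _ => _) = snd) //.
  by apply/funext => -[v t] /=; rewrite /cons_cV (@col_mxEu _ 1 d) !mxE !ord1.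
rewrite (_ : (fun _ => _) = (fun v : 'cV[R]_d => v j 0 : measurableTypeR R) \o fst).
  by apply: measurableT_comp => //; exact: measurable_coord.
by apply/funext => -[v t] /=; rewrite /cons_cV (@col_mxEd _ 1 d).
Qed.

Section cons_measure.
Variables (d : nat) (mu : {measure set 'cV[R]_d -> \bar R}).

Definition cons_measure : set 'cV[R]_d.+1 -> \bar R :=
  pushforward (mu \x lebesgue_measure)%E (@cons_cV d).

Let cons_measure0 : cons_measure set0 = 0%E.
Proof. by rewrite /cons_measure /pushforward preimage_set0 measure0. Qed.

Let cons_measure_ge0 A : (0 <= cons_measure A)%E.
Proof. exact: (measure_ge0 (mu \x lebesgue_measure)%E). Qed.

Let cons_measure_sigma_additive : semi_sigma_additive cons_measure.
Proof.
move=> F mF tF mUF; rewrite /cons_measure /pushforward preimage_bigcup.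
have mpre A : measurable A -> measurable (@cons_cV d @^-1` A).
  by move=> mA; rewrite -[X in measurable X]setTI; exact: measurable_cons_cV.
apply: (measure_semi_sigma_additive (s := (mu \x lebesgue_measure)%E)).
- by move=> n; exact: mpre.
- apply/trivIsetP => /= i j _ _ ij; rewrite -preimage_setI.
  by move/trivIsetP : tF => /(_ _ _ _ _ ij) ->//; rewrite preimage_set0.
- by rewrite -preimage_bigcup; exact: mpre.
Qed.

HB.instance Definition _ := isMeasure.Build _ _ _ cons_measure
  cons_measure0 cons_measure_ge0 cons_measure_sigma_additive.
End cons_measure.

Fixpoint lebesgue_cV d : {measure set 'cV[R]_d -> \bar R} :=
  match d with
  | 0 => \d_(0 : 'cV[R]_0)
  | d'.+1 => cons_measure (lebesgue_cV d')
  end.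

Lemma lebesgue_cV_prod d (X : 'I_d -> set (measurableTypeR R)) :
  (forall i, measurable (X i)) ->
  lebesgue_cV d [set x | forall i, X i (x i 0)] =
  (\prod_(i < d) lebesgue_measure (X i))%E.
Proof.
elim: d X => [|d IH] X mX.
  by rewrite big_ord0 /= diracE mem_set// => -[].
rewrite big_ord_recl muleC -IH; last by move=> i; exact: mX.
pose Y : set 'cV[R]_d := [set x | forall i : 'I_d, X (lift ord0 i) (x i 0)].
have YE : Y = \bigcap_(i in [set: 'I_d])
    [set x : 'cV[R]_d | X (lift ord0 i) (x i 0)].
  by apply/seteqP; split => x /= Xx i => [_|]; exact: Xx.
have mY : measurable Y.
  rewrite YE; apply: fin_bigcap_measurable => // i _.
  by rewrite -[Z in measurable Z]setTI; exact: measurable_coord (mX _).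
rewrite -(product_measure1E (lebesgue_cV d) _ mY (mX ord0)) /=.
rewrite /cons_measure /pushforward; congr (product_measure1 _ _ _).
apply/seteqP; split => [[v t] /= H|[v t] /= [Hv Ht] i].
  split=> [i|].
    have := H (rshift 1 i); rewrite (@col_mxEd _ 1 d) /=.
    by rewrite (_ : rshift 1 i = lift ord0 i)//; exact: val_inj.
  have := H (@lshift 1 d 0); rewrite (@col_mxEu _ 1 d) mxE eqxx /=.
  by rewrite (_ : @lshift 1 d 0 = ord0)//; exact: val_inj.
rewrite /cons_cV; case: (@split_ordP 1 d i) => j ->.
  rewrite (@col_mxEu _ 1 d) mxE !ord1 eqxx /=.
  by rewrite (_ : @lshift 1 d 0 = ord0)//; exact: val_inj.
rewrite (@col_mxEd _ 1 d) /=.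
by rewrite (_ : rshift 1 j = lift ord0 j)//; exact: val_inj.
Qed.
End lebesgue_cV.

Section complex_vectors.
Context {R : realType} {N : nat}.
Implicit Types u v : 'cV[R[i]]_N.

Definition inner u v : R[i] := ((map_mx conjc u)^T *m v) 0 0.

(* Real-valued, unlike the norm of R[i]; inner v v is a nonnegative real. *)
Definition enorm v : R := Num.sqrt (complex.Re (inner v v)).
End complex_vectors.

Section function_spaces.
Context {R : realType} {d N : nat}.
Notation C := R[i].
Notation leb := (@lebesgue_cV R d).
Implicit Types v w : 'cV[R]_d -> 'cV[C]_N.

Definition measurable_cVfun v := forall k : 'I_N,
  measurable_fun setT (fun x => complex.Re (v x k 0)) /\
  measurable_fun setT (fun x => complex.Im (v x k 0)).

Definition cV_integral v : 'cV[C]_N :=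
  \col_k ((\int[leb]_x complex.Re (v x k 0)) +i*
          (\int[leb]_x complex.Im (v x k 0))).

Definition Lpnorm (p : R) v : \bar R :=
  ('N[leb]_(p%:E)[EFin \o (enorm \o v)])%E.

Definition in_Lp (p : R) v := measurable_cVfun v /\ (Lpnorm p v < +oo)%E.

Definition in_Lp_loc (p : R) v := measurable_cVfun v /\
  forall K : set 'cV[R]_d, compact K ->
    (\int[leb]_(x in K) (enorm (v x) `^ p)%:E < +oo)%E.

Definition partial (i : 'I_d) (phi : 'cV[R]_d -> R) : 'cV[R]_d -> R :=
  fun x => 'D_(delta_mx i 0) (phi : 'cV[R]_d -> R^o) x.

Definition smooth (phi : 'cV[R]_d -> R) := forall s : seq 'I_d,
  continuous (foldr partial phi s) /\
  forall i x, derivable (foldr partial phi s : _ -> R^o) x (delta_mx i 0).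

Definition test_function (phi : 'cV[R]_d -> R) :=
  smooth phi /\ compact (closure [set x | phi x != 0]).

Definition is_weakD (i : 'I_d) v w :=
  [/\ in_Lp_loc 1 v, in_Lp_loc 1 w & forall phi, test_function phi ->
    cV_integral (fun x => (partial i phi x)%:C *: v x) =
    - cV_integral (fun x => (phi x)%:C *: w x)].

(* A representative of the weak derivative D_i v, which is unique up to
   a null set. Junk value: 0 when v has no weak derivative in direction i. *)
Definition weakD (i : 'I_d) v : 'cV[R]_d -> 'cV[C]_N :=
  xget (fun=> 0) [set w | is_weakD i v w].

Definition weakly_derivable (i : 'I_d) v := exists w, is_weakD i v w.

Definition W2p_loc (p : R) v :=
  [/\ in_Lp_loc p v,
      forall i, weakly_derivable i v /\ in_Lp_loc p (weakD i v) &
      forall i j, weakly_derivable j (weakD i v) /\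
                  in_Lp_loc p (weakD j (weakD i v))].

Definition W1p_seminorm (p : R) v : \bar R :=
  ((\sum_(j < d) Lpnorm p (weakD j v) `^ p) `^ p^-1)%E.

(* The drift <S x, grad v(x)>. *)
Definition drift (S : 'M[R]_d) v : 'cV[R]_d -> 'cV[C]_N :=
  fun x => \sum_(i < d) ((S *m x) i 0)%:C *: weakD i v x.

Definition L0 (A : 'M[C]_N) (S : 'M[R]_d) v : 'cV[R]_d -> 'cV[C]_N :=
  fun x => A *m (\sum_(i < d) weakD i (weakD i v) x) + drift S v x.

Definition Linfty (A B : 'M[C]_N) (S : 'M[R]_d) v : 'cV[R]_d -> 'cV[C]_N :=
  fun x => L0 A S v x - B *m v x.

Definition dom_loc (p : R) (A : 'M[C]_N) (S : 'M[R]_d) v :=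
  [/\ W2p_loc p v, in_Lp p v & in_Lp p (L0 A S v)].

(* Equality in L^p is equality almost everywhere. *)
Definition resolvent_solution (A B : 'M[C]_N) (S : 'M[R]_d) (lambda : C)
    (g v : 'cV[R]_d -> 'cV[C]_N) :=
  {ae leb, forall x, lambda *: v x - Linfty A B S v x = g x}.
End function_spaces.

(* Main.v *)
(* Idea.  Mollify the solution with a smooth radial kernel.  Since S is
   skew-symmetric, the drift <Sx, grad> generates rotations and commutes with
   convolution by a radial kernel, so the mollified u is a classical solution
   of the same equation with mollified right-hand side G.  Pairing the equation
   with chi q^((p-2)/2) u, where q = |u|^2 + eps and chi is a quadratic cut-off,
   is an energy identity: the drift integrates to zero (S is skew and chi is
   radial), the L^p-dissipativity of A bounds the diffusion term from below by
   gamma_A chi q^((p-2)/2) |Du|^2, and Young's inequality absorbs G.  Letting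
   eps -> 0 and the cut-off radius tend to infinity gives the L^p bound and
   weighted gradient control; for p <= 2 the latter bounds |D_j u|^p by AM-GM.
   Convolution does not increase L^p norms, and along a sequence of kernels
   converging almost everywhere Fatou's lemma transfers both bounds to the weak
   solution.  Uniqueness is the L^p bound for a difference of solutions, with
   zero right-hand side.  Everything is done over the reals, C^N = R^(2N). *)
From HB Require Import structures.
Require Import Defs.
From mathcomp Require Import all_boot all_order all_algebra.
From mathcomp Require Import complex.
From mathcomp Require Import all_classical all_reals all_analysis.
From mathcomp Require Import measurable_realfun ring lra.

Set Implicit Arguments.
Unset Strict Implicit.
Unset Printing Implicit Defensive.

Import Order.TTheory GRing.Theory Num.Theory.
Import numFieldNormedType.Exports.

Local Open Scope classical_set_scope.
Local Open Scope ring_scope.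

(** * Translations in L^1 *)

(** A weak solution is only locally in W^(2,p), and for p < 2 the weight |u|^(p-2) is singular at
    the zeros of u; hence the mollification and the added eps. On mollified functions every term of
    the energy identity is continuous, and integration by parts reduces to one fact: a continuous
    derivative of a compactly supported function has integral zero. The constants come from kappa =
    Re lambda - beta_B, the coercivity constant of lambda + B. Testing and Young's inequality bound
    kappa int |u|^p + (p gamma_A / 2) int q^((p-2)/2) |Du|^2 by kappa^(1-p) int |G|^p in the limit.
    The first term alone gives the factor 1/kappa; AM-GM on both terms gives (gamma_A kappa)^(-p/2)
    for each |D_j u|^p, and the sum over d directions produces d^(1/p). The errors are of two kinds:
    the gradient of the cut-off costs a multiple of 1/r times int |u|^p, while eps costs a multiple
    of the measure of the cut-off region. Therefore eps is chosen after the radius r. *)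

Section lebesgue_space.
Context {R : realType} {d : nat}.
Notation E := 'cV[R]_d.
Notation mu := (@lebesgue_cV R d).

Definition cube (r : R) : set E := [set x | forall i, `|x i 0| <= r].

Lemma measurable_rect (X : 'I_d -> set (measurableTypeR R)) :
  (forall i, measurable (X i)) -> measurable [set x : E | forall i, X i (x i 0)].
Proof.
move=> mX.
have -> : [set x : E | forall i, X i (x i 0)] =
    \bigcap_(i in [set: 'I_d]) [set x : E | X i (x i 0)].
  by apply/seteqP; split => x /= Xx i => [_|]; exact: Xx.
apply: fin_bigcap_measurable => // i _.
by rewrite -[Z in measurable Z]setTI; exact: measurable_coord (mX _).
Qed.

Lemma cubeE r : cube r = [set x : E | forall i,
  (fun=> (`[- r, r]%classic : set (measurableTypeR R))) i (x i 0)].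
Proof.
by apply/seteqP; split=> x H i; move: (H i); rewrite /= in_itv/= ler_norml.
Qed.

Lemma measurable_cube r : measurable (cube r).
Proof.
by rewrite cubeE; apply: (@measurable_rect (fun=> _)) => i; exact: measurable_itv.
Qed.

Lemma cube_fin r : (mu (cube r) < +oo)%E.
Proof.
rewrite cubeE (@lebesgue_cV_prod _ _ (fun=> _)); last by move=> i; exact: measurable_itv.
suff : (\prod_(i < d) lebesgue_measure (`[(- r)%R, r]%classic : set (measurableTypeR R)))%E \is a fin_num.
  by rewrite fin_numElt => /andP[].
elim/big_ind: _ => // [x y|i _]; first exact: fin_numM.
by rewrite lebesgue_measure_itv /=; case: ifP.
Qed.

Lemma cube_cover : \bigcup_n cube n%:R = setT.
Proof.
apply/seteqP; split => // x _.
have [n Hn] : exists n : nat, forall i, `|x i 0| <= n%:R.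
  pose f i := Num.trunc `|x i 0|.
  exists (\max_i f i).+1 => i.
  apply/ltW/(lt_le_trans (truncnS_gt _)).
  by rewrite ler_nat ltnS; exact: (@leq_bigmax _ f).
by exists n.
Qed.

Lemma subset_cube (r s : R) : r <= s -> cube r `<=` cube s.
Proof. by move=> rs x + i => /(_ i) /le_trans; exact. Qed.


Lemma sigma_finite_lebesgue_cV : sigma_finite [set: E] mu.
Proof.
exists (fun n => cube n%:R); first by rewrite cube_cover.
by move=> n; split; [exact: measurable_cube|exact: cube_fin].
Qed.

(* A copy of lebesgue_cV which is inferred to be sigma-finite, as Tonelli needs. *)
Definition leb : set E -> \bar R := mu.
HB.instance Definition _ := Measure.copy leb mu.
HB.instance Definition _ :=
  Measure_isSigmaFinite.Build _ _ _ leb sigma_finite_lebesgue_cV.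

(** A translation preserves the length of the intervals ]b, c], and these determine Lebesgue
    measure. *)
Lemma lebesgue_measure_shift (a : R) (X : set (measurableTypeR R)) :
  measurable X -> lebesgue_measure [set t | X (a + t)] = lebesgue_measure X.
Proof.
move=> mX.
have mphi : measurable_fun setT (fun t : measurableTypeR R => (a + t : measurableTypeR R)).
  exact: measurable_funD.
apply/esym.
pose f : {mfun (measurableTypeR R) >-> (measurableTypeR R)} :=
  HB.pack (fun t : measurableTypeR R => (a + t : measurableTypeR R))
   (isMeasurableFun.Build _ _ _ _ _ mphi).
rewrite (@lebesgue_measure_unique _ (pushforward lebesgue_measure f))//.
move=> _ [[b c]/= _ <-].
rewrite lebesgue_measure_itv /= /pushforward.
rewrite (_ : _ @^-1` _ = `]b - a, c - a]%classic); last first.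
  by apply/seteqP; split=> t /=; rewrite !in_itv/= ltrBlDl lerBrDl.
by rewrite lebesgue_measure_itv /= !lte_fin ltrD2r; case: ifP => // _; rewrite -!EFinB; congr (_%:E); ring.
Qed.

Lemma measurable_shift (a : E) : measurable_fun setT (fun x : E => a + x).
Proof.
apply: measurable_fun_coord => i.
rewrite (_ : (fun _ => _) = fun x : E => (a i 0 + x i 0)%R :> measurableTypeR R); last first.
  by apply/funext => x; rewrite mxE.
by apply: measurable_funD => //; exact: measurable_coord.
Qed.

Definition rect (A : set E) := exists2 X : 'I_d -> set (measurableTypeR R),
  (forall i, measurable (X i)) & A = [set x : E | forall i, X i (x i 0)].

(** The generators are preimages under a single coordinate, which are rectangles with all other
    sides full. Rectangles, unlike these generators, are stable under intersection, as the
    uniqueness theorem for measures requires. *)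
Lemma measurable_rectE : @measurable _ E = <<s rect >>.
Proof.
apply/seteqP; split => A.
  apply: smallest_sub; first exact: smallest_sigma_algebra.
  rewrite -bigcup_seq => B [i /= _ [C mC <-]]; apply: sub_sigma_algebra.
  exists (fun j => if j == i then C else setT); first by move=> j; case: ifP.
  rewrite setTI; apply/seteqP; split=> x /=.
    by move=> Cx j; case: ifP => // /eqP ->.
  by move=> /(_ i); rewrite eqxx.
apply: smallest_sub; first exact: sigma_algebra_measurable.
by move=> _ [X mX ->]; exact: measurable_rect.
Qed.

(** The measure and its push-forward by the translation agree on rectangles, by the one-dimensional
    case in each factor, and are finite on the cubes that exhaust the space. *)
Lemma lebesgue_cV_shift (a : E) (A : set E) : measurable A ->
  mu [set x | A (a + x)] = mu A.
Proof.
move=> mA.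
pose f : {mfun E >-> E} :=
  HB.pack (fun x : E => a + x) (isMeasurableFun.Build _ _ _ _ _ (measurable_shift a)).
apply/esym; apply: (measure_unique rect (fun n => cube n%:R) measurable_rectE _ _ cube_cover mu (pushforward mu f)) => //.
- move=> _ _ [X mX ->] [Y mY ->]; exists (fun i => X i `&` Y i).
    by move=> i; exact: measurableI.
  apply/seteqP; split=> x /=; first by move=> [Xx Yx] i; split.
  by move=> XYx; split=> i; case: (XYx i).
- by move=> n; rewrite cubeE; exists (fun=> `[- n%:R, n%:R]%classic) => // i; exact: measurable_itv.
- move=> _ [X mX ->].
  transitivity (mu [set x : E | forall i, [set t : measurableTypeR R | X i (a i 0 + t)] (x i 0)]); last first.
    by congr (mu _); apply/seteqP; split=> x /= Xx i; move: (Xx i); rewrite mxE.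
  rewrite (lebesgue_cV_prod (X := fun i => [set t : measurableTypeR R | X i (a i 0 + t)])).
    by rewrite lebesgue_cV_prod//; apply: eq_bigr => i _; rewrite lebesgue_measure_shift.
  move=> i; have := @measurable_funD _ _ _ setT (cst (a i 0)) (@idfun (measurableTypeR R)).
  move=> /(_ (measurable_cst _) (@measurable_id _ _ _) measurableT _ (mX i)).
  by rewrite setTI.
- by move=> n; exact: cube_fin.
Qed.

Lemma ge0_integral_shift (a : E) (f : E -> \bar R) :
  measurable_fun setT f -> (forall x, 0 <= f x)%E ->
  (\int[mu]_x f (a + x)%R = \int[mu]_x f x)%E.
Proof.
move=> mf f0.
rewrite -(ge0_integral_pushforward (measurable_shift a) mu measurableT)//.
apply: eq_measure_integral => [|mf' B mB _]; first exact: measurable_shift.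
by rewrite -(lebesgue_cV_shift a mB).
Qed.

Lemma cvg_cV (T : Type) (F : set_system T) {FF : Filter F} (f : T -> E) (l : E) :
  (forall i, f x i 0 @[x --> F] --> l i 0) -> f @ F --> l.
Proof.
move=> fl; apply/cvg_ballP => e e0.
rewrite /ball/= /mx_ball.
have : \near F, forall i, ball (l i 0) e (f F i 0).
  by apply: filter_forall => i; move/cvg_ballP : (fl i); exact.
by apply: filterS => x H; split=> // i j; rewrite ord1.
Qed.

(** The sigma-algebra is generated by coordinates and not by open sets. So [f] is written as the
    pointwise limit of its values at [x] rounded down to the grid of mesh 1/(n+1); such a function
    takes countably many values, each on a union of half-open grid boxes. *)
Lemma continuous_measurable_cV (f : E -> R) : continuous f -> measurable_fun [set: E] f.
Proof.
move=> cf.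
pose rd (n : nat) (z : 'cV[int]_d) : E := \col_i ((z i 0)%:~R / n.+1%:R).
pose fl (n : nat) (x : E) : 'cV[int]_d := \col_i Num.floor (x i 0 * n.+1%:R).
apply: (@measurable_realfun.measurable_fun_cvg _ _ _ _ (fun n x => f (rd n (fl n x)))).
  move=> n _ B mB; rewrite setTI.
  rewrite (_ : _ @^-1` _ = \bigcup_(z in [set: 'cV[int]_d])
     ([set x | fl n x = z] `&` [set x | B (f (rd n z))])); last first.
    by apply/seteqP; split=> [x /= ?|x [z _ [/= <- ?]]]//; exists (fl n x).
  apply: countable_bigcupT_measurable => [|z]; first exact: countableP.
  have [Bz|nBz] := pselect (B (f (rd n z))); last first.
    by rewrite (_ : _ `&` _ = set0)//; apply/seteqP; split=> x // [].
  rewrite (_ : _ `&` _ = [set x : E | forall i,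
      (`[(z i 0)%:~R / n.+1%:R, (z i 0 + 1)%:~R / n.+1%:R[%classic : set (measurableTypeR R)) (x i 0)]).
    by apply: (measurable_rect (X := fun i => _)) => i; exact: measurable_itv.
  apply/seteqP; split=> x /=.
    by move=> [<- _] i; rewrite mxE in_itv/= ler_pdivrMr// ltr_pdivlMr// floor_itv.
  move=> H; split=> //; apply/colP => i; rewrite mxE; apply: floor_def.
  by have := H i; rewrite in_itv/= ler_pdivrMr// ltr_pdivlMr.
move=> x _; apply: (@cvg_comp _ _ _ (fun n => rd n (fl n x)) f _ (nbhs x)); last exact: cf.
apply: cvg_cV => i.
apply/cvgrPdist_lt => e e0; near=> n.
rewrite !mxE.
have /andP[H1 H2] := floor_itv (x i 0 * n.+1%:R).
have ne : n.+1%:R^-1 < e by near: n; exact: near_infty_natSinv_lt (PosNum e0).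
have n0 : (0 : R) < n.+1%:R by [].
set z := _%:~R in H1 *; rewrite intrD -/z in H2.
rewrite ger0_norm; last by rewrite subr_ge0 ler_pdivrMr.
apply: le_lt_trans ne; rewrite lerBlDl -[X in _ + X]mul1r -mulrDl ler_pdivlMr//; exact: ltW.
Unshelve. all: by end_near. Qed.


Lemma compact_cube r : compact (cube r).
Proof.
have -> : cube r = trmx @` [set v : 'rV[R]_d | forall i, `[- r, r]%classic (v ord0 i)].
  apply/seteqP; split=> x /=.
    move=> Hx; exists x^T; last by rewrite trmxK.
    by move=> i; rewrite in_itv/= -ler_norml mxE; exact: Hx.
  by move=> [v Hv <-] i; rewrite mxE ler_norml; have := Hv i; rewrite in_itv.
apply: continuous_compact; last first.
  by apply: (@rV_compact _ _ (fun=> `[- r, r]%classic)) => i; exact: segment_compact.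
apply: continuous_subspaceT => v.
apply: (@cvg_cV _ (nbhs v) (nbhs_filter v) trmx v^T) => i.
rewrite mxE; apply: cvg_trans (@coord_continuous _ _ _ 0 i v).
by apply: near_eq_cvg; apply: nearW => w; rewrite mxE.
Qed.

Lemma closed_cube r : closed (cube r).
Proof.
by apply: compact_closed; [exact: norm_hausdorff|exact: compact_cube].
Qed.

End lebesgue_space.

(** * Continuity of translations for measurable sets *)

Section translation_continuity.
Context {R : realType} {d : nat}.
Notation E := 'cV[R]_d.
Notation mu := (@leb R d).

(** The symmetric difference of [A] and its translate by -z, that is, the points where the indicator
    of [A] changes under the shift by [z]. *)
Definition moved (A : set E) (z : E) : set E :=
  ((fun x => z + x) @^-1` A `\` A) `|` (A `\` (fun x => z + x) @^-1` A).

Lemma movedP A z x : moved A z x <-> ~ (A (z + x) <-> A x).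
Proof.
rewrite /moved/=; split; first by tauto.
by have [?|?] := pselect (A (z + x)); have [?|?] := pselect (A x); tauto.
Qed.

Lemma measurable_preshift (A : set E) z : measurable A ->
  measurable ((fun x => z + x) @^-1` A).
Proof. by move=> mA; rewrite -[X in measurable X]setTI; exact: measurable_shift. Qed.

Lemma measurable_moved (A : set E) z : measurable A -> measurable (moved A z).
Proof.
by move=> mA; apply: measurableU; apply: measurableD => //; exact: measurable_preshift.
Qed.

(* These sets form a sigma-algebra which contains the boxes, hence every
   measurable set is one of them; this is continuity of translations in L^1. *)
Definition shift_cont (A : set E) := measurable A /\ forall r e : R, 0 < e ->
  exists2 dl, 0 < dl & forall z, cube dl z -> (mu (cube r `&` moved A z) <= e%:E)%E.

Lemma shift_contC A : shift_cont A -> shift_cont (~` A).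
Proof.
move=> [mA cA]; split; first exact: measurableC.
move=> r e e0; have [dl dl0 H] := cA r e e0; exists dl => // z /H.
rewrite (_ : moved (~` A) z = moved A z)//.
apply/seteqP; split=> x /movedP nA; apply/movedP; move: nA => /=.
  by have [?|?] := pselect (A (z + x)); have [?|?] := pselect (A x); tauto.
by have [?|?] := pselect (A (z + x)); have [?|?] := pselect (A x); tauto.
Qed.

Lemma shift_cont0 : shift_cont set0.
Proof.
split=> // r e e0; exists 1 => // z _.
rewrite (_ : _ `&` _ = set0) ?measure0 ?lee_fin ?ltW//.
by apply/seteqP; split=> x // [_ /movedP]/=; tauto.
Qed.

Lemma shift_contU A B : shift_cont A -> shift_cont B -> shift_cont (A `|` B).
Proof.
move=> [mA cA] [mB cB]; split; first exact: measurableU.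
move=> r e e0; have e20 : 0 < e / 2 by rewrite divr_gt0.
have [dA dA0 HA] := cA r _ e20; have [dB dB0 HB] := cB r _ e20.
exists (Num.min dA dB); first by rewrite lt_min dA0.
move=> z Hz.
have zA : cube dA z by apply: subset_cube Hz; rewrite ge_min lexx.
have zB : cube dB z by apply: subset_cube Hz; rewrite ge_min lexx orbT.
rewrite [e]splitr EFinD.
apply: le_trans (leeD (HA z zA) (HB z zB)).
have mm C : measurable C -> measurable (cube r `&` moved C z).
  by move=> mC; apply: measurableI; [exact: measurable_cube|exact: measurable_moved].
apply: le_trans (measureU2 _ (mm A mA) (mm B mB)).
apply: le_measure; rewrite ?inE.
- by apply: mm; exact: measurableU.
- by apply: measurableU; exact: mm.
- move=> x [rx /movedP xAB]; have [Ax|nA] := pselect (moved A z x).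
    by left; split.
  right; split=> //; apply/movedP => nB; apply: xAB => /=; have {}nA : A (z + x) <-> A x by apply: contrapT => /movedP.
  by tauto.
Qed.

(** On a bounded cube the union differs from a finite partial union by a set of small measure. A
    moved point of the union is moved by the partial union, or it lies in the remainder, or its
    shift does: hence the split of [e] into three. *)
Lemma shift_cont_bigcup (F : (set E)^nat) :
  (forall n, shift_cont (F n)) -> shift_cont (\bigcup_n F n).
Proof.
move=> cF.
have mF n : measurable (F n) by case: (cF n).
have mU : measurable (\bigcup_n F n) by exact: bigcup_measurable.
split=> // r e e0; have e30 : 0 < e / 3 by rewrite divr_gt0.
pose G m := \big[setU/set0]_(k < m) F k.
have cG m : shift_cont (G m).
  rewrite /G; elim/big_ind: _ => //; first exact: shift_cont0.
  exact: shift_contU.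
have mG m : measurable (G m) by case: (cG m).
(* The cube is enlarged by 1 so that [z + x] stays inside it when [x] is in [cube r] and [z] in
   [cube 1]. *)
pose H m := cube (r + 1) `&` (\bigcup_n F n `\` G m).
have mH m : measurable (H m).
  by apply: measurableI; [exact: measurable_cube|exact: measurableD].
have H0 : \bigcap_m H m = set0.
  apply/seteqP; split=> x // Hx.
  have [_ [[n _ Fnx] _]] := Hx 0%N I.
  have [_ [_]] := Hx n.+1 I; apply.
  by rewrite /G big_ord_recr/=; right.
have : (mu \o H) x @[x --> \oo] --> mu (\bigcap_m H m).
  apply: nonincreasing_cvg_mu => //.
  - apply: le_lt_trans (cube_fin (r + 1)).
    by apply: le_measure; rewrite ?inE//; [exact: measurable_cube|exact: subIsetl].
  - by rewrite H0.
  - move=> m n mn; apply/subsetPset; apply: setIS; apply: setDS.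
    by apply: subset_bigsetU.
rewrite H0 measure0 => /fine_cvgP[_ /cvgrPdist_lt/(_ _ e30)] [m _ /(_ _ (leqnn m))].
rewrite /= sub0r normrN => Hm.
have Hfin k : (mu (H k) < +oo)%E.
  apply: le_lt_trans (cube_fin (r + 1)).
  by apply: le_measure; rewrite ?inE//; [exact: measurable_cube|exact: subIsetl].
have {Hm}Hm : (mu (H m) <= (e / 3)%:E)%E.
  rewrite -[X in (X <= _)%E]fineK ?ge0_fin_numE// lee_fin.
  by apply: le_trans (ltW Hm); exact: ler_norm.
have [_ /(_ r _ e30)[dl dl0 HG]] := cG m.
exists (Num.min dl 1); first by rewrite lt_min dl0 ltr01.
move=> z Hz.
have zl : cube dl z by apply: subset_cube Hz; rewrite ge_min lexx.
have z1 : cube 1 z by apply: subset_cube Hz; rewrite ge_min lexx orbT.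
have mHz : measurable [set x | H m (z + x)] by exact: (measurable_preshift _ (mH m)).
have Hzm : (mu [set x | H m (z + x)%R] <= (e / 3)%:E)%E.
  by rewrite /leb lebesgue_cV_shift.
have -> : e%:E = (e / 3)%:E + ((e / 3)%:E + (e / 3)%:E) :> \bar R.
  by rewrite -!EFinD; congr (_%:E); lra.
apply: le_trans (leeD (HG z zl) (leeD Hm Hzm)).
have mm C : measurable C -> measurable (cube r `&` moved C z).
  by move=> mC; apply: measurableI; [exact: measurable_cube|exact: measurable_moved].
apply: le_trans (leeD (lexx _) (measureU2 _ (mH m) mHz)).
apply: le_trans (measureU2 _ (mm _ (mG m)) (measurableU _ _ (mH m) mHz)).
apply: le_measure; rewrite ?inE; [exact: mm|by apply: measurableU; [exact: mm|exact: measurableU]|].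
move=> x [rx /movedP nF].
have r1x : cube (r + 1) x by apply: subset_cube rx; rewrite lerDl.
have r1zx : cube (r + 1) (z + x).
  by move=> i; rewrite mxE addrC; apply: le_trans (ler_normD _ _) _; apply: lerD.
have [Gzx|Gzx] := pselect (G m (z + x)); have [Gx|Gx] := pselect (G m x).
- exfalso; apply: nF; split=> _.
    by move: Gx; rewrite /G -bigcup_mkord => -[k _ Fk]; exists k.
  by move: Gzx; rewrite /G -bigcup_mkord => -[k _ Fk]; exists k.
- by left; split=> //; left; split.
- by left; split=> //; right; split.
right; have [Fx|Fx] := pselect ((\bigcup_n F n) x); first by left.
right; split=> //; split=> //; apply: contrapT => Fzx; apply: nF.
by split.
Qed.

(** A shift of size at most k moves only points within distance k of the hyperplane x_i = b. In a
    bounded cube they form a slab whose measure tends to 0 with k. *)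
Lemma shift_cont_ray (i : 'I_d) (b : R) : shift_cont [set x : E | b < x i 0].
Proof.
have mA : measurable [set x : E | b < x i 0].
  rewrite -[X in measurable X]setTI.
  have := @measurable_coord R d i measurableT `]b, +oo[%classic (measurable_itv _).
  by rewrite (_ : _ @^-1` _ = [set x : E | b < x i 0])//; apply/seteqP; split=> x /=; rewrite in_itv/= andbT.
split=> // r e e0.
(* The slab is the box with side [b - k, b + k] in direction [i] and [-r, r] in the others; for k =
   0 one side has length 0. *)
pose X (k : R) (j : 'I_d) : set (measurableTypeR R) :=
  if j == i then `[b - k, b + k]%classic else `[- r, r]%classic.
pose S k := [set x : E | forall j, X k j (x j 0)].
have mX k j : measurable (X k j) by rewrite /X; case: ifP => _; exact: measurable_itv.
have mS k : measurable (S k) by exact: measurable_rect.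
have Sfin k : (mu (S k) < +oo)%E.
  rewrite /leb lebesgue_cV_prod//.
  suff : (\prod_(j < d) lebesgue_measure (X k j))%E \is a fin_num.
    by rewrite fin_numElt => /andP[].
  elim/big_ind: _ => // [x y|j _]; first exact: fin_numM.
  by rewrite /X; case: ifP => _; rewrite lebesgue_measure_itv /=; case: ifP.
have : (mu \o (fun k => S k.+1%:R^-1)) x @[x --> \oo] --> mu (\bigcap_k S k.+1%:R^-1).
  apply: nonincreasing_cvg_mu => //.
  - exact: Sfin.
  - exact: bigcapT_measurable.
  - move=> m n mn; apply/subsetPset => x /= Sx j; move: (Sx j); rewrite /X; case: ifP => // _.
    rewrite /= !in_itv/= => /andP[h1 h2].
    have : n.+1%:R^-1 <= m.+1%:R^-1 :> R by rewrite lef_pV2 ?posrE// ler_nat.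
    by move=> h3; apply/andP; split; [apply: le_trans h1|apply: (le_trans h2)]; rewrite lerD2l ?lerN2.
have -> : mu (\bigcap_k S k.+1%:R^-1) = 0%E.
  have -> : \bigcap_k S k.+1%:R^-1 = S 0.
    apply/seteqP; split=> x /= Sx => [j|k _ j]; last first.
      move: (Sx j); rewrite /X; case: ifP => // _; rewrite /= !in_itv/= => /andP[h1 h2].
      have h3 : 0 <= k.+1%:R^-1 :> R by [].
      apply/andP; split; [apply: le_trans h1|apply: (le_trans h2)].
        by rewrite lerD2l lerN2.
      by rewrite lerD2l.
    rewrite /X; case: ifP => ji; last by move: (Sx 0%N I j); rewrite /X ji.
    rewrite /= subr0 addr0 in_itv/= -eq_le; apply/eqP/esym/eqP; rewrite -subr_eq0 -normr_le0.
    apply/ler_addgt0Pl => u u0.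
    have [k _ /(_ _ (leqnn k))/= ku] := near_infty_natSinv_lt (PosNum u0).
    rewrite addr0; apply: le_trans (ltW ku).
    move: (Sx k I j); rewrite /X ji /= in_itv/= => /andP[h1 h2].
    by rewrite ler_distl h1.
  rewrite /leb lebesgue_cV_prod// (bigD1 i)//= {1}/X eqxx subr0 addr0.
  by rewrite lebesgue_measure_itv/= ltxx mul0e.
move=> /fine_cvgP[_ /cvgrPdist_lt/(_ _ e0)] [m _ /(_ _ (leqnn m))].
rewrite /= sub0r normrN => Hm; exists m.+1%:R^-1 => // z Hz.
rewrite -[e%:E]/(e%:E); apply: (@le_trans _ _ (mu (S m.+1%:R^-1))); last first.
  rewrite -[X in (X <= _)%E]fineK ?ge0_fin_numE// lee_fin.
  by apply: le_trans (ltW Hm); exact: ler_norm.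
apply: le_measure; rewrite ?inE//.
  by apply: measurableI; [exact: measurable_cube|exact: measurable_moved].
move=> x [rx /movedP nA] j; rewrite /X; case: ifP => [/eqP ->|_]; last first.
  by rewrite /= in_itv/= -ler_norml.
have := Hz i; rewrite ler_norml => /andP[h1 h2].
rewrite /= in_itv/=; move: nA => /=; rewrite mxE.
set k : R := m.+1%:R^-1 in h1 h2 *.
have aux (t u : R) : - k <= u -> u <= k -> ~ (b < u + t <-> b < t) -> b - k <= t <= b + k.
  have [a1|a1] := ltP b t; have [a2|a2] := ltP b (u + t) => u1 u2 h; try tauto.
    by apply/andP; split; lra.
  by apply/andP; split; lra.
exact: aux.
Qed.

(** Two generation arguments are nested: coordinate preimages generate the sigma-algebra of the
    space, and open rays generate that of the line. *)
Lemma measurable_shift_cont (A : set E) : measurable A -> shift_cont A.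
Proof.
move: A; apply: smallest_sub => [|B].
  split; first exact: shift_cont0.
    by move=> ?; rewrite setTD; exact: shift_contC.
  exact: shift_cont_bigcup.
rewrite -bigcup_seq => -[i /= _ [C mC <-]]; rewrite setTI.
move: C mC; rewrite RGenOInfty.measurableE.
apply: (@smallest_sub _ _ _ [set C | shift_cont ((fun x : E => x i 0) @^-1` C)]) => [|C].
  split=> /=; first by rewrite preimage_set0; exact: shift_cont0.
    by move=> ?; rewrite setTD preimage_setC; exact: shift_contC.
  by move=> F cF; rewrite preimage_bigcup; exact: shift_cont_bigcup.
move=> [b ->]/=.
rewrite (_ : _ @^-1` _ = [set x : E | b < x i 0]); first exact: shift_cont_ray.
by apply/seteqP; split=> x /=; rewrite in_itv/= andbT.
Qed.

End translation_continuity.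

(** * Continuity of translations for integrable functions *)

Section L1_translation.
Import HBSimple.
Context {R : realType} {d : nat}.
Notation E := 'cV[R]_d.
Notation mu := (@leb R d).

Lemma measurable_fun_shift (f : E -> R) (z : E) : measurable_fun setT f ->
  measurable_fun setT (fun x => f (z + x)).
Proof. by move=> mf; apply: (measurableT_comp mf); exact: measurable_shift. Qed.

(** A simple function changes at [x] only if one of its finitely many level sets moves there, and
    then by at most twice its bound [M]. *)
Lemma sfun_shift_cont (g : {sfun E >-> R}) (r e : R) : 0 < e ->
  exists2 dl, 0 < dl & forall z, cube dl z ->
    (\int[mu]_(x in cube r) `|g (z + x)%R - g x|%:E <= e%:E)%E.
Proof.
move=> e0.
pose U z (s : seq R) := \big[setU/set0]_(y <- s) moved (g @^-1` [set y]) z.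
have mg y : measurable (g @^-1` [set y]) by exact: measurable_sfunP.
have mU z s : measurable (U z s).
  by apply: bigsetU_measurable => y _; exact: measurable_moved.
have small s u : 0 < u -> exists2 dl, 0 < dl & forall z, cube dl z ->
    (mu (cube r `&` U z s) <= u%:E)%E.
  elim: s u => [|y s IH] u u0.
    exists 1 => // z _; rewrite /U big_nil setI0 measure0 lee_fin ltW//.
  have u20 : 0 < u / 2 by rewrite divr_gt0.
  have [d1 d10 H1] := IH _ u20.
  have [_ /(_ r _ u20)[d2 d20 H2]] := measurable_shift_cont (mg y).
  exists (Num.min d1 d2) => [|z Hz]; first by rewrite lt_min d10.
  have z1 : cube d1 z by apply: subset_cube Hz; rewrite ge_min lexx.
  have z2 : cube d2 z by apply: subset_cube Hz; rewrite ge_min lexx orbT.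
  rewrite /U big_cons setIUr [u]splitr EFinD.
  apply: le_trans (leeD (H2 z z2) (H1 z z1)); apply: measureU2.
    by apply: measurableI; [exact: measurable_cube|exact: measurable_moved].
  by apply: measurableI; [exact: measurable_cube|exact: mU].
have [M [M0 HM]] : exists M, 0 < M /\ forall x, `|g x| <= M.
  have [N [Nr HN]] := simple_bounded g.
  exists (`|N| + 1); split; first by rewrite ltr_wpDl.
  by move=> x; apply: HN => //; rewrite (le_lt_trans (ler_norm N))// ltrDl.
have /finite_seqP[s Es] := fimfunP g.
have Hs z x : g (z + x) != g x -> U z s x.
  move=> gx; rewrite /U -bigcup_seq; exists (g x).
    by have : range g (g x) by [exists x]; rewrite Es.
  by apply/movedP => /= h; move/eqP: gx; apply; apply/h.
have [dl dl0 Hdl] := small s (e / (2 * M)) (divr_gt0 e0 (mulr_gt0 (ltr0Sn _ 1) M0)).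
exists dl => // z /Hdl zl.
have mc := @measurable_cube R d r.
apply: (@le_trans _ _ (\int[mu]_(x in cube r) ((2 * M)%:E * (\1_(U z s) x)%:E))%E).
  apply: ge0_le_integral => //.
  - apply/measurable_EFinP; apply: measurableT_comp => //.
    apply: measurable_funB; last exact: measurable_funTS.
    by apply: measurable_funTS; apply: measurable_fun_shift.
  - by apply: emeasurable_funM => //; apply/measurable_EFinP; apply: measurable_indic; exact: mU.
  - move=> x rx; rewrite -EFinM lee_fin indicE.
    have [->|/Hs Ux] := eqVneq (g (z + x)) (g x).
      by rewrite subrr normr0 !mulr_ge0// ltW.
    rewrite mem_set// mulr1; apply: le_trans (ler_normB _ _) _.
    by rewrite mulr_natl mulr2n lerD.
rewrite ge0_integralZl//; last 2 first.
- by apply/measurable_EFinP; apply: measurable_indic; exact: mU.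
- by rewrite lee_fin mulr_ge0// ltW.
rewrite integral_indic// setIC.
rewrite -lee_pdivlMl ?mulr_gt0// -EFinM mulrC; exact: zl.
Qed.

Lemma ge0_le_integral_cube (r : R) (f : E -> \bar R) : measurable_fun setT f ->
  (forall x, 0 <= f x)%E -> (\int[mu]_(x in cube r) f x <= \int[mu]_x f x)%E.
Proof.
move=> mf f0; apply: ge0_subset_integral => //; exact: measurable_cube.
Qed.

(** Approximation by a simple function [g n]: translation invariance gives the shifted error the
    same bound e/3 as the error itself, and the last third is the shift of [g n]. *)
Lemma L1_shift_cont (f : E -> R) (r e : R) : 0 < e ->
  mu.-integrable setT (EFin \o f) ->
  exists2 dl, 0 < dl & forall z, cube dl z ->
    (\int[mu]_(x in cube r) `|f (z + x)%R - f x|%:E <= e%:E)%E.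
Proof.
move=> e0 intf.
have e30 : 0 < e / 3 by rewrite divr_gt0.
have mf : measurable_fun setT f by apply/measurable_EFinP; exact: measurable_int intf.
have [g [ig _ gf]] := approximation_sfun_integrable measurableT intf.
move/fine_cvgP : gf => [fing /cvgrPdist_lt/(_ _ e30) gf].
have [n _ /(_ _ (leqnn n))[]] := filterI fing gf.
rewrite /= sub0r normrN => fingn Hn.
have {fingn}Hn : (\int[mu]_x `|(f x - g n x)%:E| <= (e / 3)%:E)%E.
  rewrite -[leLHS]fineK// lee_fin; apply: le_trans (ltW Hn); exact: ler_norm.
have mgn : measurable_fun setT (g n) by [].
have [dl dl0 Hdl] := sfun_shift_cont (g n) r e30.
exists dl => // z /Hdl {}Hdl.
have -> : e%:E = (e / 3)%:E + ((e / 3)%:E + (e / 3)%:E) :> \bar R.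
  by rewrite -!EFinD; congr (_%:E); lra.
have mfg : measurable_fun setT (fun x => `|(f x - g n x)%:E|%E).
  by apply/measurableT_comp => //; apply/measurable_EFinP/measurable_funB.
have Hz : (\int[mu]_x `|(f (z + x)%R - g n (z + x)%R)%:E| <= (e / 3)%:E)%E.
  apply: le_trans Hn.
  by rewrite (ge0_integral_shift z mfg).
have mfgz : measurable_fun setT (fun x => `|(f (z + x)%R - g n (z + x)%R)%:E|%E).
  by apply/measurableT_comp => //; apply/measurable_EFinP/measurable_funB; exact: measurable_fun_shift.
have mgz : measurable_fun setT (fun x => `|g n (z + x)%R - g n x|%:E).
  apply/measurable_EFinP; apply/measurableT_comp => //; apply: measurable_funB => //.
  exact: measurable_fun_shift.
apply: le_trans (leeD (le_trans (ge0_le_integral_cube r mfgz _) Hz)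
  (leeD (le_trans (ge0_le_integral_cube r mfg _) Hn) Hdl)) => //.
have mc := @measurable_cube R d r.
rewrite -ge0_integralD//; [|exact: measurable_funTS..].
rewrite -ge0_integralD//; last 3 first.
- exact: measurable_funTS.
- by move=> *; rewrite adde_ge0.
- by apply: emeasurable_funD; exact: measurable_funTS.
apply: ge0_le_integral => //.
- apply: measurable_funTS; apply/measurable_EFinP; apply/measurableT_comp => //.
  by apply: measurable_funB => //; exact: measurable_fun_shift.
- by apply: emeasurable_funD; [|apply: emeasurable_funD]; exact: measurable_funTS.
move=> x _; rewrite -!EFinD lee_fin.
apply: le_trans (ler_distD (g n (z + x)) _ _) _; rewrite lerD2l [leRHS]addrC.
by apply: le_trans (ler_distD (g n x) _ _) _; rewrite lerD2l distrC.
Qed.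

End L1_translation.

(** * Mollification *)

Section directional_derivatives.
Context {R : realType} {V : normedModType R}.

(** The two difference quotients coincide. Only directional derivatives are ever needed, and this
    transfers the one-variable rules to them. *)
Lemma is_derive_lineP (f : V -> R) (x v : V) (t a : R) :
  is_derive (t *: v + x) v f a <-> is_derive t 1 (fun s : R => f (s *: v + x)) a.
Proof.
have E : (fun h : R => h^-1 *: ((f \o shift (t *: v + x)) (h *: v) - f (t *: v + x))) =
   (fun h : R => h^-1 *: (((fun s : R => f (s *: v + x)) \o shift t) (h *: 1) -
      f (t *: v + x))).
  apply/funext => h /=; congr (_ *: (f _ - _)).
  by rewrite addrA -scalerDl [h *: 1]mulr1.
have Ed : derivable f (t *: v + x) v = derivable (fun s : R => f (s *: v + x)) t 1.
  by rewrite /derivable E.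
have Ev : 'D_v f (t *: v + x) = 'D_1 (fun s : R => f (s *: v + x)) t.
  by rewrite /derive E.
by split=> -[H1 H2]; constructor; [rewrite -Ed|rewrite -Ev|rewrite Ed|rewrite Ev].
Qed.

Lemma is_derive_line0P (f : V -> R) (x v : V) (a : R) :
  is_derive x v f a <-> is_derive (0 : R) 1 (fun s : R => f (s *: v + x)) a.
Proof. by rewrite -is_derive_lineP scale0r add0r. Qed.

Lemma is_derive_comp (g : R -> R) (f : V -> R) (x v : V) (a b : R) :
  is_derive (f x) 1 g a -> is_derive x v f b -> is_derive x v (g \o f) (a * b).
Proof.
move=> Hg /is_derive_line0P Hf; apply/is_derive_line0P.
apply: (@is_derive1_comp _ g (fun s : R => f (s *: v + x))) => //.
by rewrite scale0r add0r.
Qed.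

End directional_derivatives.

(** * Mollification with a continuous, compactly supported kernel *)

Section mollification.
Context {R : realType} {d : nat}.
Notation E := 'cV[R]_d.
Notation mu := (@leb R d).

(** Dominated convergence speaks of sequences; this turns its conclusion into continuity. *)
Lemma cvg_seq_cV (f : E -> R) (x : E) (l : R) :
  (forall u : nat -> E, u n @[n --> \oo] --> x -> f (u n) @[n --> \oo] --> l) ->
  f y @[y --> x] --> l.
Proof.
move=> H; apply: contrapT => /cvgrPdist_lt /existsNP[e /not_implyP[e0 He]].
have /choice[u Hu] : forall n : nat, exists y : E, ball x n.+1%:R^-1 y /\ e <= `|l - f y|.
  move=> n; apply: contrapT => /forallNP Hn; apply: He.
  apply/nbhs_ballP; exists n.+1%:R^-1 => //= y xy.
  by rewrite ltNge; apply/negP => h; apply: (Hn y).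
have ux : u n @[n --> \oo] --> x.
  apply/cvg_ballP => r r0; near=> n; apply: (@le_ball _ _ _ n.+1%:R^-1); last by case: (Hu n).
  by apply: ltW; near: n; exact: near_infty_natSinv_lt (PosNum r0).
have /cvgrPdist_lt/(_ _ e0)[n _ /(_ _ (leqnn n))/=] := H u ux.
by case: (Hu n) => _; rewrite leNgt => /negP.
Unshelve. all: by end_near. Qed.

(** Integrability is asked on cubes only, since every bounded set lies in one. *)
Definition locL1 (w : E -> R) := measurable_fun setT w /\
  forall r, mu.-integrable (cube r) (EFin \o w).

Definition supported (r : R) (k : E -> R) := forall x, ~ cube r x -> k x = 0.

Lemma continuous_bounded_cube (k : E -> R) (r : R) : continuous k ->
  exists2 C, 0 <= C & forall x, cube r x -> `|k x| <= C.
Proof.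
move=> ck.
have : compact (k @` cube r).
  by apply: continuous_compact; [exact: continuous_subspaceT|exact: compact_cube].
move=> /(@compact_bounded _ R^o)[M [_ HM]]; exists (`|M| + 1); first by rewrite addr_ge0.
move=> x rx; apply: (HM (`|M| + 1)); last by exists x.
by rewrite (le_lt_trans (ler_norm M))// ltrDl.
Qed.

Lemma continuous_bounded_supp (k : E -> R) (r : R) : continuous k -> supported r k ->
  exists2 C, 0 <= C & forall x, `|k x| <= C.
Proof.
move=> ck sk; have [C C0 HC] := continuous_bounded_cube r ck.
exists C => // x; have [/HC//|/sk ->] := pselect (cube r x).
by rewrite normr0.
Qed.

Lemma integrable_supp (k : E -> R) (r : R) : measurable_fun setT k ->
  supported r k -> mu.-integrable (cube r) (EFin \o k) -> mu.-integrable setT (EFin \o k).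
Proof.
move=> mk sk ik.
have -> : EFin \o k = (EFin \o k) \_ (cube r).
  apply/funext => x; rewrite patchE; case: ifPn => //; rewrite notin_setE => /sk /= ->//.
exact/(integrable_mkcond _ (@measurable_cube R d r)).
Qed.

Lemma locL1_mul (k w : E -> R) (r C : R) : measurable_fun setT k -> locL1 w ->
  supported r k -> (forall x, `|k x| <= C) ->
  mu.-integrable setT (EFin \o (fun x => k x * w x)).
Proof.
move=> mk [mw iw] sk kC.
have C0 : 0 <= C by apply: le_trans (kC 0).
apply: (@integrable_supp _ r).
- exact: measurable_funM.
- by move=> x /sk ->; rewrite mul0r.
apply: (@le_integrable _ _ _ mu _ (measurable_cube r) _ (fun x => C%:E * `|(w x)%:E|)%E).
- by apply/measurable_EFinP/measurable_funTS/measurable_funM.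
- by move=> x _; rewrite /= lee_fin !normrM !normr_id ler_wpM2r// (ger0_norm C0).
- apply: integrableZl; first exact: measurable_cube.
  exact: integrable_abse.
Qed.

Lemma continuous_shift_cV (a : E) : continuous (fun y : E => y + a).
Proof. move=> y; apply: (@cvg_cV R d _ (nbhs y) (nbhs_filter y) (fun z => z + a) (y + a)) => i.
rewrite mxE; apply: cvg_trans (cvgD (@coord_continuous _ _ _ i 0 y) (cvg_cst (a i 0))).
by apply: near_eq_cvg; apply: nearW => z; rewrite mxE. Qed.

Lemma continuous_comp_shift (k : E -> R) (a : E) : continuous k ->
  continuous (fun y : E => k (y + a)).
Proof. by move=> ck y; apply: continuous_comp; [exact: continuous_shift_cV|exact: ck]. Qed.

Lemma supported_shift (k : E -> R) (r s : R) (a : E) : cube s a -> supported r k ->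
  supported (r + s) (fun y => k (y - a)).
Proof.
move=> sa sk y ny; apply: sk => ry; apply: ny => i.
have := lerD (ry i) (sa i); rewrite !mxE; apply: le_trans.
by apply: le_trans (ler_normD _ _); rewrite subrK.
Qed.

Lemma in_cube (x : E) : cube `|x| x.
Proof.
by move=> i; rewrite [leRHS]/Num.norm/= mx_normrE; apply: (le_bigmax _ (fun ij => `|x ij.1 ij.2|) (i, ord0)).
Qed.

Lemma cubeD (r s : R) (x y : E) : cube r x -> cube s y -> cube (r + s) (x + y).
Proof.
by move=> rx sy i; rewrite mxE; apply: le_trans (ler_normD _ _) _; exact: lerD.
Qed.

(** Convolution with the reflected kernel, so that y |-> k (y - x) can itself serve as a test
    function. The reflection is the origin of the sign in [moll_derive]. *)
Definition moll (k w : E -> R) (x : E) : R := \int[mu]_y (k (y - x) * w y).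

Lemma moll_integrable (k w : E -> R) (r : R) (x : E) : continuous k ->
  supported r k -> locL1 w ->
  mu.-integrable setT (EFin \o (fun y => k (y - x) * w y)).
Proof.
move=> ck sk lw; have [C C0 HC] := continuous_bounded_supp ck sk.
apply: (locL1_mul (k := fun y => k (y - x)) (C := C) _ lw (supported_shift (in_cube x) sk)).
  by apply: continuous_measurable_cV; exact: continuous_comp_shift.
by move=> y; exact: HC.
Qed.

Lemma moll_continuous (k w : E -> R) (r : R) : continuous k ->
  supported r k -> locL1 w -> continuous (moll k w).
Proof.
move=> ck sk lw x; apply: cvg_seq_cV => u ux.
have [C C0 HC] := continuous_bounded_supp ck sk.
have [mw iw] := lw.
(* From some index on, [u n] is within 1 of [x], so all the integrands live on [cube s], where C |w|
   dominates them. *)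
pose s := r + (`|x| + 1).
have [n0 _ Hn0] : \forall n \near \oo, cube (`|x| + 1) (u n).
  move/cvgrPdist_le : ux => /(_ _ ltr01); apply: filterS => n xun.
  have -> : u n = x + (u n - x) by rewrite addrC subrK.
  apply: cubeD; first exact: in_cube.
  by apply: subset_cube (in_cube _); rewrite distrC.
rewrite -(cvg_shiftn n0).
apply: fine_cvg; rewrite fineK; last first.
  by apply: integrable_fin_num => //; exact: moll_integrable ck sk lw.
have iG : mu.-integrable setT (fun y => ((C * `|w y|) * \1_(cube s) y)%:E).
  have mc := @measurable_cube R d s.
  apply: (@integrable_supp _ s).
  - by apply: measurable_funM; [apply: measurable_funM => //; apply: measurableT_comp|apply: measurable_indic].
  - by move=> y sy; rewrite indicE memNset// mulr0.
  apply: (@le_integrable _ _ _ mu _ mc _ (fun x => C%:E * `|(w x)%:E|)%E).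
  - apply/measurable_EFinP/measurable_funTS.
    by apply: measurable_funM; [apply: measurable_funM => //; apply: measurableT_comp|apply: measurable_indic].
  - by move=> y sy; rewrite /= indicE mem_set// mulr1.
  - by apply: integrableZl => //; exact: integrable_abse.
apply: (dominated_cvg measurableT) iG _ => //.
- move=> n; apply/measurable_EFinP; apply: measurable_funM => //.
  by apply: continuous_measurable_cV; exact: continuous_comp_shift.
- move=> y _; apply: cvg_EFin; first exact: nearW.
  apply: cvgM; last exact: cvg_cst.
  apply: (@cvg_comp _ _ _ (fun n => y - u (n + n0)%N) k _ (nbhs (y - x))); last exact: ck.
  by apply: cvgB; [exact: cvg_cst|rewrite cvg_shiftn].
- move=> n y _; rewrite lee_fin normrM indicE.
  have [sy|sy] := pselect (cube s y); last first.
    rewrite memNset// mulr0.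
    rewrite (supported_shift (Hn0 _ (leq_addl n n0)) sk)// ?normr0 ?mul0r//.
  by rewrite mem_set// mulr1 ler_wpM2r.
Qed.

End mollification.

(** * Derivatives and local L^1 convergence of mollifications *)

Section mollifiers.
Context {R : realType} {d : nat}.
Notation E := 'cV[R]_d.
Notation mu := (@leb R d).

Lemma integral_shift (f : E -> \bar R) (a : E) : measurable_fun setT f ->
  (\int[mu]_y f (a + y)%R = \int[mu]_y f y)%E.
Proof.
move=> mf; rewrite integralE [RHS]integralE; congr (_ - _)%E.
  transitivity (\int[lebesgue_cV d]_x f^\+%E (a + x)%R)%E.
    by apply: eq_integral => x _; rewrite !funeposE.
  by rewrite (ge0_integral_shift a (measurable_funepos mf) (funepos_ge0 f)).
transitivity (\int[lebesgue_cV d]_x f^\-%E (a + x)%R)%E.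
  by apply: eq_integral => x _; rewrite !funenegE.
by rewrite (ge0_integral_shift a (measurable_funeneg mf) (funeneg_ge0 f)).
Qed.

Lemma Rintegral_shift (f : E -> R) (a : E) : measurable_fun setT f ->
  \int[mu]_y f (a + y) = \int[mu]_y f y.
Proof.
move=> mf; rewrite /Rintegral; congr fine.
exact/(integral_shift (f := EFin \o f))/measurable_EFinP.
Qed.

Lemma integrable_shift (f : E -> R) (a : E) : mu.-integrable setT (EFin \o f) ->
  mu.-integrable setT (EFin \o (fun x => f (a + x))).
Proof.
move=> intf; have /integrableP[/measurable_EFinP mf foo] := intf.
apply/integrableP; split; first by apply/measurable_EFinP; exact: measurable_fun_shift.
rewrite (@integral_shift (fun x => `|(f x)%:E|)%E a)//.
by apply: measurableT_comp => //; exact/measurable_EFinP.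
Qed.

Lemma locL1_cst (c : R) : locL1 (cst c : E -> R).
Proof.
split=> // r; apply/measurable_bounded_integrable => //; last exact: bounded_cst.
  exact: measurable_cube.
exact: cube_fin.
Qed.

(** Differentiation under the integral along the segment t e + x with |t| < 1: the shifted kernels
    have their supports in a common cube, where C |w| dominates the derivative. *)
Lemma moll_derive (k k' w : E -> R) (r : R) (e : E) : continuous k -> continuous k' ->
  supported r k -> supported r k' -> (forall x, is_derive x e k (k' x)) ->
  locL1 w -> forall x, is_derive x e (moll k w) (- moll k' w x).
Proof.
move=> ck ck' sk sk' dk lw x; apply/is_derive_line0P.
have [C C0 HC] := continuous_bounded_supp ck' sk'.
have [mw iw] := lw.
pose f (t : R) (y : E) := k (y - (t *: e + x)) * w y.
have df (t : R) (y : E) : is_derive t 1 (f ^~ y) (- k' (y - (t *: e + x)) * w y).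
  have -> : f ^~ y = (fun t => (fun s => k (s *: e + (y - x))) (- t)) * cst (w y).
    by apply/funext => u; rewrite /f fctE /= scaleNr opprD addrCA.
  have E1 : is_derive (- t) 1 (fun s => k (s *: e + (y - x))) (k' (y - (t *: e + x))).
    apply: (proj1 (is_derive_lineP k (y - x) e (- t) _)).
    have <- : - t *: e + (y - x) = y - (t *: e + x) by rewrite scaleNr opprD addrCA.
    exact: dk.
  have E2 : is_derive t 1 (fun t => (fun s => k (s *: e + (y - x))) (- t)) (k' (y - (t *: e + x)) * - 1).
    exact: (@is_derive1_comp _ (fun s => k (s *: e + (y - x))) (fun s => - s) t _ _ E1 (is_deriveN _)).
  apply: is_derive_eq.
  by rewrite scaler0 add0r mulrN1 /GRing.scale/= mulrC.
pose s := r + (`|e| + `|x|).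
pose G (y : E) := (C * `|w y|) * \1_(cube s) y.
have iG : mu.-integrable setT (EFin \o G).
  have mc := @measurable_cube R d s.
  apply: (@integrable_supp _ _ _ s).
  - by apply: measurable_funM; [apply: measurable_funM => //; apply: measurableT_comp|apply: measurable_indic].
  - by move=> y sy; rewrite /G indicE memNset// mulr0.
  apply: (@le_integrable _ _ _ mu _ mc _ (fun x => C%:E * `|(w x)%:E|)%E).
  - apply/measurable_EFinP/measurable_funTS.
    by apply: measurable_funM; [apply: measurable_funM => //; apply: measurableT_comp|apply: measurable_indic].
  - by move=> y sy; rewrite /= /G indicE mem_set// mulr1.
  - by apply: integrableZl => //; exact: integrable_abse.
have cubet (t : R) : t \in `]-1, 1[ -> cube (`|e| + `|x|) (t *: e + x).
  rewrite in_itv/= => /andP[t1 t2]; apply: cubeD; last exact: in_cube.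
  move=> i; rewrite mxE normrM; apply: le_trans (in_cube e i).
  by rewrite ler_piMl// ler_norml !ltW.
have G_ub (t : R) (y : E) : `]-1, 1[%classic t -> setT y -> `|partial1of2 f t y| <= G y.
  move=> tI _; rewrite partial1of2E (derive_val (is_derive := df t y)).
  rewrite normrM normrN /G indicE.
  have [sy|sy] := pselect (cube s y); last first.
    by rewrite memNset// mulr0 (supported_shift (cubet t tI) sk')// normr0 mul0r.
  by rewrite mem_set// mulr1 ler_wpM2r.
have intf (t : R) : `]-1, 1[%classic t -> mu.-integrable setT (EFin \o f t).
  by move=> _; exact: moll_integrable ck sk lw.
have I0 : `]-1, 1[%classic (0 : R) by rewrite /= in_itv/= ltrN10 ltr01.
have df1 (t : R) (y : E) : `]-1, 1[%classic t -> setT y -> derivable (f ^~ y) t 1.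
  by move=> _ _; exact: (ex_derive (is_derive := df t y)).
constructor.
  have := derivable_under_integral measurableT I0 intf df1 (G := G).
  by apply => // y; rewrite /G !mulr_ge0.
have := differentiation_under_integral measurableT I0 intf df1 (G := G).
rewrite derive1E => -> //; last by move=> y; rewrite /G !mulr_ge0.
rewrite /moll -mulN1r -RintegralZl//; last exact: moll_integrable ck' sk' lw.
apply: eq_Rintegral => y _.
by rewrite partial1of2E (derive_val (is_derive := df 0 y)) scale0r add0r mulN1r mulNr.
Qed.

(** The mollification of the constant 1 does not depend on the point, by translation invariance, so
    its derivative, minus the integral of [k'], vanishes. This is the only integration by parts of
    the energy estimate. *)
Lemma Rintegral_derive0 (k k' : E -> R) (r : R) (e : E) : continuous k -> continuous k' ->
  supported r k -> supported r k' -> (forall x, is_derive x e k (k' x)) ->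
  \int[mu]_x k' x = 0.
Proof.
move=> ck ck' sk sk' dk.
have := moll_derive ck ck' sk sk' dk (locL1_cst 1) 0.
have -> : moll k (cst 1) = cst (\int[mu]_x k x).
  apply/funext => x; rewrite /moll/=.
  rewrite -(Rintegral_shift (- x) (continuous_measurable_cV ck)).
  by apply: eq_Rintegral => y _; rewrite mulr1 addrC.
move=> [_]; rewrite derive_cst => /esym/eqP; rewrite oppr_eq0 => /eqP.
rewrite /moll => <-; apply: eq_Rintegral => y _.
by rewrite /= mulr1 subr0.
Qed.

Definition mollifier (dl : R) (k : E -> R) := [/\ continuous k, supported dl k,
  forall x, 0 <= k x & (\int[mu]_x (k x)%:E = 1)%E].

Lemma moll_shiftE (k w : E -> R) x : measurable_fun setT k -> measurable_fun setT w ->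
  moll k w x = \int[mu]_z (k z * w (x + z)).
Proof.
move=> mk mw; rewrite /moll -(Rintegral_shift x).
  by apply: eq_Rintegral => y _; rewrite addrC addKr.
apply: measurable_funM => //.
have -> : (fun y => k (y - x)) = (fun y => k (- x + y)).
  by apply/funext => y; rewrite addrC.
exact: measurable_fun_shift.
Qed.

Lemma measurable_addE : measurable_fun setT (fun xz : E * E => xz.1 + xz.2).
Proof.
apply: measurable_fun_coord => i.
rewrite (_ : (fun _ => _) = fun xz : E * E => (xz.1 i 0 + xz.2 i 0)%R :> measurableTypeR R); last first.
  by apply/funext => x; rewrite mxE.
apply: (@measurable_funD _ _ R setT (fun xz : E * E => xz.1 i 0) (fun xz : E * E => xz.2 i 0)).
  exact: (measurableT_comp (@measurable_coord R d i) measurable_fst).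
exact: (measurableT_comp (@measurable_coord R d i) measurable_snd).
Qed.

Lemma locL1_cut (w : E -> R) (r : R) : locL1 w ->
  mu.-integrable setT (EFin \o (fun x => w x * \1_(cube r) x)).
Proof.
move=> [mw iw].
have mc := @measurable_cube R d r.
have m1 : measurable_fun setT (fun x => w x * \1_(cube r) x).
  by apply: measurable_funM => //; exact: measurable_indic.
apply: (@integrable_supp _ _ _ r) => //.
  by move=> y sy; rewrite indicE memNset// mulr0.
apply: (@le_integrable _ _ _ mu _ mc _ (EFin \o w)) => //.
- exact/measurable_EFinP/measurable_funTS.
- by move=> y sy; rewrite /= indicE mem_set// mulr1.
Qed.

(** [moll k w x - w x] is an average of w (x + z) - w x over small [z]; Tonelli reduces it to
    continuity of translations. Cutting [w] off outside [cube (r + 1)] makes it integrable and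
    changes no value that is used, since dl <= 1. The threshold is the same for all kernels. *)
Lemma moll_cvg_L1 (w : E -> R) (r e : R) : locL1 w -> 0 < e ->
  exists2 dl0, 0 < dl0 & forall dl k, dl <= dl0 -> mollifier dl k ->
    (\int[mu]_(x in cube r) `|moll k w x - w x|%:E <= e%:E)%E.
Proof.
move=> lw e0; have [mw iw] := lw.
pose f x := w x * \1_(cube (r + 1)) x.
have mf : measurable_fun setT f.
  by apply: measurable_funM => //; apply: measurable_indic; exact: measurable_cube.
have [dl0 dl00 H] := L1_shift_cont r e0 (locL1_cut (r + 1) lw).
exists (Num.min dl0 1); first by rewrite lt_min dl00 ltr01.
move=> dl k; rewrite le_min => /andP[dl_dl0 dl1] [ck sk k0 ik].
have mk := continuous_measurable_cV ck.
have [C C0 HC] := continuous_bounded_supp ck sk.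
have mc := @measurable_cube R d r.
have mind : measurable_fun setT (\1_(cube r) : E -> R) by exact: measurable_indic.
have mw2 : measurable_fun setT (fun xz : E * E => f (xz.1 + xz.2) - f xz.1).
  apply: measurable_funB; first exact: (measurableT_comp mf measurable_addE).
  exact: (measurableT_comp mf measurable_fst).
pose h (xz : E * E) := ((k xz.2 * `|f (xz.1 + xz.2) - f xz.1|) * \1_(cube r) xz.1)%:E.
have mh : measurable_fun setT h.
  apply/measurable_EFinP; apply: measurable_funM; first apply: measurable_funM.
  - exact: (measurableT_comp mk measurable_snd).
  - exact: (measurableT_comp (@normr_measurable R setT) mw2).
  - exact: (measurableT_comp mind measurable_fst).
have h0 xz : (0 <= h xz)%E by rewrite lee_fin !mulr_ge0.
have intk : mu.-integrable setT (EFin \o k).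
  apply: (@integrable_supp _ _ _ dl) => //.
  apply: measurable_bounded_integrable => //.
  - exact: measurable_cube.
  - exact: cube_fin.
  - exact: measurable_funTS.
  - by exists C; split; [rewrite num_real|move=> M /ltW CM x _; apply: le_trans (HC _) CM].
have step1 x : cube r x -> (`|moll k w x - w x|%:E <= \int[mu]_z h (x, z))%E.
  move=> rx.
  have fx : f x = w x.
    by rewrite /f indicE mem_set ?mulr1//; apply: subset_cube rx; rewrite lerDl.
  have fE z : k z * w (x + z) = k z * f (x + z).
    have [dz|/sk ->] := pselect (cube dl z); last by rewrite !mul0r.
    rewrite /f indicE mem_set ?mulr1//.
    by apply: cubeD rx _; exact: subset_cube dz.
  have lf : locL1 f.
    split=> // s; apply: integrableS (locL1_cut (r + 1) lw) => //; exact: measurable_cube.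
  have i1 : mu.-integrable setT (EFin \o (fun z => k z * f (x + z))).
    apply: (@locL1_mul _ _ _ _ dl C) => //; split; first exact: measurable_fun_shift.
    move=> s; have mcs := @measurable_cube R d s.
    apply: (@integrableS _ _ _ mu setT) => //.
    exact: (integrable_shift x (locL1_cut (r + 1) lw)).
  have i2 : mu.-integrable setT (EFin \o (fun z => k z * f x)).
    by apply: (integrableZr measurableT (f x) intk).
  have -> : moll k w x - w x = \int[mu]_z (k z * f (x + z) - k z * f x).
    rewrite RintegralB// moll_shiftE//; congr (_ - _).
      by apply: eq_Rintegral => z _; rewrite fE.
    by rewrite RintegralZr// /Rintegral ik mul1r fx.
  rewrite EFin_normr_Rintegral//; last first.
    exact: (integrableB measurableT i1 i2).
  apply: le_trans (le_abse_integral _ _ _) _ => //.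
    exact: measurable_int (integrableB measurableT i1 i2).
  apply: ge0_le_integral => //.
  - by apply: measurableT_comp => //; exact: measurable_int (integrableB measurableT i1 i2).
  - by apply: (measurableT_comp mh); exact: measurable_pair1.
  - move=> z _; rewrite /h/= indicE mem_set// mulr1 lee_fin -mulrBr normrM.
    by rewrite (ger0_norm (k0 z)).
apply: (@le_trans _ _ (\int[mu]_x \int[mu]_z h (x, z))%E).
  rewrite integral_mkcond; apply: ge0_le_integral => //.
  - by move=> x _; rewrite patchE; case: ifP.
  - apply/(measurable_restrictT _ mc)/measurable_EFinP; apply: measurableT_comp => //.
    apply: measurable_funTS; apply: measurable_funB => //.
    apply: continuous_measurable_cV; exact: moll_continuous ck sk lw.
  - exact: (measurable_fun_fubini_tonelli_F h).
  - move=> x _; rewrite patchE; case: ifPn => [|_]; last exact: integral_ge0.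
    by rewrite inE => /step1.
rewrite (fubini_tonelli h)//.
apply: (@le_trans _ _ (\int[mu]_z (e%:E * (k z)%:E))%E).
  apply: ge0_le_integral => //.
  - by move=> z _; exact: integral_ge0.
  - exact: (measurable_fun_fubini_tonelli_G h).
  - by apply: emeasurable_funM => //; exact/measurable_EFinP.
  - move=> z _.
    have [dz|nz] := pselect (cube dl z); last first.
      rewrite (sk _ nz) mule0; rewrite (eq_integral (cst 0%E)) ?integral0//.
      by move=> x _; rewrite /h/= (sk _ nz) !mul0r.
    apply: (@le_trans _ _ (\int[mu]_(x in cube r) ((k z)%:E * `|f (z + x)%R - f x|%:E))%E).
      rewrite [leRHS]integral_mkcond le_eqVlt; apply/orP; left; apply/eqP.
      apply: eq_integral => x _; rewrite patchE /h/= indicE.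
      by case: ifP => _; rewrite ?mulr0// mulr1 EFinM [z + x]addrC.
    rewrite ge0_integralZl ?lee_fin//; last first.
      apply/measurable_EFinP; apply: measurableT_comp => //; apply: measurable_funTS.
      by apply: measurable_funB => //; exact: measurable_fun_shift.
    rewrite muleC lee_wpmul2r ?lee_fin//; apply: H; exact: subset_cube dz.
rewrite ge0_integralZl//; first by rewrite ik mule1.
- exact/measurable_EFinP.
- by move=> x _; rewrite lee_fin.
- by rewrite lee_fin ltW.
Qed.

End mollifiers.

(** * Cauchy-Schwarz, Young and the L^p contraction of mollification *)

Section euclidean_norm.
Context {R : realType} {I : finType}.
Implicit Types a b : I -> R.

Definition nrm a : R := Num.sqrt (\sum_m a m ^+ 2).

Lemma nrm_ge0 a : 0 <= nrm a. Proof. exact: sqrtr_ge0. Qed.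

Lemma nrmE a : nrm a ^+ 2 = \sum_m a m ^+ 2.
Proof. by rewrite sqr_sqrtr// sumr_ge0// => m _; exact: sqr_ge0. Qed.

Lemma dot_le_nrm a b : \sum_m a m * b m <= nrm a * nrm b.
Proof.
have [b0|b0] := eqVneq (nrm b) 0.
  have bm m : b m = 0.
    have /eqP := nrmE b; rewrite b0 expr0n/= eq_sym psumr_eq0; last by move=> *; exact: sqr_ge0.
    by move=> /allP/(_ m (mem_index_enum _)); rewrite sqrf_eq0 => /eqP.
  by rewrite b0 mulr0 big1// => m _; rewrite bm mulr0.
have bp : 0 < nrm b by rewrite lt_neqAle eq_sym b0 nrm_ge0.
have [a0|a0] := eqVneq (nrm a) 0.
  have am m : a m = 0.
    have /eqP := nrmE a; rewrite a0 expr0n/= eq_sym psumr_eq0; last by move=> *; exact: sqr_ge0.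
    by move=> /allP/(_ m (mem_index_enum _)); rewrite sqrf_eq0 => /eqP.
  by rewrite a0 mul0r big1// => m _; rewrite am mul0r.
have ap : 0 < nrm a by rewrite lt_neqAle eq_sym a0 nrm_ge0.
have : 0 <= \sum_m (a m * nrm b - b m * nrm a) ^+ 2 by apply: sumr_ge0 => m _; exact: sqr_ge0.
have -> : \sum_m (a m * nrm b - b m * nrm a) ^+ 2 =
  (2 * (nrm a * nrm b)) * (nrm a * nrm b - \sum_m a m * b m).
  transitivity (nrm b ^+ 2 * \sum_m a m ^+ 2 + nrm a ^+ 2 * \sum_m b m ^+ 2
     - (2 * (nrm a * nrm b)) * \sum_m a m * b m).
    by rewrite !mulr_sumr -sumrN -!big_split/=; apply: eq_bigr => m _; ring.
  by rewrite -!nrmE; ring.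
by rewrite pmulr_rge0 ?mulr_gt0// subr_ge0.
Qed.

Lemma abs_le_nrm a m : `|a m| <= nrm a.
Proof.
rewrite -sqrtr_sqr ler_wsqrtr// (bigD1 m)//= lerDl sumr_ge0// => *; exact: sqr_ge0.
Qed.

End euclidean_norm.

(** Young's inequality for the conjugate exponents p and p/(p - 1), multiplied by p. *)
Lemma powR_young (R : realType) (p s t : R) : 1 < p -> 0 <= s -> 0 <= t ->
  p * s `^ (p - 1) * t <= (p - 1) * s `^ p + t `^ p.
Proof.
move=> p1 s0 t0.
have p0 : 0 < p by lra.
have p10 : 0 < p - 1 by lra.
have := @conjugate_powR R t (s `^ (p - 1)) p (p / (p - 1)) t0 (powR_ge0 _ _) p0 (divr_gt0 p0 p10).
have -> : p^-1 + (p / (p - 1))^-1 = 1 by field; rewrite !gt_eqF.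
move=> /(_ erefl); rewrite -powRrM.
have -> : (p - 1) * (p / (p - 1)) = p by field; rewrite gt_eqF.
move=> /(ler_wpM2l (ltW p0)); rewrite mulrA (mulrAC p).
move=> /le_trans; apply.
by rewrite le_eqVlt; apply/orP; left; apply/eqP; field; rewrite !gt_eqF.
Qed.

Section jensen.
Context {R : realType} {d : nat} {I : finType}.
Notation E := 'cV[R]_d.
Notation mu := (@leb R d).

Lemma integrable_sumE (J : Type) (s : seq J) (f : J -> E -> R) :
  (forall j, mu.-integrable setT (EFin \o f j)) ->
  mu.-integrable setT (EFin \o (fun x => \sum_(j <- s) f j x)).
Proof.
move=> fi; elim: s => [|j s IH].
  under [X in EFin \o X]eq_fun do rewrite big_nil.
  exact: integrable0.
under [X in EFin \o X]eq_fun do rewrite big_cons.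
exact: (integrableD measurableT (fi j) IH).
Qed.

Lemma Rintegral_sum (J : Type) (s : seq J) (f : J -> E -> R) :
  (forall j, mu.-integrable setT (EFin \o f j)) ->
  \int[mu]_x (\sum_(j <- s) f j x) = \sum_(j <- s) \int[mu]_x f j x.
Proof.
move=> fi; elim: s => [|j s IH].
  rewrite big_nil (@eq_Rintegral _ _ _ mu setT (cst 0)); first by rewrite Rintegral_cst// mul0r.
  by move=> x _; rewrite big_nil.
rewrite big_cons -IH -RintegralD//; last exact: integrable_sumE.
by apply: eq_Rintegral => x _; rewrite big_cons.
Qed.

Lemma measurable_nrm d' (T : measurableType d') (G : I -> T -> R) :
  (forall m, measurable_fun setT (G m)) -> measurable_fun setT (fun x => nrm (fun m => G m x)).
Proof.
move=> mG.
have -> : (fun x => nrm (fun m => G m x)) = (fun x => (\sum_m G m x ^+ 2) `^ 2^-1).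
  by apply/funext => x; rewrite powR12_sqrt// sumr_ge0// => m _; exact: sqr_ge0.
apply: (measurableT_comp (measurable_powR _)).
by apply: measurable_sum => m; exact: measurable_funX.
Qed.

(** With s the mean of G, p |s|^p is the mean of p |s|^(p-2) <s, G>, which Cauchy-Schwarz and Young
    bound by the mean of (p - 1) |s|^p + |G|^p. The kernel has mass 1, so (p - 1) |s|^p cancels.
    This is Jensen's inequality for the tangent of |.|^p at s. *)
Lemma moll_jensen (p dl : R) (k : E -> R) (G : I -> E -> R) (x : E) : 1 < p ->
  mollifier dl k -> (forall m, locL1 (G m)) ->
  ((nrm (fun m => moll k (G m) x) `^ p)%:E <=
   \int[mu]_z (k z * nrm (fun m => G m (x + z)) `^ p)%:E)%E.
Proof.
move=> p1 [ck sk k0 ik] lG.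
have mG m : measurable_fun setT (G m) by case: (lG m).
have mk := continuous_measurable_cV ck.
set s := fun m => moll k (G m) x.
pose N z := nrm (fun m => G m (x + z)).
have mN : measurable_fun setT N.
  by apply: measurable_nrm => m; exact: measurable_fun_shift.
have mkN : measurable_fun setT (fun z => k z * N z `^ p).
  apply: measurable_funM => //.
  exact: (measurableT_comp (measurable_powR p) mN).
have p0 : 0 < p by lra.
have [S0|S0] := eqVneq (nrm s) 0.
  by rewrite S0 powR0 ?gt_eqF//; apply: integral_ge0 => z _; rewrite lee_fin mulr_ge0// powR_ge0.
have Sp : 0 < nrm s by rewrite lt_neqAle eq_sym S0 nrm_ge0.
have [fin|] := ltP (\int[mu]_z (k z * N z `^ p)%:E)%E +oo%E; last first.
  by rewrite leye_eq => /eqP ->; rewrite leey.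
have intkN : mu.-integrable setT (EFin \o (fun z => k z * N z `^ p)).
  apply/integrableP; split; first exact/measurable_EFinP.
  rewrite (eq_integral (fun z => (k z * N z `^ p)%:E))//.
  by move=> z _; rewrite /= ger0_norm// mulr_ge0// powR_ge0.
have [C C0 HC] := continuous_bounded_supp ck sk.
have intk : mu.-integrable setT (EFin \o k).
  have -> : EFin \o k = EFin \o (fun z => k z * cst 1 z).
    by apply/funext => z; rewrite /= mulr1.
  apply: (@locL1_mul _ _ k (cst 1) dl C) => //; exact: locL1_cst.
have ik1 : \int[mu]_z k z = 1 by rewrite /Rintegral ik.
have intG m : mu.-integrable setT (EFin \o (fun z => k z * G m (x + z))).
  have := moll_integrable x ck sk (lG m).
  move=> /(integrable_shift x); congr (mu.-integrable _ _).
  by apply/funext => z /=; rewrite addrC addKr addrC.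
have sE m : s m = \int[mu]_z (k z * G m (x + z)) by exact: moll_shiftE.
suff : p * nrm s `^ p <= (p - 1) * nrm s `^ p + \int[mu]_z (k z * N z `^ p).
  move=> H; rewrite -[leRHS]fineK; last by exact: integrable_fin_num.
  by rewrite lee_fin; rewrite /Rintegral in H; lra.
have E1 : p * nrm s `^ p = \int[mu]_z (\sum_m (p * nrm s `^ (p - 2) * s m) * (k z * G m (x + z))).
  rewrite Rintegral_sum; last by move=> m; exact: (integrableZl measurableT _ (intG m)).
  under eq_bigr do rewrite RintegralZl// -sE -mulrA -expr2.
  rewrite -mulr_sumr -nrmE -mulrA; congr (_ * _).
  by rewrite -powR_mulrn ?nrm_ge0// -powRD ?S0 ?implybT//; congr (_ `^ _); lra.
have E2 : (p - 1) * nrm s `^ p + \int[mu]_z (k z * N z `^ p) =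
    \int[mu]_z (((p - 1) * nrm s `^ p) * k z + k z * N z `^ p).
  rewrite RintegralD//; last exact: (integrableZl measurableT _ intk).
  by rewrite RintegralZl// ik1 mulr1.
rewrite E1 E2; apply: le_Rintegral => //.
- by apply: integrable_sumE => m; exact: (integrableZl measurableT _ (intG m)).
- exact: (integrableD measurableT (integrableZl measurableT _ intk) intkN).
move=> z _.
have -> : \sum_m (p * nrm s `^ (p - 2) * s m) * (k z * G m (x + z)) =
    k z * (p * nrm s `^ (p - 2) * \sum_m s m * G m (x + z)).
  by rewrite !mulr_sumr; apply: eq_bigr => m _; ring.
have -> : ((p - 1) * nrm s `^ p) * k z + k z * N z `^ p = k z * ((p - 1) * nrm s `^ p + N z `^ p).
  by ring.
apply: ler_wpM2l => //.
apply: le_trans (powR_young p1 (nrm_ge0 s) (nrm_ge0 (fun m => G m (x + z)))).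
rewrite -!mulrA; apply: ler_wpM2l; first exact: ltW.
apply: le_trans (ler_wpM2l (powR_ge0 _ _) (dot_le_nrm s _)) _.
rewrite mulrA -[X in _ * X * _](powRr1 (nrm_ge0 s)) -powRD ?S0 ?implybT//.
by rewrite (_ : p - 2 + 1 = p - 1)//; lra.
Qed.

Lemma moll_Lp (p dl : R) (k : E -> R) (G : I -> E -> R) : 1 < p ->
  mollifier dl k -> (forall m, locL1 (G m)) ->
  (\int[mu]_x (nrm (fun m => moll k (G m) x) `^ p)%:E <=
   \int[mu]_x (nrm (fun m => G m x) `^ p)%:E)%E.
Proof.
move=> p1 mollk lG; have [ck sk k0 ik] := mollk.
have mG m : measurable_fun setT (G m) by case: (lG m).
have mk := continuous_measurable_cV ck.
pose N x := nrm (fun m => G m x) `^ p.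
have mN : measurable_fun setT N.
  by apply: (measurableT_comp (measurable_powR p)); exact: measurable_nrm.
pose h (xz : E * E) := (k xz.2 * N (xz.1 + xz.2))%:E.
have mh : measurable_fun setT h.
  apply/measurable_EFinP; apply: measurable_funM.
    exact: (measurableT_comp mk measurable_snd).
  exact: (measurableT_comp mN (@measurable_addE R d)).
have h0 xz : (0 <= h xz)%E by rewrite lee_fin !mulr_ge0// powR_ge0.
apply: (@le_trans _ _ (\int[mu]_x \int[mu]_z h (x, z))%E).
  apply: ge0_le_integral => //.
  - by move=> x _; rewrite lee_fin powR_ge0.
  - apply/measurable_EFinP; apply: (measurableT_comp (measurable_powR p)).
    apply: measurable_nrm => m; apply: continuous_measurable_cV.
    exact: moll_continuous ck sk (lG m).
  - exact: (measurable_fun_fubini_tonelli_F h).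
  - by move=> x _; exact: moll_jensen mollk lG.
rewrite (fubini_tonelli h)//.
rewrite (eq_integral (fun z => (k z)%:E * \int[mu]_x (N x)%:E)%E); last first.
  move=> z _.
  have EN : (\int[mu]_x (N (z + x)%R)%:E = \int[mu]_x (N x)%:E)%E.
    exact/(integral_shift (f := EFin \o N))/measurable_EFinP.
  have mNz : measurable_fun setT (fun x => (N (z + x))%:E).
    by apply/measurable_EFinP; exact: measurable_fun_shift.
  have N0 x : [set: E] x -> (0 <= (N (z + x)%R)%:E)%E by rewrite lee_fin powR_ge0.
  have kz0 : (0 <= (k z)%:E)%E by rewrite lee_fin.
  have := ge0_integralZl mu measurableT mNz N0 kz0; rewrite EN => <-.
  by apply: eq_integral => x _; rewrite /h EFinM addrC.
rewrite ge0_integralZr//; first by rewrite ik mul1e.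
- exact/measurable_EFinP.
- by move=> z _; rewrite lee_fin.
- by apply: integral_ge0 => x _; rewrite lee_fin powR_ge0.
Qed.

End jensen.

(** * Smooth radial kernels *)

Section derivation_rules.
Context {R : realType} {V : normedModType R} (x v : V).
Implicit Types (f g : V -> R) (a b : R).

Lemma derive_eq f a b : is_derive x v f a -> a = b -> is_derive x v f b.
Proof. by move=> df <-. Qed.

Lemma deriveCst a : is_derive x v (fun=> a) 0.
Proof. exact: is_derive_cst. Qed.

Lemma deriveAdd f g a b : is_derive x v f a -> is_derive x v g b ->
  is_derive x v (fun y => f y + g y) (a + b).
Proof. by move=> df dg; exact: is_deriveD df dg. Qed.

Lemma deriveMul f g a b : is_derive x v f a -> is_derive x v g b ->
  is_derive x v (fun y => f y * g y) (a * g x + f x * b).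
Proof.
move=> df dg; apply: derive_eq (is_deriveM df dg) _.
by rewrite /GRing.scale/= addrC mulrC.
Qed.

Lemma deriveComp (h : R -> R) f a b : is_derive (f x) 1 h a -> is_derive x v f b ->
  is_derive x v (fun y => h (f y)) (a * b).
Proof. exact: is_derive_comp. Qed.

Lemma deriveSum (J : Type) (s : seq J) (P : pred J) (f : J -> V -> R) (a : J -> R) :
  (forall j, is_derive x v (f j) (a j)) ->
  is_derive x v (fun y => \sum_(j <- s | P j) f j y) (\sum_(j <- s | P j) a j).
Proof.
move=> df; elim: s => [|j s IH].
  rewrite big_nil (_ : (fun _ => _) = (fun=> 0)); first exact: deriveCst.
  by apply/funext => y; rewrite big_nil.
rewrite big_cons (_ : (fun _ => _) = (fun y => if P j then f j y + \sum_(i <- s | P i) f i y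
   else \sum_(i <- s | P i) f i y)); last by apply/funext => y; rewrite big_cons.
by case: ifP => // _; exact: deriveAdd.
Qed.

End derivation_rules.

Section continuity_rules.
Context {R : realType} {T : topologicalType}.
Implicit Types f g : T -> R.

Lemma contCst (c : R) : continuous (fun _ : T => c).
Proof. by move=> y; exact: cvg_cst. Qed.

Lemma contAdd f g : continuous f -> continuous g -> continuous (fun y => f y + g y).
Proof. by move=> cf cg y; apply: cvgD; [exact: cf|exact: cg]. Qed.

Lemma contSub f g : continuous f -> continuous g -> continuous (fun y => f y - g y).
Proof. by move=> cf cg y; apply: cvgB; [exact: cf|exact: cg]. Qed.

Lemma contMul f g : continuous f -> continuous g -> continuous (fun y => f y * g y).
Proof. by move=> cf cg y; apply: cvgM; [exact: cf|exact: cg]. Qed.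

Lemma contComp (h : R -> R) f : continuous h -> continuous f -> continuous (fun y => h (f y)).
Proof. by move=> ch cf y; apply: continuous_comp; [exact: cf|exact: ch]. Qed.

End continuity_rules.

Lemma continuous_sumE (R : realType) (T : topologicalType) (J : Type) (s : seq J)
    (f : J -> T -> R) : (forall j, continuous (f j)) ->
  continuous (fun y => \sum_(j <- s) f j y).
Proof.
move=> cf; elim: s => [|j s IH] y.
  by rewrite (_ : (fun _ => _) = (fun=> 0)); [exact: cvg_cst|apply/funext => z; rewrite big_nil].
rewrite (_ : (fun _ => _) = (fun z => f j z + \sum_(i <- s) f i z)).
  by apply: cvgD; [exact: cf|exact: IH].
by apply/funext => z; rewrite big_cons.
Qed.

(** * Functions flat at the origin *)

Section flat_function.
Context {R : realType}.
Implicit Types (P : {poly R}) (t : R).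

(** The polynomial factor in 1/t makes the family stable under derivation: with s = 1/t, the
    derivative of P(s) exp (-s) is s^2 (P - P')(s) exp (-s), which explains [flat_deriv]. *)
Definition flat P t : R := if 0 < t then P.[t^-1] * expR (- t^-1) else 0.

Definition flat_deriv P : {poly R} := 'X^2 * (P - P^`()).

Lemma horner_bound P : exists2 C, 0 <= C & forall s, 1 <= s -> `|P.[s]| <= C * s ^+ (size P).
Proof.
exists (\sum_(i < size P) `|P`_i|); first by apply: sumr_ge0.
move=> s s1; rewrite horner_coef; apply: le_trans (ler_norm_sum _ _ _) _.
rewrite mulr_suml; apply: ler_sum => i _; rewrite normrM ler_wpM2l//.
have s0 : 0 <= s by apply: le_trans s1.
by rewrite normrX (ger0_norm s0) ler_weXn2l// ltnW.
Qed.

Lemma expRN_bound m : exists2 C : R, 0 <= C & forall s : R, 0 < s -> s ^+ m * expR (- s) <= C.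
Proof.
(* From x <= exp x at x = s/(m+1), raised to the power m. *)
exists (m.+1%:R ^+ m) => [|s s0]; first by rewrite exprn_ge0.
have m0 : (0 : R) < m.+1%:R by [].
have h : s / m.+1%:R <= expR (s / m.+1%:R).
  by apply: le_trans (expR_ge1Dx _); rewrite lerDr.
have h2 : (s / m.+1%:R) ^+ m <= expR s.
  apply: (@le_trans _ _ (expR (s / m.+1%:R) ^+ m)).
    by rewrite lerXn2r// nnegrE ?expR_ge0// divr_ge0// ltW.
  rewrite -expRM_natl ler_expR mulrCA ler_piMr ?ltW//.
  by rewrite ltr_pdivrMr// mul1r ltr_nat.
rewrite expRN ler_pdivrMr ?expR_gt0// mulrC.
move: h2; rewrite expr_div_n ler_pdivrMr ?exprn_gt0//.
Qed.

(** The exponential beats every power of 1/t. Quadratic decay is all that the derivative at 0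
    requires. *)
Lemma flat_bound P : exists2 C, 0 <= C & forall t, t <= 1 -> `|flat P t| <= C * t ^+ 2.
Proof.
have [C1 C10 H1] := horner_bound P.
have [C2 C20 H2] := expRN_bound (size P + 2).
exists (C1 * C2); first exact: mulr_ge0.
move=> t t1; rewrite /flat; case: ltP => t0; last by rewrite normr0 mulr_ge0 ?sqr_ge0 ?mulr_ge0.
have s1 : 1 <= t^-1 by rewrite invf_ge1.
rewrite normrM (ger0_norm (expR_ge0 _)).
apply: (@le_trans _ _ (C1 * t^-1 ^+ size P * expR (- t^-1))).
  by rewrite ler_wpM2r ?expR_ge0// H1.
rewrite -!mulrA ler_wpM2l//.
have ti : 0 < t^-1 by rewrite invr_gt0.
have := H2 _ ti; rewrite exprD => /(ler_wpM2r (sqr_ge0 t)); apply: le_trans.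
rewrite le_eqVlt; apply/orP; left; apply/eqP.
by field; rewrite gt_eqF.
Qed.

Lemma is_derive_quadratic (f : R -> R) C : f 0 = 0 ->
  (forall t, t <= 1 -> `|f t| <= C * t ^+ 2) -> is_derive (0 : R) 1 f 0.
Proof.
move=> f0 H.
have C0 : 0 <= C.
  by have := H 1 (lexx _); rewrite expr1n mulr1; apply: le_trans.
have : (fun h : R => h^-1 *: ((f \o shift 0) (h *: 1) - f 0)) @ 0^' --> (0 : R).
  apply/cvgr0Pnorm_le => e e0; near=> h.
  have h0 : h != 0 by near: h; exact: nbhs_dnbhs_neq.
  rewrite /= f0 subr0 addr0 [h *: 1]mulr1 normrZ normfV ler_pdivrMl ?normr_gt0//.
  have h1 : `|h| <= 1.
    by near: h; apply: dnbhs0_le.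
  apply: le_trans (H _ (le_trans (ler_norm _) h1)) _.
  rewrite -real_normK ?num_real// expr2 mulrA mulrC ler_wpM2l//.
  have : `|h| <= e / (C + 1).
    near: h; apply: dnbhs0_le; apply: divr_gt0 => //; lra.
  move=> /(ler_wpM2l C0) /le_trans; apply.
  rewrite mulrCA ler_piMr ?(ltW e0)// ler_pdivrMr ?mul1r; lra.
move=> cf; constructor; first by apply/cvg_ex; exists 0.
exact/cvg_lim.
Unshelve. all: by end_near. Qed.

Lemma is_derive_flat P t : is_derive t 1 (flat P) (flat (flat_deriv P) t).
Proof.
have [t0|t0|->] := ltgtP t 0; last first.
- have [C C0 H] := flat_bound P.
  rewrite [X in is_derive _ _ _ X]/flat ltxx.
  by apply: is_derive_quadratic H; rewrite /flat ltxx.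
- apply: (@near_eq_is_derive _ _ _ (fun t => P.[t^-1] * expR (- t^-1)) (flat P)).
    by near=> u; rewrite /flat ifT//; near: u; exact: lt_nbhsr.
  rewrite /flat t0.
  have tn : t != 0 by rewrite gt_eqF.
  have i1 : is_derive t 1 (fun u : R => u^-1) (- t ^- 2).
    apply: derive_eq (@is_deriveV R id t 1 1 tn (is_derive_id _ _)) _.
    by rewrite /GRing.scale/= mulr1.
  have i2 := deriveComp (is_derive_poly P t^-1) i1.
  have i3 : is_derive t 1 (fun u : R => - u^-1) (t ^- 2).
    by apply: derive_eq (is_deriveN i1) _; rewrite opprK.
  have i4 := @deriveComp R R t 1 expR (fun u => - u^-1) _ _ (is_derive_expR (- t^-1)) i3.
  apply: derive_eq (deriveMul i2 i4) _.
  rewrite /flat_deriv hornerM hornerXn hornerD hornerN.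
  by set e := expR _; set q := P.[_]; set q' := _.[_]; field.
- apply: (@near_eq_is_derive _ _ _ (cst 0) (flat P)).
    by near=> u; rewrite /flat ltNge ifF//; apply/negbF/ltW; near: u; exact: lt_nbhsl.
  rewrite /flat ltNge ltW//=; exact: is_derive_cst.
Unshelve. all: by end_near. Qed.

Lemma continuous_flat P : continuous (flat P).
Proof.
move=> t; have [H _] := is_derive_flat P t.
exact/differentiable_continuous/derivable1_diffP.
Qed.

Lemma flat1_ge0 t : 0 <= flat 1 t.
Proof. by rewrite /flat; case: ifP => // _; rewrite hornerE mul1r expR_ge0. Qed.

End flat_function.

(** * Smooth radial kernels of small support *)

Section radial_mollifier.
Context {R : realType} {d : nat}.
Notation E := 'cV[R]_d.
Notation mu := (@leb R d).
Notation e_ i := (delta_mx i 0 : E).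

Lemma is_derive_coord (i j : 'I_d) (x : E) :
  is_derive x (e_ i) (fun y : E => y j 0) (i == j)%:R.
Proof.
apply/is_derive_line0P.
have -> : (fun s : R => (s *: e_ i + x) j 0) = (fun s : R => s * (i == j)%:R + x j 0).
  by apply/funext => s; rewrite !mxE eqxx andbT eq_sym.
apply: derive_eq (deriveAdd (deriveMul (is_derive_id _ _) (deriveCst _ _ _)) (deriveCst _ _ _)) _.
by rewrite mul1r mulr0 !addr0.
Qed.

Section smooth_class.
Variables (x : E) (r : R).

Definition sqdist (y : E) : R := \sum_i (y i 0 - x i 0) ^+ 2.

(* A class of functions stable under partial derivatives, hence of smooth
   functions, which contains the bump exp (-1/(r^2 - |y - x|^2)). *)
Inductive bumps : (E -> R) -> Prop :=
| bumps_cst c : bumps (fun=> c)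
| bumps_coord i : bumps (fun y => y i 0)
| bumps_flat P : bumps (fun y => flat P (r ^+ 2 - sqdist y))
| bumpsD f g : bumps f -> bumps g -> bumps (fun y => f y + g y)
| bumpsM f g : bumps f -> bumps g -> bumps (fun y => f y * g y).

Lemma continuous_sqdist : continuous sqdist.
Proof.
apply: continuous_sumE => i.
have h : continuous (fun y : E => y i 0 - x i 0).
  by apply: contSub; [exact: coord_continuous|exact: contCst].
exact: (contMul h h).
Qed.

Lemma is_derive_sqdist (i : 'I_d) (y : E) : is_derive y (e_ i) sqdist (2 * (y i 0 - x i 0)).
Proof.
have H j : is_derive y (e_ i) (fun z : E => (z j 0 - x j 0) ^+ 2) ((i == j)%:R * (2 * (y j 0 - x j 0))).
  have h := deriveAdd (is_derive_coord i j y) (deriveCst y (e_ i) (- x j 0)).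
  by apply: derive_eq (deriveMul h h) _; ring.
apply: derive_eq (deriveSum (index_enum _) predT H) _.
rewrite (bigD1 i)//= eqxx mul1r big1 ?addr0// => j ji.
by rewrite eq_sym (negbTE ji) mul0r.
Qed.

Lemma is_derive_bump (P : {poly R}) (i : 'I_d) (y : E) :
  is_derive y (e_ i) (fun y => flat P (r ^+ 2 - sqdist y))
    (- 2 * (y i 0 - x i 0) * flat (flat_deriv P) (r ^+ 2 - sqdist y)).
Proof.
have H : is_derive y (e_ i) (fun y => r ^+ 2 - sqdist y) (- (2 * (y i 0 - x i 0))).
  by apply: derive_eq (is_deriveB (deriveCst y (e_ i) (r ^+ 2)) (is_derive_sqdist i y)) _; rewrite sub0r.
by apply: derive_eq (@deriveComp _ _ y (e_ i) (flat P) (fun y => r ^+ 2 - sqdist y) _ _ (is_derive_flat P (r ^+ 2 - sqdist y)) H) _; ring.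
Qed.

Lemma bumps_continuous f : bumps f -> continuous f.
Proof.
elim=> [c|i|P|g h _ cg _ ch|g h _ cg _ ch].
- exact: contCst.
- exact: coord_continuous.
- apply: (@contComp _ _ (flat P) (fun y => r ^+ 2 - sqdist y)); first exact: continuous_flat.
  by apply: contSub; [exact: contCst|exact: continuous_sqdist].
- exact: contAdd.
- exact: contMul.
Qed.

Lemma bumps_derive f i : bumps f ->
  exists2 g, bumps g & forall y, is_derive y (e_ i) f (g y).
Proof.
elim=> [c|j|P|g h bg [g' bg' dg] bh [h' bh' dh]|g h bg [g' bg' dg] bh [h' bh' dh]].
- by exists (fun=> 0) => [|y]; [exact: bumps_cst|exact: deriveCst].
- by exists (fun=> (i == j)%:R) => [|y]; [exact: bumps_cst|exact: is_derive_coord].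
- exists (fun y : E => - 2 * (y i 0 + - x i 0) * flat (flat_deriv P) (r ^+ 2 - sqdist y)) => [|y].
    apply: bumpsM; last exact: bumps_flat.
    apply: bumpsM; first exact: bumps_cst.
    by apply: bumpsD; [exact: bumps_coord|exact: bumps_cst].
  exact: is_derive_bump.
- exists (fun y => g' y + h' y) => [|y]; first exact: bumpsD.
  exact: deriveAdd (dg y) (dh y).
- exists (fun y => g' y * h y + g y * h' y) => [|y].
    by apply: bumpsD; exact: bumpsM.
  exact: deriveMul (dg y) (dh y).
Qed.

Lemma bumps_smooth f : bumps f -> smooth f.
Proof.
move=> bf s.
have {bf} : bumps (foldr (@partial R d) f s).
  elim: s => //= i s IH; have [g bg dg] := bumps_derive i IH.
  by rewrite (_ : partial i _ = g)//; apply/funext => y; rewrite /partial; case: (dg y).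
move=> bs; split; first exact: bumps_continuous.
by move=> i y; have [g _ dg] := bumps_derive i bs; case: (dg y).
Qed.

Lemma sqdist_cube y s : 0 <= s -> sqdist y <= s ^+ 2 -> cube s (y - x).
Proof.
move=> s0 ys i; rewrite !mxE -[leRHS](ger0_norm s0) -ler_sqr ?nnegrE ?normr_ge0//.
rewrite !real_normK ?num_real//; apply: le_trans ys.
by rewrite /sqdist (bigD1 i)//= lerDl sumr_ge0// => j _; exact: sqr_ge0.
Qed.

Lemma test_function_bumps f : bumps f -> (forall y, ~ cube r (y - x) -> f y = 0) ->
  test_function f.
Proof.
move=> bf sf; split; first exact: bumps_smooth.
have sub : [set y | f y != 0] `<=` cube (r + `|x|).
  move=> y /= /eqP fy; rewrite -[y](subrK x).
  apply: cubeD; last exact: in_cube.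
  by apply: contrapT => /sf.
apply: subclosed_compact (@closed_closure _ _) (@compact_cube R d (r + `|x|)) _.
apply: subset_trans (closure_subset sub) _.
by have <- := (closure_id _).1 (@closed_cube R d (r + `|x|)).
Qed.

End smooth_class.

Lemma prode_cst (n : nat) (a : R) : (\prod_(i < n) a%:E = (a ^+ n)%:E)%E.
Proof.
elim: n => [|n IH]; first by rewrite big_ord0 expr0.
by rewrite big_ord_recl IH -EFinM exprS.
Qed.

Lemma cube_measure (s : R) : 0 < s -> lebesgue_cV d (cube s) = ((2 * s) ^+ d)%:E.
Proof.
move=> s0; rewrite cubeE (@lebesgue_cV_prod _ _ (fun=> _)); last by move=> i; exact: measurable_itv.
rewrite -prode_cst; apply: eq_bigr => i _.
rewrite lebesgue_measure_itv/= lte_fin ifT; last by lra.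
by rewrite -EFinB; congr (_%:E); ring.
Qed.

(** Radiality is recorded infinitesimally: x_j D_i k = x_i D_j k says that every rotation field
    annihilates [k]. Of the two families of test functions, the first serves for the derivatives of
    mollifications and the second for the commutator with the drift. *)
Lemma radial_mollifier (r : R) : 0 < r -> exists k (k' : 'I_d -> E -> R),
  [/\ mollifier r k,
      forall i, continuous (k' i) /\ supported r (k' i),
      forall i x, is_derive x (e_ i) k (k' i x),
      forall i j (x : E), x j 0 * k' i x = x i 0 * k' j x &
      (forall x : E, test_function (fun y => k (y - x))) /\
      (forall (x : E) j, test_function (fun y => k (y - x) * (y - x) j 0))].
Proof.
move=> r0.
pose b (P : {poly R}) (x y : E) := flat P (r ^+ 2 - sqdist x y).
have b0 (P : {poly R}) x y : ~ cube r (y - x) -> b P x y = 0.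
  move=> ny; rewrite /b /flat ifF//; apply/negbTE; rewrite -leNgt subr_le0.
  by rewrite leNgt; apply/negP => /ltW h; apply: ny; apply: sqdist_cube h; exact: ltW.
have bE P x y : b P 0 (y - x) = b P x y.
  rewrite /b; congr (flat _ (_ - _)); apply: eq_bigr => i _.
  by rewrite !mxE subr0.
have cb P x : continuous (b P x) by apply/(@bumps_continuous x r)/bumps_flat.
have b1_ge0 y : 0 <= b 1 0 y by exact: flat1_ge0.
have sb P : supported r (b P 0) by move=> y ny; apply: b0; rewrite subr0.
have mb P x : measurable_fun setT (b P x) by exact: continuous_measurable_cV.
have ib : mu.-integrable setT (EFin \o b 1 0).
  have [C C0 HC] := continuous_bounded_supp (cb 1 0) (sb 1).
  apply: (integrable_supp (mb _ _) (sb 1)).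
  apply: measurable_bounded_integrable => //.
  - exact: measurable_cube.
  - exact: cube_fin.
  - exact: measurable_funTS.
  - by exists C; split; [rewrite num_real|move=> M /ltW CM y _; apply: le_trans (HC _) CM].
pose c := \int[mu]_y b 1 0 y.
have cE : (\int[mu]_y (b 1 0 y)%:E = c%:E)%E by rewrite /c /Rintegral fineK//; exact: integrable_fin_num.
have c0 : 0 < c.
  (* Small enough that [cube s] lies in the ball |y|^2 <= r^2/2, on which the bump is at least [m];
     this makes its integral positive. *)
  pose s : R := r / (2 * d.+1%:R).
  have s0 : 0 < s by rewrite divr_gt0// mulr_gt0.
  have t0 : 0 < r ^+ 2 / 2 by rewrite divr_gt0// exprn_gt0.
  pose m := expR (- (r ^+ 2 / 2)^-1).
  have bm y : cube s y -> m <= b 1 0 y.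
    move=> sy.
    have sd : sqdist 0 y <= r ^+ 2 / 2.
      apply: (@le_trans _ _ (\sum_(i < d) s ^+ 2)).
        apply: ler_sum => i _; rewrite mxE subr0 -[leLHS]real_normK ?num_real//.
        by rewrite lerXn2r// nnegrE ltW.
      have rE : r = s * (2 * (d%:R + 1)).
        by rewrite /s natr1 divfK// mulf_neq0// pnatr_eq0.
      rewrite sumr_const card_ord -[leLHS]mulr_natl rE -subr_ge0.
      have -> : (s * (2 * (d%:R + 1))) ^+ 2 / 2 - d%:R * s ^+ 2 =
        s ^+ 2 * (2 * d%:R ^+ 2 + 3 * d%:R + 2) by field.
      by rewrite mulr_ge0 ?sqr_ge0// !addr_ge0// mulr_ge0// sqr_ge0.
    have rs : r ^+ 2 / 2 <= r ^+ 2 - sqdist 0 y by lra.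
    rewrite /b /flat (lt_le_trans t0 rs) hornerE mul1r ler_expR lerN2 lef_pV2// posrE.
    exact: lt_le_trans rs.
  rewrite -lte_fin -cE.
  have m0 : 0 < m by exact: expR_gt0.
  apply: (@lt_le_trans _ _ (\int[mu]_(y in cube s) m%:E)%E).
    rewrite integral_cst; last exact: measurable_cube.
    by rewrite /leb cube_measure// -EFinM lte_fin mulr_gt0// exprn_gt0// mulr_gt0.
  apply: le_trans (ge0_le_integral_cube s _ _).
  - apply: ge0_le_integral => //.
    + exact: measurable_cube.
    + by move=> *; rewrite lee_fin ltW.
    + exact/measurable_funTS/measurable_EFinP.
  - exact/measurable_EFinP.
  - by move=> y; rewrite lee_fin.
pose k y := c^-1 * b 1 0 y.
(* Each partial derivative is y_i times a factor that does not depend on [i], whence the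
   symmetry. *)
pose k' (i : 'I_d) (y : E) := c^-1 * (- 2 * y i 0 * b (flat_deriv 1) 0 y).
have ck' i : continuous (k' i).
  apply: contMul; first exact: contCst.
  apply: contMul; last exact: cb.
  by apply: contMul; [exact: contCst|exact: coord_continuous].
have bk x : bumps x r (fun y => k (y - x)).
  rewrite (_ : (fun _ => _) = fun y => c^-1 * b 1 x y).
    by apply: bumpsM; [exact: bumps_cst|exact: bumps_flat].
  by apply/funext => y; rewrite /k bE.
exists k, k'; split.
- split.
  + by apply: contMul; [exact: contCst|exact: cb].
  + by move=> y ny; rewrite /k (sb _ _ ny) mulr0.
  + by move=> y; rewrite mulr_ge0// invr_ge0 ltW.
  + rewrite (eq_integral (fun y => c^-1%:E * (b 1 0 y)%:E)%E)//.
    rewrite ge0_integralZl//.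
    * by rewrite cE -EFinM mulVf// gt_eqF.
    * exact/measurable_EFinP.
    * by move=> y _; rewrite lee_fin.
    * by rewrite lee_fin invr_ge0 ltW.
- move=> i; split; first exact: ck'.
  by move=> y ny; rewrite /k' (sb _ _ ny) !mulr0.
- move=> i x; apply: derive_eq (deriveMul (deriveCst _ _ c^-1) (is_derive_bump 0 r 1 i x)) _.
  by rewrite mul0r add0r mxE subr0.
- by move=> i j x; rewrite /k'; ring.
- split=> x; first apply: (test_function_bumps (bk x)).
    by move=> y ny; rewrite /k (sb _ _ ny) mulr0.
  move=> j; apply: (@test_function_bumps x r).
    rewrite (_ : (fun _ => _) = fun y => k (y - x) * (y j 0 + - x j 0)).
      apply: bumpsM => //; apply: bumpsD; [exact: bumps_coord|exact: bumps_cst].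
    by apply/funext => y; rewrite !mxE.
  by move=> y ny; rewrite /k (sb _ _ ny) mulr0 mul0r.
Qed.

End radial_mollifier.

(** * The energy estimate for classical solutions *)

Section quadratic_forms.
Context {R : realType} {I : finType}.
Implicit Types (u v w : I -> R) (M : I -> I -> R).

Definition dot u v : R := \sum_m u m * v m.
Definition mv M w : I -> R := fun m => \sum_n M m n * w n.

Lemma dotC u v : dot u v = dot v u.
Proof. by apply: eq_bigr => m _; rewrite mulrC. Qed.

Lemma mv_bound M : exists2 K, 0 <= K & forall u w, `|dot u (mv M w)| <= K * (nrm u * nrm w).
Proof.
exists (\sum_m \sum_n `|M m n|); first by apply: sumr_ge0 => m _; apply: sumr_ge0.
move=> u w; apply: le_trans (ler_norm_sum _ _ _) _.
rewrite mulr_suml; apply: ler_sum => m _.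
rewrite normrM mulr_suml.
apply: le_trans (ler_wpM2l (normr_ge0 _) (ler_norm_sum _ _ _)) _.
rewrite mulr_sumr; apply: ler_sum => n _; rewrite normrM mulrCA ler_wpM2l//.
by apply: ler_pM => //; exact: abs_le_nrm.
Qed.

End quadratic_forms.

(** The linear bookkeeping that ends [pointwise_energy], on generalised terms: the share [x3] of the
    zeroth-order term pays for Young's inequality on the right-hand side, and [x4] is left over. *)
Lemma energy_arith (R : realDomainType) (x1 x2 x3 x4 x5 x6 x7 x8 x9 : R) :
  x7 <= x3 + x9 -> x1 - x5 <= x6 -> x3 + x4 - x2 <= x8 ->
  x4 + x1 <= x8 - x7 + x6 + x9 + x2 + x5.
Proof. by move=> h1 h2 h3; lra. Qed.

(** * The pointwise energy inequality *)

Section pointwise_energy.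
Context {R : realType} {I : finType} {d : nat}.
Variables (p gam kap K : R) (M C : I -> I -> R).
Hypotheses (p1 : 1 < p) (gam0 : 0 < gam) (kap0 : 0 < kap) (K0 : 0 <= K).
Hypothesis hK : forall u w : I -> R, `|dot u (mv M w)| <= K * (nrm u * nrm w).
Hypothesis hM : forall z w : I -> R,
  gam * nrm z ^+ 2 * nrm w ^+ 2 <=
  nrm z ^+ 2 * dot w (mv M w) + (p - 2) * dot w z * dot z (mv M w).
Hypothesis hM2 : forall w : I -> R, gam * nrm w ^+ 2 <= dot w (mv M w).
Hypothesis hC : forall w : I -> R, kap * nrm w ^+ 2 <= dot w (mv C w).

(* T is the divergence of the fluxes of the energy identity, expanded: it
   integrates to 0. *)
Lemma pointwise_energy (u g : I -> R) (Du DDu : 'I_d -> I -> R)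
    (sx dchi : 'I_d -> R) (t r eps : R) :
  0 <= t -> 0 < r -> 0 < eps ->
  (forall j, `|dchi j| <= 4 * t / r) ->
  (forall m, g m = mv C u m - mv M (fun n => \sum_j DDu j n) m - \sum_j sx j * Du j m) ->
  let q := nrm u ^+ 2 + eps in
  let a := (p - 2) / 2 in
  let T := \sum_j (dchi j * (q `^ a * dot u (mv M (Du j))) +
      t ^+ 2 * ((p - 2) * q `^ (a - 1) * dot u (Du j) * dot u (mv M (Du j)) +
               q `^ a * (dot (Du j) (mv M (Du j)) + dot u (mv M (DDu j)))))
    + t ^+ 2 * q `^ a * \sum_j sx j * dot u (Du j) in
  is_true (kap * t ^+ 2 * q `^ (p / 2) + p * gam / 2 * t ^+ 2 * (q `^ a * \sum_j nrm (Du j) ^+ 2) <=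
  p * T + kap `^ (1 - p) * t ^+ 2 * nrm g `^ p + p * kap * t ^+ 2 * (eps * q `^ a)
   + 8 * p * d%:R * K ^+ 2 / (gam * r ^+ 2) * q `^ (p / 2)).
Proof.
move=> t0 r0 e0 hd hg q a T.
have p0 : 0 < p := lt_trans ltr01 p1.
have q0 : 0 < q by rewrite ltr_wpDl// sqr_ge0.
have qn0 : q != 0 by rewrite gt_eqF.
have qa0 : 0 <= q `^ a by exact: powR_ge0.
have qE1 : q `^ (a - 1) * q = q `^ a.
  rewrite -[X in _ * X](powRr1 (ltW q0)) -powRD ?qn0 ?implybT//.
  by rewrite subrK.
have qE2 : q `^ a * q = q `^ (p / 2).
  rewrite -[X in _ * X](powRr1 (ltW q0)) -powRD ?qn0 ?implybT//.
  by congr (_ `^ _); rewrite /a; field.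
have uq : nrm u ^+ 2 <= q by rewrite lerDl ltW.
have dotug : dot u g = dot u (mv C u) - \sum_j dot u (mv M (DDu j)) - \sum_j sx j * dot u (Du j).
  rewrite /dot (eq_bigr (fun m => u m * mv C u m - u m * mv M (fun n => \sum_j DDu j n) m
     - u m * \sum_j sx j * Du j m)); last by move=> m _; rewrite hg; ring.
  rewrite !sumrB; congr (_ - _ - _).
    rewrite exchange_big/=; apply: eq_bigr => m _; rewrite -mulr_sumr; congr (_ * _).
    rewrite /mv exchange_big/=; apply: eq_bigr => n _.
    by rewrite mulr_sumr.
  under [RHS]eq_bigr do rewrite mulr_sumr.
  rewrite exchange_big/=; apply: eq_bigr => m _; rewrite mulr_sumr.
  by apply: eq_bigr => j _; ring.
pose Z j := dchi j * (q `^ a * dot u (mv M (Du j))) +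
      t ^+ 2 * ((p - 2) * q `^ (a - 1) * dot u (Du j) * dot u (mv M (Du j)) +
               q `^ a * dot (Du j) (mv M (Du j))).
have TE : T = t ^+ 2 * q `^ a * dot u (mv C u) - t ^+ 2 * q `^ a * dot u g + \sum_j Z j.
  rewrite dotug /T.
  rewrite (eq_bigr (fun j => Z j + t ^+ 2 * q `^ a * dot u (mv M (DDu j)))); last first.
    by move=> j _; rewrite /Z; ring.
  by rewrite big_split/= -mulr_sumr; ring.
have Zge j : gam / 2 * t ^+ 2 * (q `^ a * nrm (Du j) ^+ 2) -
    8 * K ^+ 2 / (gam * r ^+ 2) * q `^ (p / 2) <= Z j.
  set N := nrm (Du j).
  have N0 : 0 <= N := nrm_ge0 _.
  have u0 : 0 <= nrm u := nrm_ge0 _.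
  (* Factor out q^(a-1) and split q = |u|^2 + eps: [hM] with z = u and w = D_j u treats the first
     part, coercivity [hM2] the second. *)
  have Q : gam * t ^+ 2 * (q `^ a * N ^+ 2) <=
     t ^+ 2 * ((p - 2) * q `^ (a - 1) * dot u (Du j) * dot u (mv M (Du j)) +
               q `^ a * dot (Du j) (mv M (Du j))).
    have -> : gam * t ^+ 2 * (q `^ a * N ^+ 2) = t ^+ 2 * (q `^ (a - 1) * (gam * q * N ^+ 2)).
      by rewrite -qE1; ring.
    apply: ler_wpM2l; first exact: sqr_ge0.
    rewrite -[X in _ + X * _]qE1.
    have -> : (p - 2) * q `^ (a - 1) * dot u (Du j) * dot u (mv M (Du j)) +
      q `^ (a - 1) * q * dot (Du j) (mv M (Du j)) =
      q `^ (a - 1) * ((nrm u ^+ 2 * dot (Du j) (mv M (Du j)) +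
         (p - 2) * dot (Du j) u * dot u (mv M (Du j))) + eps * dot (Du j) (mv M (Du j))).
      by rewrite (dotC (Du j) u) /q; ring.
    apply: ler_wpM2l; first exact: powR_ge0.
    have -> : gam * q * N ^+ 2 = gam * nrm u ^+ 2 * nrm (Du j) ^+ 2 + eps * (gam * nrm (Du j) ^+ 2).
      by rewrite /q /N; ring.
    by apply: lerD; [exact: hM|apply: ler_wpM2l; [exact: ltW|exact: hM2]].
  have L : - (gam / 2 * t ^+ 2 * (q `^ a * N ^+ 2) + 8 * K ^+ 2 / (gam * r ^+ 2) * q `^ (p / 2)) <=
     dchi j * (q `^ a * dot u (mv M (Du j))).
    rewrite lerNl; apply: le_trans (ler_norm _) _; rewrite normrN !normrM (ger0_norm qa0).
    have h1 : `|dchi j| * `|dot u (mv M (Du j))| <= 4 * t / r * (K * (nrm u * N)).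
      by apply: ler_pM => //; exact: hK.
    (* Half of the ellipticity constant is spent here; the difference of the two sides is a complete
       square. *)
    have h2 : 4 * t / r * (K * (nrm u * N)) <=
       gam / 2 * t ^+ 2 * N ^+ 2 + 8 * K ^+ 2 / (gam * r ^+ 2) * nrm u ^+ 2.
      rewrite -subr_ge0.
      have -> : gam / 2 * t ^+ 2 * N ^+ 2 + 8 * K ^+ 2 / (gam * r ^+ 2) * nrm u ^+ 2 -
        4 * t / r * (K * (nrm u * N)) =
        (gam * t * N - 4 * K * nrm u / r) ^+ 2 / (2 * gam).
        by field; rewrite ?gt_eqF.
      by rewrite divr_ge0 ?sqr_ge0// mulr_ge0// ltW.
    rewrite mulrCA; apply: le_trans (ler_wpM2l qa0 (le_trans h1 h2)) _.
    rewrite mulrDr; apply: lerD; first by rewrite le_eqVlt; apply/orP; left; apply/eqP; ring.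
    rewrite mulrCA; apply: ler_wpM2l.
      by rewrite divr_ge0// mulr_ge0// ?sqr_ge0// ltW// exprn_gt0.
    by rewrite -qE2; apply: ler_wpM2l.
  have := lerD L Q; rewrite /Z -/N => h.
  apply: le_trans h.
  by rewrite le_eqVlt; apply/orP; left; apply/eqP; field; rewrite ?gt_eqF.
have sumZ : gam / 2 * t ^+ 2 * (q `^ a * \sum_j nrm (Du j) ^+ 2) -
    8 * d%:R * K ^+ 2 / (gam * r ^+ 2) * q `^ (p / 2) <= \sum_j Z j.
  apply: le_trans (ler_sum _ (fun j _ => Zge j)).
  rewrite sumrB sumr_const card_ord -!mulr_sumr -[X in _ <= _ - X]mulr_natl.
  by rewrite le_eqVlt; apply/orP; left; apply/eqP; field; rewrite ?gt_eqF.
(* Coercivity yields |u|^2 = q - eps in place of q, which is the origin of the eps term in the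
   conclusion. *)
have hCu : kap * t ^+ 2 * (q `^ (p / 2) - eps * q `^ a) <= t ^+ 2 * q `^ a * dot u (mv C u).
  have -> : kap * t ^+ 2 * (q `^ (p / 2) - eps * q `^ a) = t ^+ 2 * q `^ a * (kap * nrm u ^+ 2).
    by rewrite -qE2 /q; ring.
  apply: ler_wpM2l; last exact: hC.
  by rewrite mulr_ge0// sqr_ge0.
(* Young's inequality for q^(1/2) and |g|/kap, multiplied by kap: it uses p - 1 of the p available
   copies of the zeroth-order term and produces kap^(1-p). *)
have hG : p * (t ^+ 2 * q `^ a * dot u g) <=
    (p - 1) * kap * t ^+ 2 * q `^ (p / 2) + kap `^ (1 - p) * t ^+ 2 * nrm g `^ p.
  have sq0 : 0 <= q `^ 2^-1 := powR_ge0 _ _.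
  have usq : nrm u <= q `^ 2^-1.
    by rewrite (powR12_sqrt (ltW q0)) -[leLHS](ger0_norm (nrm_ge0 u)) -sqrtr_sqr ler_wsqrtr.
  have := powR_young p1 sq0 (divr_ge0 (nrm_ge0 g) (ltW kap0)).
  rewrite -!powRrM [2^-1 * p]mulrC => Y.
  have E3 : q `^ a * q `^ 2^-1 = q `^ (2^-1 * (p - 1)).
    by rewrite -powRD ?qn0 ?implybT//; congr (_ `^ _); rewrite /a; field.
  have kn0 : kap != 0 by rewrite gt_eqF.
  have E4 : (nrm g / kap) `^ p * kap = kap `^ (1 - p) * nrm g `^ p.
    rewrite powRM ?nrm_ge0 ?invr_ge0 ?(ltW kap0)// -powR_inv1 ?(ltW kap0)// -powRrM.
    rewrite -mulrA -[X in _ * (_ * X)](powRr1 (ltW kap0)) -powRD ?kn0 ?implybT// mulrC.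
    by congr (_ `^ _ * _); ring.
  have h3 : q `^ a * dot u g <= q `^ (2^-1 * (p - 1)) * nrm g.
    rewrite -E3 -mulrA; apply: ler_wpM2l => //; apply: le_trans (dot_le_nrm _ _) _.
    by rewrite ler_wpM2r// nrm_ge0.
  have h4 : p * (q `^ (2^-1 * (p - 1)) * nrm g) <= (p - 1) * kap * q `^ (p / 2) + kap `^ (1 - p) * nrm g `^ p.
    rewrite -E4; move: Y => /(ler_wpM2l (ltW kap0)).
    rewrite (_ : kap * (_ * (nrm g / kap)) = p * (q `^ (2^-1 * (p - 1)) * nrm g)); last first.
      by field; rewrite gt_eqF.
    by move=> /le_trans; apply; rewrite le_eqVlt; apply/orP; left; apply/eqP; ring.
  have -> : p * (t ^+ 2 * q `^ a * dot u g) = t ^+ 2 * (p * (q `^ a * dot u g)) by ring.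
  have -> : (p - 1) * kap * t ^+ 2 * q `^ (p / 2) + kap `^ (1 - p) * t ^+ 2 * nrm g `^ p =
    t ^+ 2 * ((p - 1) * kap * q `^ (p / 2) + kap `^ (1 - p) * nrm g `^ p) by ring.
  apply: ler_wpM2l; first exact: sqr_ge0.
  by apply: le_trans h4; apply: ler_wpM2l => //; exact: ltW.
rewrite TE.
move: hG (ler_wpM2l (ltW p0) sumZ) (ler_wpM2l (ltW p0) hCu).
have -> : 8 * p * d%:R * K ^+ 2 / (gam * r ^+ 2) * q `^ (p / 2) =
  p * (8 * d%:R * K ^+ 2 / (gam * r ^+ 2) * q `^ (p / 2)) by field; rewrite ?gt_eqF.
set A1 := 8 * _ * _ / _ * _; set A2 := q `^ a * \sum_j _; set A3 := \sum_j Z j.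
set A4 := t ^+ 2 * q `^ a * dot u g; set A5 := t ^+ 2 * q `^ a * dot u (mv C u).
set A6 := kap `^ (1 - p) * t ^+ 2 * nrm g `^ p.
set A7 := q `^ (p / 2); set A8 := q `^ a.
have -> : p * (gam / 2 * t ^+ 2 * A2 - A1) = p * gam / 2 * t ^+ 2 * A2 - p * A1 by ring.
have -> : p * (kap * t ^+ 2 * (A7 - eps * A8)) =
  (p - 1) * kap * t ^+ 2 * A7 + kap * t ^+ 2 * A7 - p * kap * t ^+ 2 * (eps * A8) by ring.
have -> : p * (A5 - A4 + A3) = p * A5 - p * A4 + p * A3 by ring.
move: (p * gam / 2 * t ^+ 2 * A2) (p * kap * t ^+ 2 * (eps * A8)) => x1 x2.
move: ((p - 1) * kap * t ^+ 2 * A7) (kap * t ^+ 2 * A7) => x3 x4.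
move: (p * A1) (p * A3) (p * A4) (p * A5) A6 => x5 x6 x7 x8 x9.
exact: energy_arith.
Qed.

End pointwise_energy.

(** * The quadratic cut-off and skew-symmetry *)

Section cutoff.
Context {R : realType} {d : nat}.
Notation E := 'cV[R]_d.
Notation mu := (@leb R d).
Notation e_ i := (delta_mx i 0 : E).

Definition ppart (t : R) := Num.max 0 t.

Lemma ppart_ge0 t : 0 <= ppart t. Proof. by rewrite /ppart le_max lexx. Qed.

Lemma continuous_ppart : continuous ppart.
Proof. by move=> t; apply: continuous_max; [exact: cvg_cst|exact: cvg_id]. Qed.

(** Squaring removes the kink of the positive part at 0. *)
Lemma is_derive_ppart2 (t : R) : is_derive t 1 (fun s => ppart s ^+ 2) (2 * ppart t).
Proof.
have [t0|t0|->] := ltgtP t 0; last first.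
- rewrite /ppart maxxx mulr0; apply: (@is_derive_quadratic _ _ 1); first by rewrite maxxx expr0n.
  move=> s _; rewrite mul1r ger0_norm ?sqr_ge0//.
  by rewrite /Num.max; case: ifP => // _; rewrite expr0n sqr_ge0.
- apply: (@near_eq_is_derive R R R (fun s : R => s * s) (fun s : R => ppart s ^+ 2)).
    near=> s; rewrite /ppart max_r ?expr2//; apply: ltW; near: s; exact: lt_nbhsr.
  rewrite /ppart max_r ?ltW//.
  by apply: derive_eq (deriveMul (is_derive_id _ _) (is_derive_id _ _)) _; ring.
- apply: (@near_eq_is_derive R R R (fun _ : R => 0) (fun s : R => ppart s ^+ 2)).
    near=> s; rewrite /ppart max_l ?expr0n//; apply: ltW; near: s; exact: lt_nbhsl.
  by rewrite /ppart max_l ?ltW// mulr0; exact: is_derive_cst.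
Unshelve. all: by end_near. Qed.

(** The energy is weighted with the square of this function. The square is continuously
    differentiable, and its gradient is controlled by the cut-off itself, as the absorption of the
    cross term demands. *)
Definition cutoff (r : R) (x : E) : R := ppart (1 - sqdist 0 x / r ^+ 2).

Lemma cutoff_ge0 r x : 0 <= cutoff r x. Proof. exact: ppart_ge0. Qed.

Lemma sqdist_ge0 (y x : E) : 0 <= sqdist y x.
Proof. by apply: sumr_ge0 => i _; exact: sqr_ge0. Qed.

Lemma cutoff_le1 r x : 0 < r -> cutoff r x <= 1.
Proof.
move=> r0; rewrite /cutoff /ppart ge_max ler01 gerBl.
by rewrite divr_ge0 ?sqdist_ge0 ?sqr_ge0.
Qed.

Lemma cutoff_supp r : 0 < r -> supported r (cutoff r).
Proof.
move=> r0 x nx; rewrite /cutoff /ppart max_l// leNgt; apply/negP => h; apply: nx.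
rewrite -[x]subr0; apply: sqdist_cube; first exact: ltW.
by move: h; rewrite subr_gt0 ltr_pdivrMr ?exprn_gt0// mul1r => /ltW.
Qed.

Lemma continuous_cutoff r : continuous (cutoff r).
Proof.
apply: (contComp continuous_ppart); apply: contSub; first exact: contCst.
by apply: contMul; [exact: continuous_sqdist|exact: contCst].
Qed.

Definition dcutoff2 (r : R) (j : 'I_d) (x : E) : R := - 4 * cutoff r x * x j 0 / r ^+ 2.

Lemma is_derive_cutoff2 r j (x : E) :
  is_derive x (e_ j) (fun y => cutoff r y ^+ 2) (dcutoff2 r j x).
Proof.
have h : is_derive x (e_ j) (fun y => 1 - sqdist 0 y / r ^+ 2) (- (2 * x j 0 / r ^+ 2)).
  have hd := deriveMul (is_derive_sqdist 0 j x) (deriveCst x (e_ j) (r ^- 2)).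
  apply: derive_eq (is_deriveB (deriveCst x (e_ j) 1) hd) _.
  by rewrite mxE; ring.
apply: derive_eq (@deriveComp _ _ x (e_ j) (fun s => ppart s ^+ 2) _ _ _ (is_derive_ppart2 _) h) _.
by rewrite /dcutoff2 /cutoff; ring.
Qed.

Lemma continuous_dcutoff2 r j : continuous (dcutoff2 r j).
Proof.
apply: contMul; last exact: contCst; apply: contMul; last exact: coord_continuous.
by apply: contMul; [exact: contCst|exact: continuous_cutoff].
Qed.

Lemma dcutoff2_bound r j x : 0 < r -> `|dcutoff2 r j x| <= 4 * cutoff r x / r.
Proof.
move=> r0; have [rx|/(cutoff_supp r0) h] := pselect (cube r x); last first.
  by rewrite /dcutoff2 h mulr0 !mul0r normr0 mulr0 mul0r.
rewrite /dcutoff2 !normrM normfV normrX normrN (ger0_norm (cutoff_ge0 _ _)) (gtr0_norm r0) normr_nat.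
rewrite ler_pdivrMr ?exprn_gt0//.
have -> : 4 * cutoff r x / r * r ^+ 2 = 4 * cutoff r x * r by field; rewrite gt_eqF.
by apply: ler_wpM2l; [rewrite mulr_ge0// cutoff_ge0|exact: rx].
Qed.

Lemma skew_diag (S : 'M[R]_d) i : S^T = - S -> S i i = 0.
Proof.
move=> /matrixP/(_ i i); rewrite !mxE => /eqP; rewrite -subr_eq0 opprK -mulr2n.
by rewrite mulrn_eq0 => /eqP.
Qed.

Lemma skew_dot (S : 'M[R]_d) (f : 'I_d -> 'I_d -> R) : S^T = - S ->
  (forall i j, f i j = f j i) -> \sum_i \sum_j S i j * f i j = 0.
Proof.
move=> hS fs; set s := \sum_i _.
suff : s = - s by move=> /eqP; rewrite -subr_eq0 opprK -mulr2n mulrn_eq0 => /eqP.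
rewrite {1}/s exchange_big/= -sumrN; apply: eq_bigr => i _; rewrite -sumrN.
apply: eq_bigr => j _; have /matrixP/(_ i j) := hS; rewrite !mxE => ->.
by rewrite mulNr fs.
Qed.

(** The gradient of the cut-off is parallel to x, and <S x, x> = 0. *)
Lemma skew_cutoff (S : 'M[R]_d) r (x : E) : S^T = - S ->
  \sum_j (S *m x) j 0 * dcutoff2 r j x = 0.
Proof.
move=> hS; rewrite -[RHS](@skew_dot S (fun i j => - 4 * cutoff r x / r ^+ 2 * (x i 0 * x j 0)) hS).
  apply: eq_bigr => i _; rewrite mxE mulr_suml; apply: eq_bigr => j _.
  by rewrite /dcutoff2; ring.
by move=> i j; rewrite (mulrC (x i 0)).
Qed.

Lemma cutoff_cvg (x : E) : cutoff n.+1%:R x @[n --> \oo] --> (1 : R).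
Proof.
apply/cvgrPdist_le => e e0; near=> n.
have n0 : (0 : R) < n.+1%:R by [].
have h : sqdist 0 x / n.+1%:R ^+ 2 <= e.
  have : n.+1%:R^-1 <= e / (sqdist 0 x + 1).
    apply: ltW; near: n.
    have q0 : 0 < e / (sqdist 0 x + 1) by rewrite divr_gt0// ltr_wpDl// sqdist_ge0.
    exact: near_infty_natSinv_lt (PosNum q0).
  rewrite ler_pdivlMr ?ltr_wpDl ?sqdist_ge0// => h; apply: le_trans h.
  rewrite expr2 invfM mulrA mulrC ler_wpM2l// ?invr_ge0//.
  rewrite (@le_trans _ _ (sqdist 0 x))// ?lerDl//.
  by rewrite ler_piMr ?sqdist_ge0// invf_le1// ler1n.
have h1 := cutoff_le1 x n0.
rewrite ger0_norm ?subr_ge0//.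
rewrite lerBlDr -lerBlDl; apply: le_trans (_ : 1 - sqdist 0 x / n.+1%:R ^+ 2 <= _).
  by rewrite lerD2l lerN2.
by rewrite /cutoff /ppart le_max lexx orbT.
Unshelve. all: by end_near. Qed.

(** Fatou's lemma: the cut-offs tend to 1 pointwise and the error b/(n+1) disappears. *)
Lemma cutoff_limit (f : E -> R) (a b : R) : measurable_fun setT f -> (forall x, 0 <= f x) ->
  (forall n, (\int[mu]_x (cutoff n.+1%:R x ^+ 2 * f x)%:E <= (a + b / n.+1%:R)%:E)%E) ->
  (\int[mu]_x (f x)%:E <= a%:E)%E.
Proof.
move=> mf f0 H.
pose h (n : nat) (x : E) := (cutoff n.+1%:R x ^+ 2 * f x)%:E.
have mh n : measurable_fun setT (h n).
  apply/measurable_EFinP; apply: measurable_funM => //; apply: measurable_funX.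
  by apply: continuous_measurable_cV; exact: continuous_cutoff.
have h0 n x : (0 <= h n x)%E by rewrite lee_fin mulr_ge0// sqr_ge0.
have hcvg x : h n x @[n --> \oo] --> (f x)%:E.
  apply: cvg_EFin; first exact: nearW.
  rewrite -[X in _ --> X]mul1r; apply: cvgM; last exact: cvg_cst.
  rewrite -[X in _ --> X](expr1n _ 2) expr2.
  by apply: cvgM; exact: cutoff_cvg.
rewrite (eq_integral (fun x => limn_einf (h ^~ x))); last first.
  by move=> x _; rewrite (cvg_limn_einf_sup (hcvg x)).1.
apply: le_trans (fatou _ measurableT mh (fun n x _ => h0 n x)) _.
have ca : (a + b / n.+1%:R)%:E @[n --> \oo] --> a%:E.
  apply: cvg_EFin; first exact: nearW.
  rewrite -[X in _ --> X]addr0; apply: cvgD; first exact: cvg_cst.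
  rewrite -[X in _ --> X](mulr0 b); apply: cvgM; first exact: cvg_cst.
  exact: cvg_harmonic.
rewrite -(cvg_lim _ ca)// limn_einf_lim.
apply: lee_lim; [exact: is_cvg_einfs|by apply/cvg_ex; exists a%:E|].
apply: nearW => n; apply: le_trans (H n).
by apply: ereal_inf_lbound; exists n => /=.
Qed.

End cutoff.

Lemma powR_le0_homo (R : realType) (a x y : R) : a <= 0 -> 0 < x -> x <= y -> y `^ a <= x `^ a.
Proof.
move=> a0 x0 xy; rewrite -[a]opprK !(powRN _ (- a)) lef_pV2 ?posrE ?powR_gt0//; last exact: lt_le_trans xy.
by apply: ge0_ler_powR; rewrite ?nnegrE ?oppr_ge0// ltW//; exact: lt_le_trans xy.
Qed.

(** The sum is at most twice the larger term. *)
Lemma powRD_bound (R : realType) (b x y : R) : 0 <= b -> 0 <= x -> 0 <= y ->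
  (x + y) `^ b <= 2 `^ b * (x `^ b + y `^ b).
Proof.
move=> b0 x0 y0.
have aux s t : 0 <= s -> s <= t -> (s + t) `^ b <= 2 `^ b * t `^ b.
  move=> s0 st; rewrite -powRM//; last exact: le_trans st.
  apply: ge0_ler_powR; rewrite ?nnegrE ?addr_ge0 ?mulr_ge0//; [exact: le_trans st|exact: le_trans st|].
  by rewrite mulr_natl mulr2n lerD.
have [xy|/ltW yx] := leP x y.
  by apply: le_trans (aux _ _ x0 xy) _; rewrite ler_wpM2l ?powR_ge0// lerDr powR_ge0.
by rewrite addrC; apply: le_trans (aux _ _ y0 yx) _; rewrite ler_wpM2l ?powR_ge0// lerDl powR_ge0.
Qed.

Lemma integrable_contsupp (R : realType) (d : nat) (k : 'cV[R]_d -> R) (r : R) :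
  continuous k -> supported r k -> (@leb R d).-integrable setT (EFin \o k).
Proof.
move=> ck sk; have [C C0 HC] := continuous_bounded_supp ck sk.
have mk := continuous_measurable_cV ck.
apply: (integrable_supp mk sk).
apply: measurable_bounded_integrable => //.
- exact: measurable_cube.
- exact: cube_fin.
- exact: measurable_funTS.
- by exists C; split; [rewrite num_real|move=> b /ltW Cb x _; apply: le_trans (HC _) Cb].
Qed.

(* AM-GM with weights p/2 and 1 - p/2. *)
Lemma gradient_young (R : realType) (p gam kap q N : R) : 0 < p -> p <= 2 -> 0 < gam ->
  0 < kap -> 0 < q -> 0 <= N ->
  N `^ p <= (gam / kap) `^ (- (p / 2)) * kap^-1 *
    (kap * q `^ (p / 2) + p * gam / 2 * (q `^ ((p - 2) / 2) * N ^+ 2)).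
Proof.
move=> p0 p2 gam0 kap0 q0 N0.
have p20 : 0 < p / 2 by rewrite divr_gt0.
have gk0 : 0 < gam / kap by rewrite divr_gt0.
have kn0 : kap != 0 by rewrite gt_eqF.
have qn0 : q != 0 by rewrite gt_eqF.
have X0 : 0 <= gam / kap * (q `^ ((p - 2) / 2) * N ^+ 2).
  by apply: mulr_ge0; [exact: ltW|rewrite mulr_ge0 ?powR_ge0 ?sqr_ge0].
rewrite powRN -mulrA ler_pdivlMl ?powR_gt0// mulrDr mulKf//.
have -> : kap^-1 * (p * gam / 2 * (q `^ ((p - 2) / 2) * N ^+ 2)) =
  p / 2 * (gam / kap * (q `^ ((p - 2) / 2) * N ^+ 2)) by ring.
move: (gam / kap) gk0 X0 => c c0 X0.
(* The case p = 2 is separate because the Young exponent 2/p must exceed 1. *)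
move: p2; rewrite le_eqVlt => /predU1P[->|p2].
  rewrite subrr mul0r powRr0 mul1r divff// mul1r !powRr1 ?(ltW q0) ?(ltW c0)// powR_mulrn//.
  by rewrite lerDr ltW.
have P1 : 1 < 2 / p by rewrite ltr_pdivlMr// mul1r.
(* The two arguments are chosen so that the powers of q cancel in their product and only N^p
   remains. *)
have := powR_young P1 (powR_ge0 (q `^ (p / 2)) (p / 2))
  (powR_ge0 (c * (q `^ ((p - 2) / 2) * N ^+ 2)) (p / 2)).
rewrite -!powRrM (_ : p / 2 * (2 / p) = 1); last by field; rewrite gt_eqF.
rewrite mulr1.
rewrite powRr1// (powRM _ (ltW c0)) ?mulr_ge0 ?powR_ge0 ?sqr_ge0// powRM ?powR_ge0 ?sqr_ge0//.
rewrite -powR_mulrn// -!powRrM (_ : 2%:R * (p / 2) = p); last by field.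
set Z := c * _.
rewrite (_ : 2 / p * _ * _ = 2 / p * (c `^ (p / 2) * N `^ p) *
  (q `^ (p / 2 * (p / 2 * (2 / p - 1))) * q `^ ((p - 2) / 2 * (p / 2)))); last by ring.
rewrite -powRD ?qn0 ?implybT// (_ : p / 2 * (p / 2 * (2 / p - 1)) + _ = 0); last first.
  by field; rewrite gt_eqF.
rewrite powRr0 mulr1 => /(ler_wpM2l (ltW p20)).
rewrite mulrA (_ : p / 2 * (2 / p) = 1) ?mul1r; last by field; rewrite gt_eqF.
move=> /le_trans; apply; rewrite mulrDr lerD2r mulrA.
rewrite -[leRHS]mul1r; apply: ler_wpM2r; first exact: powR_ge0.
rewrite (_ : p / 2 * (2 / p - 1) = 1 - p / 2); last by field; rewrite gt_eqF.
by rewrite lerBlDr lerDl ltW.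
Qed.

(** * Integrated estimates for classical solutions *)

Section smooth_energy.
Context {R : realType} {I : finType} {d : nat}.
Notation E := 'cV[R]_d.
Notation mu := (@leb R d).
Notation e_ i := (delta_mx i 0 : E).
Variables (p gam kap : R) (M C : I -> I -> R) (S : 'M[R]_d).
Hypotheses (p1 : 1 < p) (gam0 : 0 < gam) (kap0 : 0 < kap) (hS : S^T = - S).
Hypothesis hM : forall z w : I -> R,
  gam * nrm z ^+ 2 * nrm w ^+ 2 <=
  nrm z ^+ 2 * dot w (mv M w) + (p - 2) * dot w z * dot z (mv M w).
Hypothesis hM2 : forall w : I -> R, gam * nrm w ^+ 2 <= dot w (mv M w).
Hypothesis hC : forall w : I -> R, kap * nrm w ^+ 2 <= dot w (mv C w).
Variables (U G : I -> E -> R) (DU DDU : I -> 'I_d -> E -> R).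
Hypotheses (cU : forall m, continuous (U m)) (cDU : forall m j, continuous (DU m j))
  (cDDU : forall m j, continuous (DDU m j)).
Hypothesis dU : forall m j x, is_derive x (e_ j) (U m) (DU m j x).
Hypothesis dDU : forall m j x, is_derive x (e_ j) (DU m j) (DDU m j x).
Hypothesis hG : forall m x, G m x = mv C (U^~ x) m -
  mv M (fun n => \sum_j DDU n j x) m - \sum_j (S *m x) j 0 * DU m j x.

Let u (x : E) : I -> R := U^~ x.
Let du (j : 'I_d) (x : E) : I -> R := fun m => DU m j x.
Let ddu (j : 'I_d) (x : E) : I -> R := fun m => DDU m j x.
Let q (eps : R) (x : E) : R := nrm (u x) ^+ 2 + eps.
Let a : R := (p - 2) / 2.

Let p0 : 0 < p. Proof. exact: lt_trans ltr01 p1. Qed.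

Let qE eps : q eps = fun x => \sum_m U m x * U m x + eps.
Proof.
by apply/funext => x; rewrite /q nrmE; congr (_ + _); apply: eq_bigr => m _; rewrite expr2.
Qed.

Let q_gt0 eps x : 0 < eps -> 0 < q eps x.
Proof. by move=> e0; rewrite /q ltr_wpDl// sqr_ge0. Qed.

Let cq eps : continuous (q eps).
Proof.
rewrite qE; apply: contAdd; last exact: contCst.
by apply: continuous_sumE => m; apply: contMul.
Qed.

Let dq eps j x : is_derive x (e_ j) (q eps) (2 * dot (u x) (du j x)).
Proof.
rewrite qE; apply: derive_eq (deriveAdd (deriveSum (index_enum _) predT
  (fun m => deriveMul (dU m j x) (dU m j x))) (deriveCst x (e_ j) eps)) _.
rewrite addr0 /dot mulr_sumr; apply: eq_bigr => m _.
by rewrite /u /du; ring.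
Qed.

Let cqpow eps b : 0 < eps -> continuous (fun x => q eps x `^ b).
Proof.
move=> e0 x; apply: (@continuous_comp _ _ _ (q eps) (fun s => s `^ b)); first exact: cq.
have [H _] := is_derive1_powR b (q_gt0 x e0).
exact/differentiable_continuous/derivable1_diffP.
Qed.

Let dqpow eps b j x : 0 < eps -> is_derive x (e_ j) (fun y => q eps y `^ b)
  (b * q eps x `^ (b - 1) * (2 * dot (u x) (du j x))).
Proof.
by move=> e0; exact: (@deriveComp _ _ x (e_ j) (fun s => s `^ b) (q eps) _ _
  (is_derive1_powR b (q_gt0 x e0)) (dq eps j x)).
Qed.

Let cdot (f g : E -> I -> R) : (forall m, continuous (fun x => f x m)) ->
  (forall m, continuous (fun x => g x m)) -> continuous (fun x => dot (f x) (g x)).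
Proof. by move=> cf cg; apply: continuous_sumE => m; exact: contMul. Qed.

Let cmv (L : I -> I -> R) (f : E -> I -> R) m : (forall m, continuous (fun x => f x m)) ->
  continuous (fun x => mv L (f x) m).
Proof. by move=> cf; apply: continuous_sumE => n; apply: contMul => //; exact: contCst. Qed.

Let cuMdu j : continuous (fun x => dot (u x) (mv M (du j x))).
Proof. by apply: cdot => // m; apply: cmv => n; exact: cDU. Qed.

Let duMdu j x : is_derive x (e_ j) (fun y => dot (u y) (mv M (du j y)))
  (dot (du j x) (mv M (du j x)) + dot (u x) (mv M (ddu j x))).
Proof.
have h m : is_derive x (e_ j) (fun y => mv M (du j y) m) (mv M (ddu j x) m).
  apply: derive_eq (deriveSum (index_enum _) predT
    (fun n => deriveMul (deriveCst x (e_ j) (M m n)) (dDU n j x))) _.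
  by apply: eq_bigr => n _; rewrite mul0r add0r.
apply: derive_eq (deriveSum (index_enum _) predT (fun m => deriveMul (dU m j x) (h m))) _.
by rewrite big_split.
Qed.

Let chi r (x : E) := cutoff r x ^+ 2.

Let cchi r : continuous (chi r).
Proof.
rewrite (_ : chi r = fun x => cutoff r x * cutoff r x); last by apply/funext => x; rewrite /chi expr2.
by apply: contMul; exact: continuous_cutoff.
Qed.

(* The fluxes of the diffusion and of the drift. *)
Let fluxF r eps j (x : E) := chi r x * (q eps x `^ a * dot (u x) (mv M (du j x))).

Let dfluxF r eps j (x : E) := dcutoff2 r j x * (q eps x `^ a * dot (u x) (mv M (du j x))) +
  chi r x * ((p - 2) * q eps x `^ (a - 1) * dot (u x) (du j x) * dot (u x) (mv M (du j x)) +
     q eps x `^ a * (dot (du j x) (mv M (du j x)) + dot (u x) (mv M (ddu j x)))).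

Let fluxH r eps j (x : E) := (S *m x) j 0 * (chi r x * q eps x `^ (p / 2)).

Let dfluxH r eps j (x : E) := (S *m x) j 0 * (dcutoff2 r j x * q eps x `^ (p / 2) +
  chi r x * (p * q eps x `^ a * dot (u x) (du j x))).

Let chi_supp (r : R) (x : E) : 0 < r -> ~ cube r x -> cutoff r x = 0 /\ forall j, dcutoff2 r j x = 0.
Proof.
by move=> r0 /(cutoff_supp r0) h; split=> // j; rewrite /dcutoff2 h mulr0 !mul0r.
Qed.

Let int_dfluxF r eps j : 0 < r -> 0 < eps ->
  mu.-integrable setT (EFin \o dfluxF r eps j) /\ \int[mu]_x dfluxF r eps j x = 0.
Proof.
move=> r0 e0.
have cF : continuous (fluxF r eps j).
  by apply: contMul => //; apply: contMul => //; exact: cqpow.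
have cdF : continuous (dfluxF r eps j).
  apply: contAdd.
    by apply: contMul; [exact: continuous_dcutoff2|apply: contMul => //; exact: cqpow].
  apply: contMul => //; apply: contAdd.
    apply: contMul => //; apply: contMul; last by apply: cdot => // m; exact: cDU.
    by apply: contMul; [exact: contCst|exact: cqpow].
  apply: contMul; first exact: cqpow.
  apply: contAdd.
    by apply: cdot => m; [exact: cDU|apply: cmv => n; exact: cDU].
  by apply: cdot => m; [exact: cU|apply: cmv => n; exact: cDDU].
have sF : supported r (fluxF r eps j).
  by move=> x /(chi_supp r0)[h _]; rewrite /fluxF /chi h expr0n mul0r.
have sdF : supported r (dfluxF r eps j).
  by move=> x /(chi_supp r0)[h h']; rewrite /dfluxF /chi h h' expr0n !mul0r addr0.
split; first exact: integrable_contsupp cdF sdF.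
apply: (Rintegral_derive0 (e := e_ j) cF cdF sF sdF) => x.
apply: derive_eq (deriveMul (is_derive_cutoff2 r j x) (deriveMul (dqpow a j x e0) (duMdu j x))) _.
have aE : p - 2 = a * 2 by rewrite /a divfK.
by rewrite /dfluxF /chi aE; ring.
Qed.

Let int_dfluxH r eps j : 0 < r -> 0 < eps ->
  mu.-integrable setT (EFin \o dfluxH r eps j) /\ \int[mu]_x dfluxH r eps j x = 0.
Proof.
move=> r0 e0.
have cS i : continuous (fun x : E => (S *m x) i 0).
  rewrite (_ : (fun _ => _) = fun x : E => \sum_k S i k * x k 0); last by apply/funext => x; rewrite mxE.
  by apply: continuous_sumE => k; apply: contMul; [exact: contCst|exact: coord_continuous].
(* The field S x has no j-th derivative in its j-th component because the diagonal of S vanishes. *)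
have dSj x : is_derive x (e_ j) (fun y : E => (S *m y) j 0) 0.
  rewrite (_ : (fun _ => _) = fun x : E => \sum_k S j k * x k 0); last by apply/funext => y; rewrite mxE.
  apply: derive_eq (deriveSum (index_enum _) predT (fun k =>
    deriveMul (deriveCst x (e_ j) (S j k)) (is_derive_coord j k x))) _.
  rewrite (bigD1 j)//= big1 => [|k kj]; first by rewrite eqxx (skew_diag j hS) !mul0r !addr0.
  by rewrite eq_sym (negbTE kj) mulr0 mul0r addr0.
have cH : continuous (fluxH r eps j).
  by apply: contMul => //; apply: contMul => //; exact: cqpow.
have cdH : continuous (dfluxH r eps j).
  apply: contMul => //; apply: contAdd.
    by apply: contMul; [exact: continuous_dcutoff2|exact: cqpow].
  apply: contMul => //; apply: contMul; last by apply: cdot => // m; exact: cDU.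
  by apply: contMul; [exact: contCst|exact: cqpow].
have sH : supported r (fluxH r eps j).
  by move=> x /(chi_supp r0)[h _]; rewrite /fluxH /chi h expr0n mul0r mulr0.
have sdH : supported r (dfluxH r eps j).
  by move=> x /(chi_supp r0)[h h']; rewrite /dfluxH /chi h h' expr0n !mul0r addr0 mulr0.
split; first exact: integrable_contsupp cdH sdH.
apply: (Rintegral_derive0 (e := e_ j) cH cdH sH sdH) => x.
apply: derive_eq (deriveMul (dSj x) (deriveMul (is_derive_cutoff2 r j x) (dqpow (p / 2) j x e0))) _.
rewrite mul0r add0r /dfluxH /chi (_ : p / 2 - 1 = a); last by rewrite /a; field.
by field.
Qed.

(** The factor 1/p compensates D_j q^(p/2) = p q^a <u, D_j u>, so that the drift enters exactly as
    in the tested equation. *)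
Let energyT r eps (x : E) :=
  \sum_j dfluxF r eps j x + p^-1 * \sum_j dfluxH r eps j x.

Let int_energyT r eps : 0 < r -> 0 < eps ->
  mu.-integrable setT (EFin \o energyT r eps) /\ \int[mu]_x energyT r eps x = 0.
Proof.
move=> r0 e0.
have iF : mu.-integrable setT (EFin \o (fun x => \sum_j dfluxF r eps j x)).
  by apply: integrable_sumE => j; case: (int_dfluxF j r0 e0).
have iH : mu.-integrable setT (EFin \o (fun x => \sum_j dfluxH r eps j x)).
  by apply: integrable_sumE => j; case: (int_dfluxH j r0 e0).
have iH' := integrableZl measurableT p^-1 iH.
split; first exact: (integrableD measurableT iF iH').
rewrite RintegralD// RintegralZl// !Rintegral_sum => [|j|j].
- rewrite big1 => [|j _]; last by case: (int_dfluxF j r0 e0).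
  by rewrite big1 ?mulr0 ?addr0// => j _; case: (int_dfluxH j r0 e0).
- by case: (int_dfluxH j r0 e0).
- by case: (int_dfluxF j r0 e0).
Qed.

(** The part of the drift flux that differentiates the cut-off drops out by [skew_cutoff]; what
    remains is the expression [T] of [pointwise_energy]. *)
Let energyTE r eps x : energyT r eps x =
  \sum_j (dcutoff2 r j x * (q eps x `^ a * dot (u x) (mv M (du j x))) +
      cutoff r x ^+ 2 * ((p - 2) * q eps x `^ (a - 1) * dot (u x) (du j x) * dot (u x) (mv M (du j x)) +
               q eps x `^ a * (dot (du j x) (mv M (du j x)) + dot (u x) (mv M (ddu j x)))))
    + cutoff r x ^+ 2 * q eps x `^ a * \sum_j (S *m x) j 0 * dot (u x) (du j x).
Proof.
congr (_ + _).
have -> : \sum_j dfluxH r eps j x = q eps x `^ (p / 2) * (\sum_j (S *m x) j 0 * dcutoff2 r j x)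
    + p * (cutoff r x ^+ 2 * q eps x `^ a * \sum_j (S *m x) j 0 * dot (u x) (du j x)).
  rewrite !mulr_sumr -big_split/=; apply: eq_bigr => j _.
  by rewrite /dfluxH /chi; ring.
by rewrite (skew_cutoff _ _ hS) mulr0 add0r mulKf// gt_eqF.
Qed.

Let energyJ r eps (x : E) : R := kap * chi r x * q eps x `^ (p / 2) +
  p * gam / 2 * chi r x * (q eps x `^ a * \sum_j nrm (du j x) ^+ 2).

Let energyJ_ge0 r eps x : 0 <= energyJ r eps x.
Proof.
apply: addr_ge0; apply: mulr_ge0.
- by apply: mulr_ge0; [exact: ltW|exact: sqr_ge0].
- exact: powR_ge0.
- apply: mulr_ge0; last exact: sqr_ge0.
  by rewrite divr_ge0// mulr_ge0// ltW.
- by rewrite mulr_ge0 ?powR_ge0// sumr_ge0// => j _; exact: sqr_ge0.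
Qed.

(** For p <= 2 the exponent a is nonpositive, so eps q^a <= eps^(1 + a) = eps^(p/2) everywhere. For
    p > 2 the weight q^a may grow, and only its bound on the given cube helps; hence the dependence
    on [r]. *)
Let choose_eps (r dl : R) : 0 < dl -> exists2 eps, 0 < eps &
  eps `^ (p / 2) <= dl /\ forall x, cube r x -> eps * q eps x `^ a <= dl.
Proof.
move=> dl0.
have p20 : 0 < p / 2 by rewrite divr_gt0.
pose e1 := dl `^ (p / 2)^-1.
have e10 : 0 < e1 by exact: powR_gt0.
have e1E : e1 `^ (p / 2) = dl by rewrite -powRrM mulVf ?gt_eqF// powRr1// ltW.
have le_e1 e : 0 < e -> e <= e1 -> e `^ (p / 2) <= dl.
  by move=> e0 ee; rewrite -e1E; apply: ge0_ler_powR; rewrite ?nnegrE// ltW.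
have [p2|p2] := leP p 2.
  exists e1 => //; split=> [|x _]; first exact: le_e1.
  have a0 : a <= 0 by rewrite /a pmulr_lle0// subr_le0.
  have := powR_le0_homo a0 e10 (_ : e1 <= q e1 x).
  rewrite /q lerDr sqr_ge0 => /(_ isT)/(ler_wpM2l (ltW e10)) /le_trans; apply.
  rewrite -{1}(powRr1 (ltW e10)) -powRD ?(gt_eqF e10) ?implybT//.
  by rewrite (_ : 1 + a = p / 2) ?e1E// /a; field.
have a0 : 0 <= a by rewrite /a divr_ge0// subr_ge0 ltW.
(* The bound is taken for eps = 1; it holds for the final eps <= 1 because q increases with eps. *)
have [B B0 HB] := continuous_bounded_cube r (@cq 1).
exists (Num.min 1 (Num.min e1 (dl / (B `^ a + 1)))).
  by rewrite !lt_min ltr01 e10 divr_gt0// ltr_wpDl ?powR_ge0.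
set e := Num.min _ _.
have e0 : 0 < e by rewrite !lt_min ltr01 e10 divr_gt0// ltr_wpDl ?powR_ge0.
have ee1 : e <= 1 by rewrite /e ge_min lexx.
have ee2 : e <= e1 by rewrite /e ge_min [X in _ || X]ge_min lexx orbT.
have ee3 : e <= dl / (B `^ a + 1) by rewrite /e ge_min [X in _ || X]ge_min lexx !orbT.
split=> [|x rx]; first exact: le_e1.
apply: (@le_trans _ _ (dl / (B `^ a + 1) * (B `^ a + 1))); last first.
  by rewrite divfK// gt_eqF// ltr_wpDl ?powR_ge0.
apply: ler_pM => //; [exact: ltW|exact: powR_ge0|].
apply: (@le_trans _ _ (B `^ a)); last by rewrite lerDl.
apply: ge0_ler_powR; rewrite ?nnegrE//; first exact/ltW/q_gt0.
apply: le_trans (HB x rx); rewrite ger0_norm; last exact/ltW/q_gt0.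
by rewrite /q lerD2l.
Qed.

Let NU (x : E) := nrm (u x) `^ p.
Let NG (x : E) := nrm (fun m => G m x) `^ p.
Hypotheses (iU : mu.-integrable setT (EFin \o NU)) (iG : mu.-integrable setT (EFin \o NG)).

Let NU_ge0 x : 0 <= NU x. Proof. exact: powR_ge0. Qed.
Let NG_ge0 x : 0 <= NG x. Proof. exact: powR_ge0. Qed.

(** The errors of [pointwise_energy] are rewritten as a small constant on the cube plus a multiple
    of |u|^p / r, both integrable. The condition 1 <= r weakens 1/r^2 to 1/r. *)
Let energyJ_bound (K r eps dl : R) x : 0 <= K ->
  (forall v w : I -> R, `|dot v (mv M w)| <= K * (nrm v * nrm w)) ->
  1 <= r -> 0 < eps -> eps `^ (p / 2) <= dl ->
  (forall x, cube r x -> eps * q eps x `^ a <= dl) ->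
  energyJ r eps x <= p * energyT r eps x + kap `^ (1 - p) * NG x +
    (p * kap * dl + 8 * p * d%:R * K ^+ 2 / gam / r * (2 `^ (p / 2) * dl)) * \1_(cube r) x +
    8 * p * d%:R * K ^+ 2 / gam / r * 2 `^ (p / 2) * NU x.
Proof.
move=> K0 hK r1 e0 edl qdl.
have r0 : 0 < r := lt_le_trans ltr01 r1.
have dl0 : 0 <= dl := le_trans (powR_ge0 _ _) edl.
set c := 8 * p * d%:R * K ^+ 2 / gam.
have c0 : 0 <= c by rewrite /c divr_ge0 ?(ltW gam0)// !mulr_ge0// ?(ltW p0)// sqr_ge0.
have cr0 : 0 <= c / r by rewrite divr_ge0// ltW.
have kp0 : 0 <= kap `^ (1 - p) := powR_ge0 _ _.
(* Outside the cube the cut-off and its gradient vanish, so both [energyJ] and [energyT] are 0. *)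
have [rx|nx] := pselect (cube r x); last first.
  have [h h'] := chi_supp r0 nx.
  have -> : energyJ r eps x = 0 by rewrite /energyJ /chi h expr0n !mulr0 !mul0r addr0.
  have -> : energyT r eps x = 0.
    rewrite energyTE h expr0n !mul0r addr0 big1// => j _.
    by rewrite h' !mul0r addr0.
  rewrite indicE memNset// !mulr0 add0r addr0; apply: addr_ge0; apply: mulr_ge0 => //.
  by apply: mulr_ge0 => //; exact: powR_ge0.
have := @pointwise_energy R I d p gam kap K M C p1 gam0 kap0 hK hM hM2 hC
  (u x) (fun m => G m x) (du^~ x) (ddu^~ x) (fun j => (S *m x) j 0) (fun j => dcutoff2 r j x)
  (cutoff r x) r eps (cutoff_ge0 r x) r0 e0 (fun j => dcutoff2_bound j x r0) (hG^~ x).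
rewrite -/(q eps x) -/a /= -energyTE -/(chi r x) -/(energyJ r eps x) => /le_trans; apply.
rewrite -!addrA lerD2l; apply: lerD.
  rewrite -[leLHS]mulrA; apply: ler_wpM2l => //.
  rewrite -[leRHS]mul1r; apply: ler_wpM2r; first exact: powR_ge0.
  by rewrite /chi expr_le1// ?cutoff_ge0 ?cutoff_le1.
rewrite indicE mem_set// mulr1 -!addrA.
have pk0 : 0 <= p * kap by rewrite mulr_ge0// ltW.
apply: lerD.
  rewrite -mulrA; apply: ler_wpM2l => //.
  rewrite -[leRHS]mul1r; apply: ler_pM => //.
  - exact: sqr_ge0.
  - by rewrite mulr_ge0 ?powR_ge0// ltW.
  - by rewrite expr_le1// ?cutoff_ge0 ?cutoff_le1.
  - exact: qdl.
have h1 : q eps x `^ (p / 2) <= 2 `^ (p / 2) * (NU x + dl).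
  apply: le_trans (powRD_bound _ (sqr_ge0 _) (ltW e0)) _; first by rewrite divr_ge0// ltW.
  apply: ler_wpM2l; first exact: powR_ge0.
  apply: lerD => //.
  rewrite /NU -powR_mulrn ?nrm_ge0// -powRrM.
  by rewrite (_ : 2%:R * (p / 2) = p)//; field.
apply: le_trans (ler_wpM2l _ h1) _.
  by rewrite divr_ge0// ?mulr_ge0// ?(ltW p0) ?sqr_ge0// ltW// exprn_gt0.
rewrite (_ : c / r * (2 `^ (p / 2) * dl) + c / r * 2 `^ (p / 2) * NU x =
  c / r * (2 `^ (p / 2) * (NU x + dl))); last by ring.
apply: ler_wpM2r; first by rewrite mulr_ge0 ?powR_ge0// addr_ge0.
rewrite /c -[leRHS]mulrA; apply: ler_wpM2l.
  by rewrite !mulr_ge0// ?(ltW p0)// sqr_ge0.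
rewrite -invfM lef_pV2 ?posrE ?mulr_gt0 ?exprn_gt0//.
apply: ler_wpM2l; first exact: ltW.
by rewrite expr2 ler_peMl// ltW.
Qed.

(** The constant D is found before the radius and eps after it: D collects all the errors, which
    integrate to at most D/r. *)
Let energy_cut : exists D, forall r, 1 <= r -> exists2 eps, 0 < eps &
  (\int[mu]_x (energyJ r eps x)%:E <= (kap `^ (1 - p) * \int[mu]_x NG x + D / r)%:E)%E.
Proof.
have [K K0 hK] := mv_bound M.
set c := 8 * p * d%:R * K ^+ 2 / gam.
have c0 : 0 <= c by rewrite /c divr_ge0 ?(ltW gam0)// !mulr_ge0// ?(ltW p0)// sqr_ge0.
have AU0 : 0 <= \int[mu]_x NU x by exact: Rintegral_ge0.
exists (p * kap + c * 2 `^ (p / 2) + c * 2 `^ (p / 2) * \int[mu]_x NU x) => r r1.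
have r0 : 0 < r := lt_le_trans ltr01 r1.
have mc := @measurable_cube R d r.
have muc0 : 0 <= fine (mu (cube r)) by rewrite fine_ge0.
(* Chosen so that [dl] times the measure of the cube is at most 1/r. *)
pose dl := (r * (1 + fine (mu (cube r))))^-1.
have dl0 : 0 < dl by rewrite invr_gt0 mulr_gt0// ltr_wpDr.
have [eps e0 [h1 h2]] := choose_eps r dl0.
exists eps => //.
have [iT T0] := int_energyT r0 e0.
set e := p * kap * dl + c / r * (2 `^ (p / 2) * dl).
pose rhs x := p * energyT r eps x + kap `^ (1 - p) * NG x + e * \1_(cube r) x +
  c / r * 2 `^ (p / 2) * NU x.
have le_rhs x : energyJ r eps x <= rhs x by exact: energyJ_bound.
have i1 : mu.-integrable setT (EFin \o (fun x => p * energyT r eps x)) by exact: (integrableZl measurableT p iT).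
have i2 : mu.-integrable setT (EFin \o (fun x => kap `^ (1 - p) * NG x)) by exact: (integrableZl measurableT _ iG).
have i3' : mu.-integrable setT (EFin \o (\1_(cube r) : E -> R)).
  apply/integrableP; split; first exact/measurable_EFinP/measurable_indic.
  rewrite (eq_integral (fun x => (\1_(cube r) x)%:E)); last by move=> x _; rewrite /= ger0_norm.
  by rewrite integral_indic// setIT; exact: cube_fin.
have i3 : mu.-integrable setT (EFin \o (fun x => e * \1_(cube r) x)) by exact: (integrableZl measurableT e i3').
have i4 : mu.-integrable setT (EFin \o (fun x => c / r * 2 `^ (p / 2) * NU x)) by exact: (integrableZl measurableT _ iU).
have i12 := integrableD measurableT i1 i2.
have i123 := integrableD measurableT i12 i3.
have irhs : mu.-integrable setT (EFin \o rhs) := integrableD measurableT i123 i4.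
have mJ : measurable_fun setT (energyJ r eps).
  apply: measurable_funD.
    apply: measurable_funM; last by apply: continuous_measurable_cV; exact: cqpow.
    by apply: measurable_funM => //; exact: continuous_measurable_cV.
  apply: measurable_funM.
    by apply: measurable_funM => //; exact: continuous_measurable_cV.
  apply: measurable_funM; first by apply: continuous_measurable_cV; exact: cqpow.
  apply: measurable_sum => j; apply: measurable_funX; apply: measurable_nrm => m.
  by apply: continuous_measurable_cV; exact: cDU.
apply: (@le_trans _ _ (\int[mu]_x (rhs x)%:E)%E).
  apply: ge0_le_integral => //.
  - by move=> x _; rewrite lee_fin.
  - exact/measurable_EFinP.
  - exact: measurable_int irhs.
  - by move=> x _; rewrite lee_fin.
rewrite -[leLHS]fineK; last exact: integrable_fin_num.
have -> : fine (\int[mu]_x (rhs x)%:E)%E = kap `^ (1 - p) * \int[mu]_x NG x +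
    e * \int[mu]_x \1_(cube r) x + c / r * 2 `^ (p / 2) * \int[mu]_x NU x.
  rewrite -/(Rintegral mu setT rhs) /rhs (RintegralD _ i123 i4)// (RintegralD _ i12 i3)// (RintegralD _ i1 i2)//.
  rewrite (RintegralZl _ measurableT iT) (RintegralZl _ measurableT iG) (RintegralZl _ measurableT i3').
  by rewrite (RintegralZl _ measurableT iU) T0 mulr0 add0r.
rewrite lee_fin -addrA lerD2l.
have -> : \int[mu]_x \1_(cube r) x = fine (mu (cube r)).
  by rewrite /Rintegral integral_indic// setIT.
have h3 : dl * fine (mu (cube r)) <= r^-1.
  rewrite /dl invfM -mulrA -[leRHS]mulr1; apply: ler_wpM2l; first by rewrite invr_ge0 ltW.
  by rewrite mulrC ler_pdivrMr ?ltr_wpDr// mul1r lerDr.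
have r2 : r^-1 <= 1 by rewrite invf_le1.
have h4 : e * fine (mu (cube r)) <= (p * kap + c * 2 `^ (p / 2)) / r.
  rewrite /e (_ : _ * fine _ = (p * kap + c * 2 `^ (p / 2) / r) * (dl * fine (mu (cube r)))); last by ring.
  have P0 : 0 <= p * kap by rewrite mulr_ge0// ltW.
  have C0 : 0 <= c * 2 `^ (p / 2) by rewrite mulr_ge0// powR_ge0.
  apply: ler_pM => //.
  - by rewrite addr_ge0// divr_ge0// ltW.
  - by rewrite mulr_ge0// ltW.
  - by rewrite lerD2l ler_pdivrMr// ler_peMr.
rewrite (_ : c / r * _ * _ = c * 2 `^ (p / 2) * \int[mu]_x NU x / r); last by ring.
by rewrite [leRHS]mulrDl lerD2r.
Qed.

(** Applied below to |u|^p and to |D_j u|^p: a function dominated by the energy under every cut-off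
    inherits the limiting bound. *)
Let le_cutoff_energy (f : E -> R) (c : R) : 0 <= c -> measurable_fun setT f ->
  (forall x, 0 <= f x) ->
  (forall r eps x, 0 < eps -> cutoff r x ^+ 2 * f x <= c * energyJ r eps x) ->
  (\int[mu]_x (f x)%:E <= (c * (kap `^ (1 - p) * \int[mu]_x NG x))%:E)%E.
Proof.
move=> c0 mf f0 fJ; have [D HD] := energy_cut.
apply: (@cutoff_limit _ _ f _ (c * D)) => // n.
have n1 : (1 : R) <= n.+1%:R by rewrite ler1n.
have [eps e0 H] := HD _ n1.
have mJ : measurable_fun setT (energyJ n.+1%:R eps).
  apply: measurable_funD.
    apply: measurable_funM; last by apply: continuous_measurable_cV; exact: cqpow.
    by apply: measurable_funM => //; exact: continuous_measurable_cV.
  apply: measurable_funM.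
    by apply: measurable_funM => //; exact: continuous_measurable_cV.
  apply: measurable_funM; first by apply: continuous_measurable_cV; exact: cqpow.
  apply: measurable_sum => j; apply: measurable_funX; apply: measurable_nrm => m.
  by apply: continuous_measurable_cV; exact: cDU.
apply: (@le_trans _ _ (\int[mu]_x (c%:E * (energyJ n.+1%:R eps x)%:E))%E).
  apply: ge0_le_integral => //.
  - by move=> x _; rewrite lee_fin mulr_ge0// sqr_ge0.
  - apply/measurable_EFinP; apply: measurable_funM => //.
    by apply: continuous_measurable_cV; exact: cchi.
  - by apply: emeasurable_funM => //; exact/measurable_EFinP.
  - by move=> x _; rewrite -EFinM lee_fin; exact: fJ.
rewrite ge0_integralZl//; last 2 first.
- exact/measurable_EFinP.
- by move=> x _; rewrite lee_fin.
apply: le_trans (lee_wpmul2l _ H) _; first by rewrite lee_fin.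
by rewrite -EFinM lee_fin mulrDr [c * (D / _)]mulrA.
Qed.

(** Only the zeroth-order part of the energy is kept, with q >= |u|^2; dividing by kap turns
    kap^(1-p) into kap^(-p). *)
Lemma smooth_Lp_estimate :
  (\int[mu]_x (nrm (U^~ x) `^ p)%:E <= (kap `^ (- p) * \int[mu]_x (nrm (G^~ x) `^ p))%:E)%E.
Proof.
have -> : kap `^ (- p) * \int[mu]_x (nrm (G^~ x) `^ p) = kap^-1 * (kap `^ (1 - p) * \int[mu]_x NG x).
  rewrite mulrA; congr (_ * _); rewrite -(powR_inv1 (ltW kap0)) -powRD ?(gt_eqF kap0) ?implybT//.
  by congr (_ `^ _); ring.
apply: le_cutoff_energy => //.
- by rewrite invr_ge0 ltW.
- by apply: (measurableT_comp (measurable_powR p)); apply: measurable_nrm => m; exact: continuous_measurable_cV.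
- move=> r eps x e0; rewrite ler_pdivlMl//.
  apply: (@le_trans _ _ (kap * chi r x * q eps x `^ (p / 2))).
    rewrite mulrA; apply: ler_wpM2l; first by rewrite mulr_ge0 ?sqr_ge0// ltW.
    rewrite (_ : p = 2%:R * (p / 2)); last by field.
    rewrite powRrM powR_mulrn ?nrm_ge0// (_ : 2%:R * (p / 2) / 2 = p / 2); last by field.
    apply: ge0_ler_powR; rewrite ?nnegrE ?sqr_ge0//; [by rewrite divr_ge0// ltW|exact/ltW/q_gt0|].
    by rewrite /q lerDl ltW.
  rewrite /energyJ lerDl; apply: mulr_ge0.
    by rewrite mulr_ge0 ?sqr_ge0// divr_ge0// mulr_ge0// ltW.
  by rewrite mulr_ge0 ?powR_ge0// sumr_ge0// => j _; exact: sqr_ge0.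
Qed.

(** [gradient_young] uses both parts of the energy, with |D_j u|^2 bounded by the sum over all
    directions. The exponents of kap add up: p/2 - 1 + (1 - p) = -p/2. *)
Lemma smooth_gradient_estimate j : p <= 2 ->
  (\int[mu]_x (nrm (fun m => DU m j x) `^ p)%:E <=
   ((gam * kap) `^ (- (p / 2)) * \int[mu]_x (nrm (G^~ x) `^ p))%:E)%E.
Proof.
move=> p2.
have gk0 : 0 < gam / kap by rewrite divr_gt0.
have kn0 : kap != 0 by rewrite gt_eqF.
have -> : (gam * kap) `^ (- (p / 2)) * \int[mu]_x (nrm (G^~ x) `^ p) =
    (gam / kap) `^ (- (p / 2)) * kap^-1 * (kap `^ (1 - p) * \int[mu]_x NG x).
  rewrite !mulrA; congr (_ * _).
  rewrite !powRM ?invr_ge0 ?(ltW gam0) ?(ltW kap0)// -!mulrA; congr (_ * _).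
  rewrite -(powR_inv1 (ltW kap0)) -powRrM -!powRD ?kn0 ?implybT//.
  by congr (_ `^ _); field.
apply: le_cutoff_energy => //.
- by rewrite mulr_ge0 ?powR_ge0// invr_ge0 ltW.
- by apply: (measurableT_comp (measurable_powR p)); apply: measurable_nrm => m; exact: continuous_measurable_cV.
- by move=> x; exact: powR_ge0.
- move=> r eps x e0.
  have h := gradient_young p0 p2 gam0 kap0 (q_gt0 x e0) (nrm_ge0 (du j x)).
  have chi0 : 0 <= chi r x by exact: sqr_ge0.
  apply: le_trans (ler_wpM2l chi0 h) _.
  rewrite mulrCA; apply: ler_wpM2l.
    by rewrite mulr_ge0 ?powR_ge0// invr_ge0 ltW.
  rewrite (_ : energyJ r eps x = chi r x * (kap * q eps x `^ (p / 2) +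
    p * gam / 2 * (q eps x `^ a * \sum_j nrm (du j x) ^+ 2))); last by rewrite /energyJ; ring.
  apply: ler_wpM2l => //; rewrite lerD2l.
  apply: ler_wpM2l; first by rewrite divr_ge0// mulr_ge0// ltW.
  apply: ler_wpM2l; first exact: powR_ge0.
  by rewrite (bigD1 j)//= lerDl sumr_ge0// => i _; exact: sqr_ge0.
Qed.

End smooth_energy.

(** * Passage to weak solutions *)

Section moll_linear.
Context {R : realType} {d : nat}.
Notation E := 'cV[R]_d.
Notation mu := (@leb R d).
Implicit Types (k w : E -> R).

Lemma locL1D v w : locL1 v -> locL1 w -> locL1 (fun x => v x + w x).
Proof.
move=> [mv iv] [mw iw]; split; first exact: measurable_funD.
by move=> r; apply: (integrableD (measurable_cube r) (iv r) (iw r)).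
Qed.

(** Covers the drift, whose coefficient S x is continuous but unbounded. *)
Lemma locL1_contM k w : continuous k -> locL1 w -> locL1 (fun x => k x * w x).
Proof.
move=> ck lw; have mk := continuous_measurable_cV ck.
split; first by apply: measurable_funM => //; case: lw.
move=> r; have mc := @measurable_cube R d r.
have [C C0 HC] := continuous_bounded_cube r ck.
apply: (eq_integrable mc (EFin \o (fun x => (k x * \1_(cube r) x) * w x))).
  by move=> x rx; rewrite /= indicE rx mulr1.
apply: (@integrableS _ _ _ mu setT) => //.
apply: (@locL1_mul R d (fun x => k x * \1_(cube r) x) w r C) => //.
- by apply: measurable_funM => //; exact: measurable_indic.
- by move=> x nx; rewrite indicE memNset// mulr0.
- move=> x; rewrite indicE; have [/set_mem/HC|_] := boolP (x \in cube r); last by rewrite mulr0 normr0.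
  by rewrite mulr1.
Qed.

Lemma locL1Z c w : locL1 w -> locL1 (fun x => c * w x).
Proof. by apply: locL1_contM; exact: contCst. Qed.

Lemma locL1_sum (J : Type) (s : seq J) (w : J -> E -> R) : (forall j, locL1 (w j)) ->
  locL1 (fun x => \sum_(j <- s) w j x).
Proof.
move=> lw; elim: s => [|j s IH].
  by rewrite (_ : (fun _ => _) = cst 0); [exact: locL1_cst|apply/funext => x; rewrite big_nil].
rewrite (_ : (fun _ => _) = fun x => w j x + \sum_(j <- s) w j x).
  exact: locL1D.
by apply/funext => x; rewrite big_cons.
Qed.

Lemma locL1N w : locL1 w -> locL1 (fun x => - w x).
Proof.
move=> /(locL1Z (-1)); rewrite (_ : (fun _ => _) = fun x => - w x)//.
by apply/funext => x; rewrite mulN1r.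
Qed.

Variables (k : E -> R) (r : R).
Hypotheses (ck : continuous k) (sk : supported r k).

Lemma mollD v w x : locL1 v -> locL1 w ->
  moll k (fun y => v y + w y) x = moll k v x + moll k w x.
Proof.
move=> lv lw; rewrite /moll -(RintegralD _ (moll_integrable x ck sk lv) (moll_integrable x ck sk lw))//.
by apply: eq_Rintegral => y _; rewrite mulrDr.
Qed.

Lemma mollZ c w x : locL1 w -> moll k (fun y => c * w y) x = c * moll k w x.
Proof.
move=> lw; rewrite /moll -(RintegralZl c measurableT (moll_integrable x ck sk lw)).
by apply: eq_Rintegral => y _; rewrite mulrCA.
Qed.

Lemma mollN w x : locL1 w -> moll k (fun y => - w y) x = - moll k w x.
Proof.
move=> lw; rewrite -mulN1r -mollZ//; congr (moll _ _ _).
by apply/funext => y; rewrite mulN1r.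
Qed.

Lemma moll_sum (J : Type) (s : seq J) (w : J -> E -> R) x : (forall j, locL1 (w j)) ->
  moll k (fun y => \sum_(j <- s) w j y) x = \sum_(j <- s) moll k (w j) x.
Proof.
move=> lw; rewrite /moll -(@Rintegral_sum R d J s (fun j y => k (y - x) * w j y)).
  by apply: eq_Rintegral => y _; rewrite mulr_sumr.
by move=> j; exact: moll_integrable ck sk (lw j).
Qed.

Lemma moll_ae (v w : E -> R) x : locL1 v -> locL1 w -> {ae mu, forall y, v y = w y} ->
  moll k v x = moll k w x.
Proof.
move=> lv lw vw; rewrite /moll /Rintegral; congr fine; apply: ae_eq_integral => //.
- exact: measurable_int (moll_integrable x ck sk lv).
- exact: measurable_int (moll_integrable x ck sk lw).
- by apply: filterS vw => y vwy _; rewrite vwy.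
Qed.

End moll_linear.

(** * Mollified weak derivatives and the drift *)

Section moll_weak.
Context {R : realType} {d : nat}.
Notation E := 'cV[R]_d.
Notation mu := (@leb R d).
Notation e_ i := (delta_mx i 0 : E).
Implicit Types (k v w : E -> R).

(** The integral identity of [is_weakD] for one real component, without the integrability
    clauses. *)
Definition weak_deriv (j : 'I_d) v w := forall phi, test_function phi ->
  \int[mu]_y (partial j phi y * v y) = - \int[mu]_y (phi y * w y).

Lemma is_derive_shift k (x y e : E) a : is_derive (y - x) e k a ->
  is_derive y e (fun z => k (z - x)) a.
Proof.
move=> /is_derive_line0P h; apply/is_derive_line0P.
by under eq_fun do rewrite -addrA.
Qed.

Lemma moll_weak_deriv k k' v w j x : test_function (fun y => k (y - x)) ->
  (forall y, is_derive y (e_ j) k (k' y)) -> weak_deriv j v w ->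
  - moll k' v x = moll k w x.
Proof.
move=> tk dk /(_ _ tk) h; rewrite /moll -[RHS]opprK -h; congr (- _).
apply: eq_Rintegral => y _; congr (_ * _).
by rewrite /partial; case: (is_derive_shift (dk (y - x))).
Qed.

(* The commutator of the mollification with the drift pairs the skew matrix S
   with a matrix which is symmetric because the kernel is radial. *)
Lemma moll_drift (S : 'M[R]_d) k (k' : 'I_d -> E -> R) r v (w : 'I_d -> E -> R) (x : E) :
  S^T = - S -> continuous k -> supported r k ->
  (forall i (y : E), is_derive y (e_ i) k (k' i y)) ->
  (forall i j (y : E), y j 0 * k' i y = y i 0 * k' j y) ->
  (forall j, test_function (fun y : E => k (y - x) * (y - x) j 0)) ->
  (forall j, locL1 (w j)) -> (forall j, weak_deriv j v (w j)) ->
  moll k (fun y => \sum_j (S *m y) j 0 * w j y) x = \sum_j (S *m x) j 0 * moll k (w j) x.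
Proof.
move=> hS ck sk dk radial tk lw wd.
pose kl l (z : E) := k z * z l 0.
have ckl l : continuous (kl l) by apply: contMul => //; exact: coord_continuous.
have skl l : supported r (kl l) by move=> z /sk h; rewrite /kl h mul0r.
have ikl l j := moll_integrable x (ckl l) (skl l) (lw j).
have ik j := moll_integrable x ck sk (lw j).
(* With z = y - x, moving the derivative off [w j] pairs S with D_j (k z_l) = z_l D_j k + delta_jl
   k, which is symmetric in j and l. *)
have sym : \sum_j \sum_l S j l * moll (kl l) (w j) x = 0.
  apply: skew_dot => // i j; rewrite -[RHS]opprK -[LHS]opprK; congr (- _).
  rewrite /moll -!(wd _ _ (tk _)); apply: eq_Rintegral => y _; congr (_ * _).
  have H a b : partial a (fun y : E => k (y - x) * (y - x) b 0) y =
      k' a (y - x) * (y - x) b 0 + k (y - x) * (a == b)%:R.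
    have h := is_derive_shift (deriveMul (dk a (y - x)) (is_derive_coord a b (y - x))).
    by rewrite /partial; case: h.
  rewrite !H eq_sym; congr (_ + _).
  by rewrite mulrC radial mulrC.
(* S y = S x + S (y - x), and the second summand is the commutator. *)
have E y : k (y - x) * (\sum_j (S *m y) j 0 * w j y) =
   \sum_j ((S *m x) j 0 * (k (y - x) * w j y) + \sum_l S j l * (kl l (y - x) * w j y)).
  rewrite mulr_sumr; apply: eq_bigr => j _.
  have -> : (S *m y) j 0 = (S *m x) j 0 + \sum_l S j l * (y - x) l 0.
    by rewrite -[in LHS](subrK x y) addrC mulmxDr mxE; congr (_ + _); rewrite mxE.
  rewrite mulrDl mulrDr; congr (_ + _); first by rewrite mulrCA.
  by rewrite mulr_suml mulr_sumr; apply: eq_bigr => l _; rewrite /kl; ring.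
have i1 j : mu.-integrable setT (EFin \o (fun y => (S *m x) j 0 * (k (y - x) * w j y))).
  exact: (integrableZl measurableT _ (ik j)).
have i2 j l : mu.-integrable setT (EFin \o (fun y => S j l * (kl l (y - x) * w j y))).
  exact: (integrableZl measurableT _ (ikl l j)).
have i3 j := integrable_sumE (index_enum _) (i2 j).
rewrite /moll (eq_Rintegral _ (fun y _ => E y)) Rintegral_sum; last first.
  by move=> j; exact: (integrableD measurableT (i1 j) (i3 j)).
rewrite -[RHS]addr0 -[X in _ = _ + X]sym -big_split/=; apply: eq_bigr => j _.
rewrite (RintegralD measurableT (i1 j) (i3 j)) (RintegralZl _ measurableT (ik j)); congr (_ + _).
rewrite (Rintegral_sum _ (i2 j)); apply: eq_bigr => l _.
by rewrite (RintegralZl _ measurableT (ikl l j)).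
Qed.

End moll_weak.

(** * Almost everywhere limits of mollifications *)

Section moll_limit.
Context {R : realType} {d : nat}.
Notation E := 'cV[R]_d.
Notation mu := (@leb R d).

(** The n-th kernel has L^1 error at most 2^-(n+1) on [cube n], so the series of errors has a finite
    integral, is finite almost everywhere, and its terms tend to 0. The predicate [P] makes
    convergence and the estimates hold for one and the same sequence of kernels. *)
Lemma moll_cvg_ae (J : finType) (W : J -> E -> R) (P : (E -> R) -> Prop) :
  (forall j, locL1 (W j)) ->
  (forall r, 0 < r -> exists2 k, mollifier r k & P k) ->
  exists2 k : nat -> E -> R, forall n, (exists r, mollifier r (k n)) /\ P (k n) &
    {ae mu, forall x, forall j, moll (k n) (W j) x @[n --> \oo] --> W j x}.
Proof.
move=> lW HP.
have step (n : nat) : exists k, [/\ exists r, mollifier r k, P k &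
  forall j, (\int[mu]_(x in cube n%:R) `|moll k (W j) x - W j x|%:E <= (1 / (2 ^ n.+1)%:R)%:E)%E].
  have e0 : (0 : R) < 1 / (2 ^ n.+1)%:R by rewrite divr_gt0// ltr0n expn_gt0.
  have /choice[dl Hdl] : forall j, exists dl0, 0 < dl0 /\ forall dl k, dl <= dl0 -> mollifier dl k ->
     (\int[mu]_(x in cube n%:R) `|moll k (W j) x - W j x|%:E <= (1 / (2 ^ n.+1)%:R)%:E)%E.
    by move=> j; have [dl0 h0 h] := moll_cvg_L1 n%:R (lW j) e0; exists dl0.
  (* One radius serves the whole finite family [W]. *)
  pose r := \big[Num.min/1]_j dl j.
  have r0 : 0 < r by apply: lt_bigmin => // j _; case: (Hdl j).
  have [k mk Pk] := HP r r0.
  exists k; split => //; first by exists r.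
  move=> j; have [_ h] := Hdl j; apply: (h r) => //.
  exact: bigmin_le_cond.
have [k Hk] := choice step.
exists k => [n|]; first by case: (Hk n).
pose f j (n : nat) (x : E) := (`|moll (k n) (W j) x - W j x| * \1_(cube n%:R) x)%:E.
have mf j n : measurable_fun setT (f j n).
  apply/measurable_EFinP; apply: measurable_funM.
    apply: measurableT_comp => //; apply: measurable_funB; last by case: (lW j).
    apply: continuous_measurable_cV; case: (Hk n) => -[r [ck sk _ _]] _ _.
    exact: moll_continuous ck sk (lW j).
  by apply: measurable_indic; exact: measurable_cube.
have f0 j n x : (0 <= f j n x)%E by rewrite lee_fin mulr_ge0.
have fin j : {ae mu, forall x, (\sum_(n <oo) f j n x < +oo)%E}.
  have mS : measurable_fun setT (fun x => \sum_(n <oo) f j n x)%E.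
    by apply: ge0_emeasurable_sum.
  have iS : mu.-integrable setT (fun x => \sum_(n <oo) f j n x)%E.
    apply/integrableP; split => //.
    rewrite (eq_integral (fun x => \sum_(n <oo) f j n x)%E); last first.
      by move=> x _; rewrite gee0_abs// nneseries_ge0.
    rewrite integral_nneseries//; apply: le_lt_trans (ltry 1).
    apply: le_trans (epsilon_trick0 xpredT ler01).
    apply: lee_nneseries => n _.
      by move=> _; apply: integral_ge0.
    have [_ _ /(_ j)] := Hk n; apply: le_trans.
    rewrite [leRHS]integral_mkcond le_eqVlt; apply/orP; left; apply/eqP.
    apply: eq_integral => x _; rewrite patchE /f indicE.
    by case: ifP => _; rewrite ?mulr1// mulr0.
  apply: filterS (integrable_ae measurableT iS) => x /(_ I).
  rewrite ge0_fin_numE//; exact: nneseries_ge0.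
have cv j : {ae mu, forall x, moll (k n) (W j) x @[n --> \oo] --> W j x}.
  apply: filterS (fin j) => x fx.
  have t0 := nneseries_tail_cvg fx (fun n _ => f0 j n x).
  have f_cvg : f j n x @[n --> \oo] --> 0%E.
    apply: squeeze_cvge t0; last exact: cvg_cst.
    apply: nearW => n; rewrite f0/=.
    have := @nneseries_lim_ge R (fun n => f j n x) xpredT n n.+1 (fun i _ _ => f0 j i x).
    by rewrite big_nat1.
  have /fine_cvg : f j n x @[n --> \oo] --> (0:R)%:E by [].
  rewrite /f /= => /cvgrPdist_lt H; apply/cvgrPdist_lt => e e0.
  near=> n.
  have : `|0 - `|moll (k n) (W j) x - W j x| * \1_(cube n%:R) x| < e by near: n; exact: H.
  rewrite indicE mem_set; last first.
    move=> i; apply: le_trans (in_cube x i) _.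
    near: n; exact: nbhs_infty_ger.
  by rewrite mulr1 sub0r normrN normr_id distrC.
(* The finite family is indexed by naturals in order to use that a countable union of null sets is
   null. *)
have : {ae mu, forall x, forall n : nat, forall j, enum_rank j = n :> nat ->
    moll (k m) (W j) x @[m --> \oo] --> W j x}.
  apply: ae_foralln => n.
  have [ltn|geq] := ltnP n #|J|.
    apply: filterS (cv (enum_val (Ordinal ltn))) => x h j ejn.
    by rewrite (_ : j = enum_val (Ordinal ltn))// -[j]enum_rankK; congr enum_val; exact: val_inj.
  by apply: aeW => x j ejn; move: geq; rewrite -ejn leqNgt ltn_ord.
by apply: filterS => x h j; exact: (h (enum_rank j) j).
Unshelve. all: by end_near. Qed.

Lemma cvg_powR (p : R) (u : nat -> R) (l : R) : 1 <= p -> (forall n, 0 <= u n) -> 0 <= l ->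
  u n @[n --> \oo] --> l -> u n `^ p @[n --> \oo] --> l `^ p.
Proof.
move=> p1 u0; rewrite le_eqVlt => /predU1P[<-|l0] ul; last first.
  have h : {for l, continuous (fun s : R => s `^ p)}.
    have [H _] := is_derive1_powR p l0.
    exact/differentiable_continuous/derivable1_diffP.
  exact: (cvg_comp _ _ ul h).
(* At the limit 0 the power need not be differentiable from both sides; there u^p <= u for u <= 1
   suffices. *)
rewrite powR0 ?gt_eqF ?(lt_le_trans ltr01)//.
apply/cvgrPdist_le => e e0; near=> n.
have h : `|0 - u n| <= Num.min e 1.
  by near: n; move/cvgrPdist_le : ul; apply; rewrite lt_min e0 ltr01.
move: h; rewrite !sub0r !normrN (ger0_norm (u0 n)) ger0_norm ?powR_ge0// le_min => /andP[ue u1].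
apply: le_trans ue; have [->|un0] := eqVneq (u n) 0.
  by rewrite powR0// gt_eqF// (lt_le_trans ltr01).
rewrite -[leRHS](powRr1 (u0 n)); apply: ger_powR => //.
by rewrite lt_neqAle eq_sym un0 u0.
Unshelve. all: by end_near. Qed.

Lemma cvg_nrm (I : finType) (u : nat -> I -> R) (l : I -> R) :
  (forall m, u n m @[n --> \oo] --> l m) -> nrm (u n) @[n --> \oo] --> nrm l.
Proof.
move=> ul; apply: (@cvg_comp _ _ _ (fun n => \sum_m u n m ^+ 2) Num.sqrt _ (nbhs (\sum_m l m ^+ 2))); last exact: sqrt_continuous.
elim: (index_enum I) => [|m s IH].
  by rewrite big_nil (_ : (fun _ => _) = cst 0); [exact: cvg_cst|apply/funext => n; rewrite big_nil].
under eq_fun do rewrite big_cons expr2.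
by rewrite big_cons expr2; apply: cvgD IH; exact: cvgM.
Qed.

(** Fatou's lemma on the complement of the null set where convergence may fail. *)
Lemma moll_limit_Lp (I : finType) (p c : R) (k : nat -> E -> R) (W : I -> E -> R) :
  1 <= p -> (forall n, exists r, mollifier r (k n)) -> (forall m, locL1 (W m)) ->
  {ae mu, forall x, forall m, moll (k n) (W m) x @[n --> \oo] --> W m x} ->
  (forall n, \int[mu]_x (nrm (fun m => moll (k n) (W m) x) `^ p)%:E <= c%:E)%E ->
  (\int[mu]_x (nrm (fun m => W m x) `^ p)%:E <= c%:E)%E.
Proof.
move=> p1 mk lW [N [mN N0 HN]] H.
have mp (G : I -> E -> R) : (forall m, measurable_fun setT (G m)) ->
    measurable_fun setT (fun x => (nrm (fun m => G m x) `^ p)%:E).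
  move=> mG; apply/measurable_EFinP; apply: (measurableT_comp (measurable_powR p)).
  exact: measurable_nrm.
have mM n : measurable_fun setT (fun x => (nrm (fun m => moll (k n) (W m) x) `^ p)%:E).
  apply: mp => m; apply: continuous_measurable_cV; have [r [ck sk _ _]] := mk n.
  exact: moll_continuous ck sk (lW m).
have mW : measurable_fun setT (fun x => (nrm (fun m => W m x) `^ p)%:E).
  by apply: mp => m; case: (lW m).
have mD : measurable (setT `\` N) by exact: measurableD.
rewrite (ge0_negligible_integral mN measurableT mW) => [|x _|]; [|by rewrite lee_fin powR_ge0|exact: N0].
have hcvg x : (setT `\` N) x -> (nrm (fun m => moll (k n) (W m) x) `^ p)%:E @[n --> \oo] -->
    (nrm (fun m => W m x) `^ p)%:E.
  move=> [_ Nx].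
  have {Nx} h m : moll (k n) (W m) x @[n --> \oo] --> W m x.
    by apply: contrapT => nh; apply: Nx; apply: HN => /= /(_ m).
  apply: cvg_EFin; first exact: nearW.
  apply: cvg_powR => // [n||]; [exact: nrm_ge0|exact: nrm_ge0|].
  exact: cvg_nrm.
rewrite (eq_integral (fun x => limn_einf (fun n => (nrm (fun m => moll (k n) (W m) x) `^ p)%:E))); last first.
  by move=> x /set_mem/hcvg h; rewrite (cvg_limn_einf_sup h).1.
apply: le_trans (fatou mu mD _ _) _.
- by move=> n; exact: measurable_funTS.
- by move=> n x _; rewrite lee_fin powR_ge0.
have cc : (fun _ : nat => c%:E) @ \oo --> c%:E .
  exact: cvg_cst.
rewrite limn_einf_lim -(cvg_lim _ cc)//.
apply: lee_lim; [exact: is_cvg_einfs|exact: is_cvg_cst|].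
apply: nearW => n; apply: le_trans (H n).
apply: (@le_trans _ _ (\int[mu]_(x in setT `\` N) (nrm (fun m => moll (k n) (W m) x) `^ p)%:E)%E).
  by apply: ereal_inf_lbound; exists n => /=.
by apply: ge0_subset_integral => // x _; rewrite lee_fin powR_ge0.
Qed.

End moll_limit.

(** * Estimates for weak solutions of the real system *)

Section weak_estimates.
Context {R : realType} {I : finType} {d : nat}.
Notation E := 'cV[R]_d.
Notation mu := (@leb R d).
Notation e_ i := (delta_mx i 0 : E).
Variables (p gam kap : R) (M C : I -> I -> R) (S : 'M[R]_d).
Hypotheses (p1 : 1 < p) (gam0 : 0 < gam) (kap0 : 0 < kap) (hS : S^T = - S).
Hypothesis hM : forall z w : I -> R,
  gam * nrm z ^+ 2 * nrm w ^+ 2 <=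
  nrm z ^+ 2 * dot w (mv M w) + (p - 2) * dot w z * dot z (mv M w).
Hypothesis hM2 : forall w : I -> R, gam * nrm w ^+ 2 <= dot w (mv M w).
Hypothesis hC : forall w : I -> R, kap * nrm w ^+ 2 <= dot w (mv C w).
Variables (V g : I -> E -> R) (DV DDV : I -> 'I_d -> E -> R).
Hypotheses (lV : forall m, locL1 (V m)) (lDV : forall m j, locL1 (DV m j))
  (lDDV : forall m j, locL1 (DDV m j)) (lg : forall m, locL1 (g m)).
Hypothesis wDV : forall m j, weak_deriv j (V m) (DV m j).
Hypothesis wDDV : forall m j, weak_deriv j (DV m j) (DDV m j).
Hypothesis hg : {ae mu, forall x, forall m, g m x = mv C (V^~ x) m -
  mv M (fun n => \sum_j DDV n j x) m - \sum_j (S *m x) j 0 * DV m j x}.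
Hypothesis fV : (\int[mu]_x (nrm (V^~ x) `^ p)%:E < +oo)%E.
Hypothesis fg : (\int[mu]_x (nrm (g^~ x) `^ p)%:E < +oo)%E.

Let ng := \int[mu]_x (nrm (g^~ x) `^ p).

(** The two estimates for the functions mollified with [k], but with the norm of the original
    right-hand side, so that the bound is the same along the sequence of kernels. *)
Let good (k : E -> R) :=
  (\int[mu]_x (nrm (fun m => moll k (V m) x) `^ p)%:E <= (kap `^ (- p) * ng)%:E)%E /\
  (p <= 2 -> forall j, (\int[mu]_x (nrm (fun m => moll k (DV m j) x) `^ p)%:E <=
     ((gam * kap) `^ (- (p / 2)) * ng)%:E)%E).

Let ngE : (\int[mu]_x (nrm (g^~ x) `^ p)%:E)%E = ng%:E.
Proof.
rewrite /ng /Rintegral fineK// ge0_fin_numE//.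
by apply: integral_ge0 => x _; rewrite lee_fin powR_ge0.
Qed.

Let integrable_moll (k : E -> R) r (W : I -> E -> R) : mollifier r k ->
  (forall m, locL1 (W m)) -> (\int[mu]_x (nrm (W^~ x) `^ p)%:E < +oo)%E ->
  mu.-integrable setT (EFin \o (fun x => nrm (fun m => moll k (W m) x) `^ p)).
Proof.
move=> mk lW fW; have [ck sk _ _] := mk.
apply/integrableP; split.
  apply/measurable_EFinP; apply: (measurableT_comp (measurable_powR p)).
  apply: measurable_nrm => m; apply: continuous_measurable_cV.
  exact: moll_continuous ck sk (lW m).
rewrite (eq_integral (fun x => (nrm (fun m => moll k (W m) x) `^ p)%:E)); last first.
  by move=> x _; rewrite /= ger0_norm// powR_ge0.
exact: le_lt_trans (moll_Lp p1 mk lW) fW.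
Qed.

Let radial_good r : 0 < r -> exists2 k, mollifier r k & good k.
Proof.
move=> r0; have [k [k' [mk ck' dk radial [tk tkc]]]] := @radial_mollifier R d r r0.
exists k => //; have [ck sk _ _] := mk.
have moll_dU m j x : is_derive x (e_ j) (moll k (V m)) (moll k (DV m j) x).
  rewrite -(moll_weak_deriv (tk x) (dk j) (wDV m j)).
  by case: (ck' j) => cj sj; exact: (moll_derive ck cj sk sj (dk j)).
have moll_dDU m j x : is_derive x (e_ j) (moll k (DV m j)) (moll k (DDV m j) x).
  rewrite -(moll_weak_deriv (tk x) (dk j) (wDDV m j)).
  by case: (ck' j) => cj sj; exact: (moll_derive ck cj sk sj (dk j)).
have cS (j : 'I_d) : continuous (fun x : E => (S *m x) j 0).
  rewrite (_ : (fun _ => _) = fun x : E => \sum_k S j k * x k 0); last by apply/funext => x; rewrite mxE.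
  by apply: continuous_sumE => i; apply: contMul; [exact: contCst|exact: coord_continuous].
have lmv (L : I -> I -> R) (W : I -> E -> R) m : (forall n, locL1 (W n)) ->
    locL1 (fun x => mv L (W^~ x) m).
  by move=> lW; apply: locL1_sum => n; exact: locL1Z.
have moll_mv (L : I -> I -> R) (W : I -> E -> R) m x : (forall n, locL1 (W n)) ->
    moll k (fun x => mv L (W^~ x) m) x = mv L (fun n => moll k (W n) x) m.
  move=> lW; rewrite /mv (moll_sum ck sk _ _ (fun n => locL1Z (L m n) (lW n))).
  by apply: eq_bigr => n _; exact: (mollZ ck sk).
have lsum n : locL1 (fun x => \sum_j DDV n j x) by exact: locL1_sum.
have ldrift m : locL1 (fun x => \sum_j (S *m x) j 0 * DV m j x).
  by apply: locL1_sum => j; exact: locL1_contM.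
(* Constant coefficients commute with mollification by linearity, the drift by [moll_drift]; the
   equation, known almost everywhere, now holds at every point. *)
have moll_eq m x : moll k (g m) x = mv C (fun n => moll k (V n) x) m -
    mv M (fun n => \sum_j moll k (DDV n j) x) m - \sum_j (S *m x) j 0 * moll k (DV m j) x.
  have lCV : locL1 (fun x => mv C (V^~ x) m) by exact: lmv.
  have lMD : locL1 (fun x => mv M (fun n => \sum_j DDV n j x) m) by exact: lmv.
  have lCM := locL1D lCV (locL1N lMD).
  rewrite (moll_ae ck sk x (lg m) (locL1D lCM (locL1N (ldrift m)))); last first.
    by apply: filterS hg => y ->.
  rewrite (mollD ck sk x lCM (locL1N (ldrift m))) (mollD ck sk x lCV (locL1N lMD)).
  rewrite (mollN ck sk x lMD) (mollN ck sk x (ldrift m)) !moll_mv//.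
  rewrite (moll_drift hS ck sk dk radial (tkc x) (lDV m) (wDV m)); congr (_ - _ - _).
  by congr (mv _ _ _); apply/funext => n; exact: (moll_sum ck sk _ _ (lDDV n)).
have iU := integrable_moll mk lV fV.
have iG := integrable_moll mk lg fg.
have cm (W : E -> R) : locL1 W -> continuous (moll k W) by exact: moll_continuous ck sk.
have le_ng : \int[mu]_x (nrm (fun m => moll k (g m) x) `^ p) <= ng.
  apply: (fine_le _ _ (moll_Lp p1 mk lg)); last by rewrite ngE.
  exact: (integrable_fin_num measurableT iG).
split=> [|p2 j].
  apply: le_trans (@smooth_Lp_estimate R I d p gam kap M C S p1 gam0 kap0 hS hM hM2 hC
    (fun m => moll k (V m)) (fun m => moll k (g m)) (fun m j => moll k (DV m j))
    (fun m j => moll k (DDV m j)) (fun m => cm _ (lV m)) (fun m j => cm _ (lDV m j))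
    (fun m j => cm _ (lDDV m j)) moll_dU moll_dDU moll_eq iU iG) _.
  by rewrite lee_fin ler_wpM2l// powR_ge0.
apply: le_trans (@smooth_gradient_estimate R I d p gam kap M C S p1 gam0 kap0 hS hM hM2 hC
    (fun m => moll k (V m)) (fun m => moll k (g m)) (fun m j => moll k (DV m j))
    (fun m j => moll k (DDV m j)) (fun m => cm _ (lV m)) (fun m j => cm _ (lDV m j))
    (fun m j => cm _ (lDDV m j)) moll_dU moll_dDU moll_eq iU iG j p2) _.
by rewrite lee_fin ler_wpM2l// powR_ge0.
Qed.

Lemma weak_estimates :
  (\int[mu]_x (nrm (V^~ x) `^ p)%:E <=
    (kap `^ (- p))%:E * \int[mu]_x (nrm (g^~ x) `^ p)%:E)%E /\
  (p <= 2 -> forall j, (\int[mu]_x (nrm (fun m => DV m j x) `^ p)%:E <=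
    ((gam * kap) `^ (- (p / 2)))%:E * \int[mu]_x (nrm (g^~ x) `^ p)%:E)%E).
Proof.
(* The function and all its first derivatives form one finite family, with [None] for the function,
   so that a single sequence of kernels converges for all of them. *)
pose W (z : I * option 'I_d) := if z.2 is Some j then DV z.1 j else V z.1.
have lW z : locL1 (W z) by rewrite /W; case: z.2.
have [k Hk kW] := moll_cvg_ae lW radial_good.
have p1' : 1 <= p by exact: ltW.
have mk n : exists r, mollifier r (k n) by case: (Hk n).
rewrite ngE -!EFinM; split=> [|p2 j].
  apply: (moll_limit_Lp p1' mk lV) => [|n]; last by have [_ []] := Hk n.
  by apply: filterS kW => x h m; exact: h (m, None).
apply: (@moll_limit_Lp R d I p _ k (fun m => DV m j) p1' mk (fun m => lDV m j)) => [|n]; last first.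
  by have [_ [_ h]] := Hk n; exact: h.
by apply: filterS kW => x h m; exact: h (m, Some j).
Qed.

End weak_estimates.

(** * Complex vectors as real vectors *)

Local Open Scope complex_scope.

Section realification.
Context {R : realType} {N : nat}.
Notation C := R[i].
Notation I := ('I_N * bool)%type.
Notation Re := complex.Re.
Notation Im := complex.Im.
Implicit Types (u v : 'cV[C]_N) (A : 'M[C]_N).

(* C^N is the real space indexed by pairs (k, b), where b = true stands for
   the imaginary part. *)
Definition toR v : I -> R := fun m => if m.2 then Im (v m.1 0) else Re (v m.1 0).
Definition ofR (w : I -> R) : 'cV[C]_N := \col_k (w (k, false) +i* w (k, true)).
(** A complex entry a + ib becomes the real block with rows (a, -b) and (b, a). *)
Definition realmx A : I -> I -> R := fun m n =>
  if m.2 then (if n.2 then Re (A m.1 n.1) else Im (A m.1 n.1))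
  else (if n.2 then - Im (A m.1 n.1) else Re (A m.1 n.1)).

Lemma ReD (x y : C) : Re (x + y) = Re x + Re y. Proof. by case: x; case: y. Qed.
Lemma ImD (x y : C) : Im (x + y) = Im x + Im y. Proof. by case: x; case: y. Qed.

Lemma ofRK w : toR (ofR w) = w.
Proof. by apply/funext => -[k []]; rewrite /toR /ofR mxE. Qed.

Lemma toR_inj u v : toR u = toR v -> u = v.
Proof.
move=> uv; apply/colP => k; apply/eqP; rewrite eq_complex.
by have := congr1 (@^~ (k, false)) uv; have := congr1 (@^~ (k, true)) uv; rewrite /toR /= => -> ->; rewrite !eqxx.
Qed.

Lemma toRD u v m : toR (u + v) m = toR u m + toR v m.
Proof. by rewrite /toR mxE ReD ImD; case: ifP. Qed.

Lemma toRN u m : toR (- u) m = - toR u m.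
Proof. by rewrite /toR mxE; case: (u _ _) => a b; case: ifP. Qed.

Lemma toR0 m : toR 0 m = 0.
Proof. by rewrite /toR mxE; case: ifP. Qed.

Lemma toR_sum (J : Type) (s : seq J) (f : J -> 'cV[C]_N) m :
  toR (\sum_(j <- s) f j) m = \sum_(j <- s) toR (f j) m.
Proof. by elim: s => [|j s IH]; rewrite ?big_nil ?toR0// !big_cons toRD IH. Qed.

Lemma toRZ (a : R) u m : toR (a%:C *: u) m = a * toR u m.
Proof. by rewrite /toR mxE; case: (u _ _) => x y /=; rewrite !mul0r subr0 addr0; case: ifP. Qed.

Lemma sum_pair_bool (f : I -> R) : \sum_m f m = \sum_k (f (k, false) + f (k, true)).
Proof.
rewrite (eq_bigr (fun m => f (m.1, m.2))); last by case.
rewrite -(pair_bigA _ (fun k b => f (k, b)))/=; apply: eq_bigr => k _.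
by rewrite big_bool addrC.
Qed.

Lemma Re_sum (J : Type) (s : seq J) (f : J -> C) : Re (\sum_(j <- s) f j) = \sum_(j <- s) Re (f j).
Proof. by elim: s => [|j s IH]; rewrite ?big_nil// !big_cons ReD IH. Qed.

Lemma Im_sum (J : Type) (s : seq J) (f : J -> C) : Im (\sum_(j <- s) f j) = \sum_(j <- s) Im (f j).
Proof. by elim: s => [|j s IH]; rewrite ?big_nil// !big_cons ImD IH. Qed.

Lemma toR_mul A v m : toR (A *m v) m = mv (realmx A) (toR v) m.
Proof.
rewrite /mv sum_pair_bool /toR /realmx; case: m => k b /=.
rewrite mxE Re_sum Im_sum; case: b; apply: eq_bigr => l _ /=.
  by case: (A k l) => a a'; case: (v l 0) => x y /=; ring.
by case: (A k l) => a a'; case: (v l 0) => x y /=; ring.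
Qed.

(** All the hypotheses involve only real parts of inner products, and so they pass to the real space
    unchanged. *)
Lemma Re_inner u v : Re (inner u v) = dot (toR u) (toR v).
Proof.
rewrite /dot sum_pair_bool /toR /inner /= mxE Re_sum; apply: eq_bigr => k _.
by rewrite !mxE; case: (u k 0) => a b; case: (v k 0) => x y /=; ring.
Qed.

Lemma enormE v : enorm v = nrm (toR v).
Proof.
by rewrite /enorm /nrm Re_inner.
Qed.

End realification.

Section forms.
Context {R : realType} {I : finType}.
Implicit Types (u v w : I -> R).

Lemma nrmZ (c : R) w : nrm (fun m => c * w m) = `|c| * nrm w.
Proof.
apply/eqP; rewrite -(@eqrXn2 _ 2) ?mulr_ge0 ?nrm_ge0//.
rewrite exprMn !nrmE mulr_sumr real_normK ?num_real//; apply/eqP.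
by apply: eq_bigr => m _; rewrite exprMn.
Qed.

Lemma nrm_eq0 w : nrm w = 0 -> w = fun=> 0.
Proof.
move=> w0; apply/funext => m; apply/eqP; rewrite -normr_eq0 eq_le normr_ge0 andbT.
by rewrite -w0 abs_le_nrm.
Qed.

Lemma nrmD u v : nrm (fun m => u m + v m) <= nrm u + nrm v.
Proof.
rewrite -(@ler_pXn2r _ 2) ?nnegrE ?addr_ge0 ?nrm_ge0// sqrrD !nrmE.
apply: (@le_trans _ _ (\sum_m u m ^+ 2 + dot u v *+ 2 + \sum_m v m ^+ 2)).
  rewrite /dot -sumrMnl -!big_split/=; apply: ler_sum => m _.
  by rewrite sqrrD.
by rewrite lerD2r lerD2l lerMn2r dot_le_nrm orbT.
Qed.

Lemma nrmN w : nrm (fun m => - w m) = nrm w.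
Proof.
rewrite -[RHS]mul1r -[X in X * _](@normr1 R) -normrN -nrmZ; congr nrm.
by apply/funext => m; rewrite mulN1r.
Qed.

Lemma mvZ (M : I -> I -> R) c w : mv M (fun m => c * w m) = fun m => c * mv M w m.
Proof.
by apply/funext => m; rewrite /mv mulr_sumr; apply: eq_bigr => n _; rewrite mulrCA.
Qed.

Lemma dotZZ c u v : dot (fun m => c * u m) (fun m => c * v m) = c ^+ 2 * dot u v.
Proof. by rewrite /dot mulr_sumr; apply: eq_bigr => m _; ring. Qed.

Lemma form_bound_unit (M : I -> I -> R) (b : R) :
  (forall w, nrm w = 1 -> b <= dot w (mv M w)) -> forall w, b * nrm w ^+ 2 <= dot w (mv M w).
Proof.
move=> h w; have [w0|w0] := eqVneq (nrm w) 0.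
  by rewrite w0 expr0n mulr0 (nrm_eq0 w0) /dot big1// => m _; rewrite mul0r.
have := h (fun m => (nrm w)^-1 * w m).
rewrite nrmZ ger0_norm ?invr_ge0 ?nrm_ge0// mulVf// => /(_ erefl).
by rewrite mvZ dotZZ exprVn mulrC ler_pdivlMr// exprn_gt0// lt_neqAle eq_sym w0 nrm_ge0.
Qed.

End forms.

Section realified_hypotheses.
Context {R : realType} {N : nat} (p gam : R) (A : 'M[R[i]]_N).
Hypothesis hA : forall z w : 'cV[R[i]]_N,
      gam * enorm z ^+ 2 * enorm w ^+ 2 <=
      enorm z ^+ 2 * complex.Re (inner w (A *m w)) +
      (p - 2) * complex.Re (inner w z) * complex.Re (inner z (A *m w)).

Lemma realmx_ellipticity (z w : 'I_N * bool -> R) :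
  gam * nrm z ^+ 2 * nrm w ^+ 2 <=
  nrm z ^+ 2 * dot w (mv (realmx A) w) + (p - 2) * dot w z * dot z (mv (realmx A) w).
Proof.
have := hA (ofR z) (ofR w); rewrite !enormE !Re_inner.
by rewrite (_ : toR (A *m ofR w) = mv (realmx A) w) ?ofRK//; apply/funext => m; rewrite toR_mul ofRK.
Qed.

(* The choice z = i w makes Re <w, z> vanish. *)
Lemma realmx_coercive (w : 'I_N * bool -> R) : gam * nrm w ^+ 2 <= dot w (mv (realmx A) w).
Proof.
have [w0|w0] := eqVneq (nrm w) 0.
  by rewrite w0 expr0n mulr0 (nrm_eq0 w0) /dot big1// => m _; rewrite mul0r.
pose z : 'I_N * bool -> R := fun m => if m.2 then w (m.1, false) else - w (m.1, true).
have zw : nrm z = nrm w.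
  rewrite /nrm !sum_pair_bool; congr Num.sqrt; apply: eq_bigr => k _ /=.
  by rewrite /z/= sqrrN addrC.
have dz : dot w z = 0.
  by rewrite /dot sum_pair_bool big1// => k _; rewrite /z/=; ring.
have := realmx_ellipticity z w; rewrite dz zw mulr0 mul0r addr0.
rewrite (_ : gam * _ * _ = nrm w ^+ 2 * (gam * nrm w ^+ 2)); last by ring.
by rewrite ler_pM2l// exprn_gt0// lt_neqAle eq_sym w0 nrm_ge0.
Qed.

End realified_hypotheses.

(** As <u, u> is real, only Re lambda contributes from lambda <u, u>. The bound on B extends from
    unit vectors by homogeneity. *)
Lemma realmx_dissipative (R : realType) (N : nat) (B : 'M[R[i]]_N) (betaB : R) (lambda : R[i])
  (hB : forall w : 'cV[R[i]]_N, enorm w = 1 -> - betaB <= complex.Re (inner w (B *m w)))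
  (w : 'I_N * bool -> R) :
  (complex.Re lambda - betaB) * nrm w ^+ 2 <= dot w (mv (realmx (lambda%:M + B)) w).
Proof.
have h : forall w : 'I_N * bool -> R, nrm w = 1 -> - betaB <= dot w (mv (realmx B) w).
  move=> w' w1; have := hB (ofR w'); rewrite enormE ofRK => /(_ w1); rewrite Re_inner ofRK.
  by rewrite (_ : toR (B *m ofR w') = mv (realmx B) w')//; apply/funext => m; rewrite toR_mul ofRK.
have := form_bound_unit h w.
have -> : dot w (mv (realmx (lambda%:M + B)) w) = complex.Re lambda * nrm w ^+ 2 + dot w (mv (realmx B) w).
  rewrite -(ofRK w) -(_ : toR ((lambda%:M + B) *m ofR w) = mv (realmx (lambda%:M + B)) (toR (ofR w))); last first.
    by apply/funext => m; rewrite toR_mul.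
  rewrite -(_ : toR (B *m ofR w) = mv (realmx B) (toR (ofR w))); last first.
    by apply/funext => m; rewrite toR_mul.
  rewrite -!Re_inner mulmxDl mul_scalar_mx -enormE; set u := ofR w.
  have -> : inner u (lambda *: u + B *m u) = lambda * inner u u + inner u (B *m u).
    by rewrite /inner mulmxDr mxE -scalemxAr mxE.
  rewrite ReD; congr (_ + _).
  have -> : inner u u = (enorm u ^+ 2)%:C.
    rewrite enormE nrmE sum_pair_bool /inner mxE rmorph_sum/=; apply: eq_bigr => k _.
    rewrite /toR !mxE /=; case: (u k 0) => a b; apply/eqP; rewrite eq_complex /=.
    by apply/andP; split; apply/eqP; ring.
  by case: lambda => a b /=; rewrite mulr0 subr0.
by move=> hw; rewrite mulrBl -mulNr lerD2l.
Qed.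

(** * Real components of complex functions *)

Section function_translation.
Context {R : realType} {d N : nat}.
Notation E := 'cV[R]_d.
Notation C := R[i].
Notation mu := (@leb R d).
Notation e_ i := (delta_mx i 0 : E).
Implicit Types v w : E -> 'cV[C]_N.

Definition cpart v : 'I_N * bool -> E -> R := fun m x => toR (v x) m.

Lemma measurable_cpart v : measurable_cVfun v -> forall m, measurable_fun setT (cpart v m).
Proof. by move=> mv [k b]; have [h1 h2] := mv k; case: b. Qed.

Lemma locL1_in_Lp_loc1 v : in_Lp_loc 1 v -> forall m, locL1 (cpart v m).
Proof.
move=> [/measurable_cpart mv h] m; split=> // r.
have mc := @measurable_cube R d r.
apply/integrableP; split; first exact/measurable_EFinP/measurable_funTS.
have hr : (\int[mu]_(x in cube r) (enorm (v x) `^ 1)%:E < +oo)%E := h _ (@compact_cube R d r).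
apply: le_lt_trans hr.
apply: ge0_le_integral => //.
- by apply/measurable_EFinP/measurableT_comp => //; exact: measurable_funTS.
- apply/measurable_EFinP/measurable_funTS.
  apply: (measurableT_comp (measurable_powR 1)).
  rewrite (_ : (fun _ => _) = fun x => nrm ((cpart v)^~ x)).
    exact: measurable_nrm.
  by apply/funext => x; rewrite enormE.
- move=> x _; rewrite lee_fin powRr1; last by rewrite enormE nrm_ge0.
  by rewrite enormE; exact: abs_le_nrm.
Qed.

Lemma LpnormE (p : R) v : p != 0 ->
  (Lpnorm p v `^ p = \int[mu]_x (nrm ((cpart v)^~ x) `^ p)%:E)%E.
Proof.
move=> p0; have := @poweR_Lnorm _ _ _ (lebesgue_cV d) (EFin \o (enorm \o v)) p p0.
rewrite -/(Lpnorm p v) => ->; apply: eq_integral => x _ /=.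
by rewrite ger0_norm ?enormE// nrm_ge0.
Qed.

Lemma in_Lp_fin (p : R) v : 1 < p -> in_Lp p v ->
  (\int[mu]_x (nrm ((cpart v)^~ x) `^ p)%:E < +oo)%E.
Proof. by move=> p1 [_ h]; rewrite -LpnormE ?gt_eqF ?(lt_trans ltr01)// poweR_lty. Qed.

(** |v| <= 1 + |v|^p, and cubes have finite measure. *)
Lemma locL1_in_Lp (p : R) v : 1 < p -> in_Lp p v -> forall m, locL1 (cpart v m).
Proof.
move=> p1 hv m; have fv := in_Lp_fin p1 hv; have mv := measurable_cpart hv.1.
split=> // r; have mc := @measurable_cube R d r.
have mn : measurable_fun setT (fun x => (nrm ((cpart v)^~ x) `^ p)%:E).
  by apply/measurable_EFinP/(measurableT_comp (measurable_powR p)); exact: measurable_nrm.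
apply/integrableP; split; first exact/measurable_EFinP/measurable_funTS.
apply: (@le_lt_trans _ _ (\int[mu]_(x in cube r) (1 + (nrm ((cpart v)^~ x) `^ p)%:E))%E).
  apply: ge0_le_integral => //.
  - by apply/measurable_EFinP/measurableT_comp => //; exact: measurable_funTS.
  - by apply: emeasurable_funD => //; exact: measurable_funTS.
  - move=> x _; rewrite -EFinD lee_fin; apply: le_trans (abs_le_nrm _ _) _.
    have n0 := nrm_ge0 ((cpart v)^~ x).
    have [n1|n1] := leP (nrm ((cpart v)^~ x)) 1.
      by apply: le_trans n1 _; rewrite lerDl powR_ge0.
    apply: (@le_trans _ _ (nrm ((cpart v)^~ x) `^ p)); last by rewrite lerDr.
    rewrite -[leLHS](powRr1 n0); apply: ler_powR; exact: ltW.
rewrite ge0_integralD//; [|by move=> x _; rewrite lee_fin powR_ge0|exact: measurable_funTS].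
rewrite integral_cst// mul1e lte_add_pinfty//; first exact: cube_fin.
apply: le_lt_trans fv; apply: ge0_le_integral_cube => // x.
by rewrite lee_fin powR_ge0.
Qed.

(** Test functions are real, so the complex identity splits into real and imaginary parts. *)
Lemma is_weakD_cpart (i : 'I_d) v w : is_weakD i v w ->
  forall m, weak_deriv i (cpart v m) (cpart w m).
Proof.
move=> [_ _ h] [k b] phi /h /colP/(_ k).
rewrite !mxE => /eqP; rewrite eq_complex /= => /andP[/eqP h1 /eqP h2].
have scE (psi : E -> R) (u : E -> 'cV[C]_N) (x : E) :
    (((psi x)%:C *: u x) k 0 = (psi x * complex.Re (u x k 0)) +i* (psi x * complex.Im (u x k 0))).
  by rewrite mxE; case: (u x k 0) => a c; apply/eqP; rewrite eq_complex /= !mul0r subr0 addr0 !eqxx.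
have L1 (psi : E -> R) (u : E -> 'cV[C]_N) :
    \int[mu]_x complex.Re (((psi x)%:C *: u x) k 0) = \int[mu]_x (psi x * cpart u (k, false) x).
  by apply: eq_Rintegral => x _; rewrite scE.
have L2 (psi : E -> R) (u : E -> 'cV[C]_N) :
    \int[mu]_x complex.Im (((psi x)%:C *: u x) k 0) = \int[mu]_x (psi x * cpart u (k, true) x).
  by apply: eq_Rintegral => x _; rewrite scE.
by case: b; rewrite -?L1 -?L2.
Qed.

(** Existence of a weak derivative excludes the default value 0. *)
Lemma weakDP (i : 'I_d) v : weakly_derivable i v -> is_weakD i v (weakD i v).
Proof. by move=> [w hw]; rewrite /weakD; exact: (xgetPex (fun=> 0) (ex_intro _ w hw)). Qed.

Lemma test_function_supp (phi : E -> R) : test_function phi ->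
  exists r, supported r phi /\ forall i, supported r (partial i phi).
Proof.
move=> [_ /compact_bounded[M [_ HM]]].
pose r := `|M| + 1; exists r.
have sr : supported r phi.
  move=> x nx; apply/eqP; rewrite -[_ == _]negbK; apply/negP => px; apply: nx => i.
  apply: le_trans (in_cube x i) _; apply: (HM r); last exact: subset_closure.
  by rewrite (le_lt_trans (ler_norm M))// ltrDl.
split=> // i x nx.
(* The complement of the cube is open, so [phi] vanishes near [x] and its partial derivatives vanish
   at [x]. *)
have : \near x, (fun=> 0) x = phi x.
  have op : open (~` cube r : set E) by rewrite openC; exact: closed_cube.
  by apply: filterS (open_nbhs_nbhs (conj op nx)) => y /sr.
move=> h; rewrite /partial -(near_eq_derive (e_ i) h).
exact: derive_cst.
Qed.

Lemma weak_derivB (i : 'I_d) (v1 v2 w1 w2 : E -> R) : locL1 v1 -> locL1 v2 -> locL1 w1 ->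
  locL1 w2 -> weak_deriv i v1 w1 -> weak_deriv i v2 w2 ->
  weak_deriv i (fun x => v1 x - v2 x) (fun x => w1 x - w2 x).
Proof.
move=> lv1 lv2 lw1 lw2 h1 h2 phi tphi.
have [r [sp /(_ i) sdp]] := test_function_supp tphi.
have [smooth_phi _] := tphi.
have cp : continuous phi by case: (smooth_phi [::]).
have cdp : continuous (partial i phi) by case: (smooth_phi [:: i]).
have int k u : continuous k -> supported r k -> locL1 u ->
    mu.-integrable setT (EFin \o (fun x => k x * u x)).
  move=> ck sk lu; have [K K0 HK] := continuous_bounded_supp ck sk.
  exact: (locL1_mul (continuous_measurable_cV ck) lu sk HK).
under eq_Rintegral do rewrite mulrBr.
under [in RHS]eq_Rintegral do rewrite mulrBr.
rewrite !RintegralB//; try exact: int.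
by rewrite h1// h2// opprB addrC opprK.
Qed.

End function_translation.

(** * The complex resolvent equation *)

Section resolvent.
Context {R : realType} {d N : nat}.
Notation E := 'cV[R]_d.
Notation C := R[i].
Notation mu := (@leb R d).
Variables (p gamma beta : R) (A B : 'M[C]_N) (S : 'M[R]_d) (lambda : C).
Hypotheses (p1 : 1 < p) (gamma0 : 0 < gamma) (hS : S^T = - S).
Hypothesis hA : forall z w : 'cV[R[i]]_N,
      gamma * enorm z ^+ 2 * enorm w ^+ 2 <=
      enorm z ^+ 2 * complex.Re (inner w (A *m w)) +
      (p - 2) * complex.Re (inner w z) * complex.Re (inner z (A *m w)).
Hypothesis hB : forall w : 'cV[R[i]]_N, enorm w = 1 -> - beta <= complex.Re (inner w (B *m w)).
Hypothesis hlambda : beta < complex.Re lambda.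

Let p0 : 0 < p. Proof. exact: lt_trans p1. Qed.
Let kap := complex.Re lambda - beta.
Let kap0 : 0 < kap. Proof. by rewrite subr_gt0. Qed.

(** The weak derivatives [w] and [z] are arguments instead of [weakD], so that a difference of two
    solutions can be given the differences of the chosen representatives. *)
Let resolvent_estimates (v g : E -> 'cV[C]_N) (w z : 'I_d -> E -> 'cV[C]_N) :
  (forall m, locL1 (cpart v m)) -> (forall j m, locL1 (cpart (w j) m)) ->
  (forall j m, locL1 (cpart (z j) m)) -> (forall m, locL1 (cpart g m)) ->
  (forall j m, weak_deriv j (cpart v m) (cpart (w j) m)) ->
  (forall j m, weak_deriv j (cpart (w j) m) (cpart (z j) m)) ->
  {ae mu, forall x, lambda *: v x -
    (A *m (\sum_j z j x) + \sum_j ((S *m x) j 0)%:C *: w j x - B *m v x) = g x} ->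
  (\int[mu]_x (nrm ((cpart v)^~ x) `^ p)%:E < +oo)%E ->
  (\int[mu]_x (nrm ((cpart g)^~ x) `^ p)%:E < +oo)%E ->
  (\int[mu]_x (nrm ((cpart v)^~ x) `^ p)%:E <=
    (kap `^ (- p))%:E * \int[mu]_x (nrm ((cpart g)^~ x) `^ p)%:E)%E /\
  (p <= 2 -> forall j, (\int[mu]_x (nrm ((cpart (w j))^~ x) `^ p)%:E <=
    ((gamma * kap) `^ (- (p / 2)))%:E * \int[mu]_x (nrm ((cpart g)^~ x) `^ p)%:E)%E).
Proof.
move=> lv lw lz lg wv ww eq fv fg.
have heq : {ae mu, forall x, forall m, cpart g m x = mv (realmx (lambda%:M + B)) ((cpart v)^~ x) m -
  mv (realmx A) (fun n => \sum_j cpart (z j) n x) m - \sum_j (S *m x) j 0 * cpart (w j) m x}.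
  apply: filterS eq => x gx m; rewrite /cpart -gx -toR_mul mulmxDl mul_scalar_mx.
  have -> : (fun n => \sum_j toR (z j x) n) = toR (\sum_j z j x).
    by apply/funext => n; rewrite toR_sum.
  rewrite -toR_mul !(toRD, toRN) toR_sum.
  rewrite (eq_bigr (fun j => (S *m x) j 0 * toR (w j x) m)); last by move=> j _; exact: toRZ.
  by ring.
exact: (@weak_estimates R _ d p gamma kap (realmx A) (realmx (lambda%:M + B)) S p1 gamma0 kap0 hS
  (realmx_ellipticity hA) (realmx_coercive hA) (realmx_dissipative lambda hB)
  (cpart v) (cpart g) (fun m j => cpart (w j) m) (fun m j => cpart (z j) m)
  lv (fun m j => lw j m) (fun m j => lz j m) lg (fun m j => wv j m) (fun m j => ww j m) heq fv fg).
Qed.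

Variable g : E -> 'cV[C]_N.

Let in_domain (v : E -> 'cV[C]_N) : dom_loc p A S v ->
  [/\ forall m, locL1 (cpart v m), forall j m, locL1 (cpart (weakD j v) m),
     forall j m, locL1 (cpart (weakD j (weakD j v)) m),
     forall j m, weak_deriv j (cpart v m) (cpart (weakD j v) m) &
     forall j m, weak_deriv j (cpart (weakD j v) m) (cpart (weakD j (weakD j v)) m)].
Proof.
move=> [[_ h1 h2] hv _].
have W1 j : is_weakD j v (weakD j v) by apply: weakDP; case: (h1 j).
have W2 j : is_weakD j (weakD j v) (weakD j (weakD j v)) by apply: weakDP; case: (h2 j j).
split.
- exact: locL1_in_Lp hv.
- by move=> j; have [_ + _] := W1 j; exact: locL1_in_Lp_loc1.
- by move=> j; have [_ + _] := W2 j; exact: locL1_in_Lp_loc1.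
- by move=> j; exact: is_weakD_cpart.
- by move=> j; exact: is_weakD_cpart.
Qed.

Lemma resolvent_unique v1 v2 : dom_loc p A S v1 -> dom_loc p A S v2 ->
  resolvent_solution A B S lambda g v1 -> resolvent_solution A B S lambda g v2 ->
  {ae mu, forall x, v1 x = v2 x}.
Proof.
move=> d1 d2 e1 e2.
have [lv1 lw1 lz1 wv1 ww1] := in_domain d1; have [lv2 lw2 lz2 wv2 ww2] := in_domain d2.
have cpartB (u1 u2 : E -> 'cV[C]_N) m :
    cpart (fun x => u1 x - u2 x) m = fun x => cpart u1 m x - cpart u2 m x.
  by apply/funext => x; rewrite /cpart toRD toRN.
have locL1B (u1 u2 : E -> R) : locL1 u1 -> locL1 u2 -> locL1 (fun x => u1 x - u2 x).
  by move=> h1 h2; apply: locL1D => //; exact: locL1N.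
have sACA (a b c e : 'cV[C]_N) : (a - b) - (c - e) = (a - c) - (b - e).
  by rewrite opprD addrACA -opprD.
have lin (a1 a2 b1 b2 c1 c2 : 'cV[C]_N) :
    (a1 - a2) - ((b1 - b2) - (c1 - c2)) = a1 - (b1 - c1) - (a2 - (b2 - c2)).
  by rewrite (sACA b1) sACA.
pose v x := v1 x - v2 x.
pose w (j : 'I_d) (x : E) := weakD j v1 x - weakD j v2 x.
pose z (j : 'I_d) (x : E) := weakD j (weakD j v1) x - weakD j (weakD j v2) x.
have vE m : cpart v m = fun x => cpart v1 m x - cpart v2 m x := cpartB v1 v2 m.
have wE j m : cpart (w j) m = fun x => cpart (weakD j v1) m x - cpart (weakD j v2) m x :=
  cpartB (weakD j v1) (weakD j v2) m.
have zE j m : cpart (z j) m = fun x => cpart (weakD j (weakD j v1)) m x - cpart (weakD j (weakD j v2)) m x :=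
  cpartB (weakD j (weakD j v1)) (weakD j (weakD j v2)) m.
have eqv : {ae mu, forall x, lambda *: v x -
    (A *m (\sum_j z j x) + \sum_j ((S *m x) j 0)%:C *: w j x - B *m v x) = 0}.
  apply: filterS2 e1 e2 => x E1 E2.
  have E0 : (lambda *: v1 x - Linfty A B S v1 x) - (lambda *: v2 x - Linfty A B S v2 x) = 0.
    by rewrite E1 E2 subrr.
  rewrite -[RHS]E0 /Linfty /L0 /drift /v /w /z.
  under [X in _ + X - _]eq_bigr do rewrite scalerBr.
  rewrite !sumrB !mulmxBr scalerBr [X in _ - (X - _)]addrACA -opprD.
  exact: lin.
have v12 x : v x = 0 -> v1 x = v2 x by move=> /eqP; rewrite subr_eq0 => /eqP.
clearbody v w z.
have nv0 : (\int[mu]_x (nrm (fun m => cpart (fun=> 0 : 'cV[C]_N) m x) `^ p)%:E = 0)%E.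
  rewrite (eq_integral (cst 0%E)) ?integral0// => x _.
  rewrite (_ : nrm _ = 0) ?powR0 ?gt_eqF//.
  by rewrite /nrm big1 ?sqrtr0// => m _; rewrite /cpart toR0 expr0n.
have mcomp (u : E -> 'cV[C]_N) : (forall m, locL1 (cpart u m)) ->
    measurable_fun setT (fun x => (nrm ((cpart u)^~ x) `^ p)%:E).
  move=> lu; apply/measurable_EFinP/(measurableT_comp (measurable_powR p)).
  by apply: measurable_nrm => m; case: (lu m).
have lv m : locL1 (cpart v m) by rewrite vE; exact: (locL1B _ _ (lv1 m) (lv2 m)).
have mn1 := mcomp _ lv1.
have mn2 := mcomp _ lv2.
have mn12 := emeasurable_funD mn1 mn2.
have fv : (\int[mu]_x (nrm ((cpart v)^~ x) `^ p)%:E < +oo)%E.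
  have [_ /(in_Lp_fin p1) f1 _] := d1; have [_ /(in_Lp_fin p1) f2 _] := d2.
  (* The difference is in L^p because (s + t)^p <= 2^p (s^p + t^p). *)
  apply: (@le_lt_trans _ _ (\int[mu]_x ((2 `^ p)%:E * ((nrm ((cpart v1)^~ x) `^ p)%:E + (nrm ((cpart v2)^~ x) `^ p)%:E)))%E).
    have mn := mcomp _ lv.
    have mn3 : measurable_fun setT (fun x => (2 `^ p)%:E *
        ((nrm ((cpart v1)^~ x) `^ p)%:E + (nrm ((cpart v2)^~ x) `^ p)%:E))%E.
      exact: emeasurable_funM (measurable_cst _) mn12.
    apply: ge0_le_integral; [exact: measurableT| |exact: mn|exact: mn3|].
    - by move=> x _; rewrite lee_fin powR_ge0.
    - move=> x _; rewrite -EFinD -EFinM lee_fin.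
      apply: le_trans (powRD_bound (ltW p0) (nrm_ge0 _) (nrm_ge0 _)).
      apply: ge0_ler_powR; rewrite ?nnegrE ?addr_ge0 ?nrm_ge0 ?(ltW p0)//.
      rewrite -(nrmN ((cpart v2)^~ x)); apply: le_trans (nrmD _ _).
      rewrite le_eqVlt; apply/orP; left; apply/eqP; congr nrm; apply/funext => m.
      by rewrite vE.
  have c0 : (0 <= (2 `^ p)%:E :> \bar R)%E by rewrite lee_fin powR_ge0.
  have n0 (u : E -> 'cV[C]_N) (x : E) : [set: E] x -> (0 <= (nrm ((cpart u)^~ x) `^ p)%:E)%E.
    by rewrite lee_fin powR_ge0.
  have -> := ge0_integralZl mu measurableT mn12 (fun x h => adde_ge0 (n0 v1 x h) (n0 v2 x h)) c0.
  have -> := ge0_integralD mu measurableT (n0 v1) mn1 (n0 v2) mn2.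
  have f12 := lte_add_pinfty f1 f2.
  exact: (lte_mul_pinfty c0 isT f12).
have lw j m : locL1 (cpart (w j) m).
  by rewrite wE; exact: (locL1B _ _ (lw1 j m) (lw2 j m)).
have lz j m : locL1 (cpart (z j) m).
  by rewrite zE; exact: (locL1B _ _ (lz1 j m) (lz2 j m)).
have l0 m : locL1 (cpart (fun=> 0 : 'cV[C]_N) m : E -> R).
  rewrite (_ : cpart _ m = cst 0); first exact: locL1_cst.
  by apply/funext => x; rewrite /cpart toR0.
have wv j m : weak_deriv j (cpart v m) (cpart (w j) m).
  rewrite vE wE.
  exact: (weak_derivB (lv1 m) (lv2 m) (lw1 j m) (lw2 j m) (wv1 j m) (wv2 j m)).
have ww j m : weak_deriv j (cpart (w j) m) (cpart (z j) m).
  rewrite wE zE.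
  exact: (weak_derivB (lw1 j m) (lw2 j m) (lz1 j m) (lz2 j m) (ww1 j m) (ww2 j m)).
have f0 : (\int[mu]_x (nrm ((cpart (fun=> 0 : 'cV[C]_N))^~ x) `^ p)%:E < +oo)%E by rewrite nv0.
have [H _] := resolvent_estimates lv lw lz l0 wv ww eqv fv f0.
have {}H : (\int[mu]_x (nrm ((cpart v)^~ x) `^ p)%:E = 0)%E.
  apply/eqP; rewrite eq_le; apply/andP; split; first by move: H; rewrite nv0 mule0.
  by apply: integral_ge0 => x _; rewrite lee_fin powR_ge0.
have /ae_eq_integral_abs : measurable_fun setT (fun x => (nrm ((cpart v)^~ x) `^ p)%:E) by exact: mcomp.
move=> /(_ mu measurableT)[h _].
have := h _; rewrite (eq_integral (fun x => (nrm ((cpart v)^~ x) `^ p)%:E)); last first.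
  by move=> x _; rewrite gee0_abs// lee_fin powR_ge0.
move=> /(_ H); apply: filterS => x /(_ I) [] /eqP.
rewrite powR_eq0 => /andP[/eqP/nrm_eq0 vx _].
apply: v12; apply: toR_inj; apply/funext => m.
by rewrite toR0; exact: (congr1 (@^~ m) vx).
Qed.

Hypothesis hg : in_Lp p g.

Let LpnormE' (v : E -> 'cV[C]_N) :
  (Lpnorm p v = (\int[mu]_x (nrm ((cpart v)^~ x) `^ p)%:E) `^ p^-1)%E.
Proof.
have pn0 : p != 0 by rewrite gt_eqF.
by rewrite -(LpnormE v pn0) -poweRrM mulfV// poweRe1//; exact: Lnorm_ge0.
Qed.

Let powR_mono (X : \bar R) (c y : R) : (0 <= X)%E -> 0 <= c -> 0 <= y ->
  (X <= (c * y)%:E)%E -> (X `^ p^-1 <= (c `^ p^-1)%:E * y%:E `^ p^-1)%E.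
Proof.
move=> X0 c0 y0 h; rewrite poweR_EFin -EFinM -powRM// -poweR_EFin.
by apply: gt0_ler_poweR; rewrite ?invr_ge0 ?(ltW p0)// in_itv/= ?leey ?andbT// lee_fin mulr_ge0.
Qed.

Lemma resolvent_bounds v : dom_loc p A S v -> resolvent_solution A B S lambda g v ->
  (Lpnorm p v <= (kap^-1)%:E * Lpnorm p g)%E /\
  (p <= 2 -> (W1p_seminorm p v <=
     (d%:R `^ p^-1 * gamma `^ (- 2^-1) / kap `^ 2^-1)%:E * Lpnorm p g)%E).
Proof.
move=> dv ev; have [lv lw lz wv ww] := in_domain dv.
have [_ hv _] := dv.
have fg := in_Lp_fin p1 hg.
have pn0 : p != 0 by rewrite gt_eqF.
have n0 (u : E -> 'cV[C]_N) : (0 <= \int[mu]_x (nrm ((cpart u)^~ x) `^ p)%:E)%E.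
  by apply: integral_ge0 => x _; rewrite lee_fin powR_ge0.
have [H1 H2] := resolvent_estimates lv lw lz (locL1_in_Lp p1 hg) wv ww ev (in_Lp_fin p1 hv) fg.
have [y yE] : exists y, (\int[mu]_x (nrm ((cpart g)^~ x) `^ p)%:E)%E = y%:E.
  by exists (fine (\int[mu]_x (nrm ((cpart g)^~ x) `^ p)%:E)%E); rewrite fineK// ge0_fin_numE.
have y0 : 0 <= y by rewrite -lee_fin -yE.
rewrite !LpnormE' yE; rewrite yE -EFinM in H1.
split=> [|p2].
  have := powR_mono (n0 v) (powR_ge0 _ _) y0 H1.
  by rewrite -powRrM mulNr mulfV// powR_inv1// ltW.
have {}H2 j : (Lpnorm p (weakD j v) `^ p <= ((gamma * kap) `^ (- (p / 2)) * y)%:E)%E.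
  by rewrite LpnormE// EFinM -yE; exact: H2.
rewrite /W1p_seminorm.
have S0 : (0 <= \sum_(j < d) Lpnorm p (weakD j v) `^ p)%E by apply: sume_ge0 => j _; exact: poweR_ge0.
(* The d directions have equal bounds; after the p-th root their number becomes the factor
   d^(1/p). *)
have H3 : (\sum_(j < d) Lpnorm p (weakD j v) `^ p <= (d%:R * (gamma * kap) `^ (- (p / 2)) * y)%:E)%E.
  apply: (@le_trans _ _ (\sum_(j < d) ((gamma * kap) `^ (- (p / 2)) * y)%:E)%E).
    by apply: lee_sum => j _; exact: H2.
  by rewrite sumEFin sumr_const card_ord -[X in X%:E]mulr_natl mulrA.
have c0 : 0 <= d%:R * (gamma * kap) `^ (- (p / 2)) by rewrite mulr_ge0// powR_ge0.
have := powR_mono S0 c0 y0 H3.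
rewrite powRM ?powR_ge0// -powRrM (_ : - (p / 2) * p^-1 = - 2^-1); last by field.
by rewrite powRM ?(ltW gamma0) ?(ltW kap0)// mulrA [X in _ * X]powRN.
Qed.

End resolvent.

Theorem theorem4p4 (R : realType) (d N : nat) (hd : (2 <= d)%N)
    (hN : (1 <= N)%N) (p : R) (hp : 1 < p)
    (A B : 'M[R[i]]_N) (S : 'M[R]_d) (hS : S^T = - S)
    (gammaA : R) (hgammaA : 0 < gammaA)
    (hA : forall z w : 'cV[R[i]]_N,
      gammaA * enorm z ^+ 2 * enorm w ^+ 2 <=
      enorm z ^+ 2 * complex.Re (inner w (A *m w)) +
      (p - 2) * complex.Re (inner w z) * complex.Re (inner z (A *m w)))
    (betaB : R)
    (hB : forall w : 'cV[R[i]]_N, enorm w = 1 ->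
      - betaB <= complex.Re (inner w (B *m w)))
    (lambda : R[i]) (hlambda : betaB < complex.Re lambda)
    (g : 'cV[R]_d -> 'cV[R[i]]_N) (hg : in_Lp p g)
    (vstar : 'cV[R]_d -> 'cV[R[i]]_N) (hdom : dom_loc p A S vstar)
    (hsol : resolvent_solution A B S lambda g vstar) :
  [/\ forall v : 'cV[R]_d -> 'cV[R[i]]_N, dom_loc p A S v ->
        resolvent_solution A B S lambda g v ->
        {ae lebesgue_cV d, forall x, v x = vstar x},
      (Lpnorm p vstar <= ((complex.Re lambda - betaB)^-1)%:E * Lpnorm p g)%E &
      p <= 2 ->
        (W1p_seminorm p vstar <=
         (d%:R `^ p^-1 * gammaA `^ (- 2^-1) /
          (complex.Re lambda - betaB) `^ 2^-1)%:E * Lpnorm p g)%E].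
Proof.
have [estimate gradient] := resolvent_bounds hp hgammaA hS hA hB hlambda hg hdom hsol.
split=> // v domv solv.
exact: (resolvent_unique hp hgammaA hS hA hB hlambda domv hdom solv hsol).
Qed.
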